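(* Assume that $k$ is uncountable. Let $X, Y$ be irreducible normal affine varieties over $k$ such that $\mathrm{Aut}(X)$ and $\mathrm{Aut}(Y)$ are isomorphic as abstract groups. If $X$ is toric and not isomorphic to an algebraic torus, then $Y$ is isomorphic to $X$ (as a variety over $k$).
   Context: $k$ is an algebraically closed field of characteristic zero. An algebraic torus is a variety isomorphic to $\mathbb{G}_m^n$ for some $n \ge 0$ (so a point counts as a torus). An affine variety $X$ is toric if it is normal, irreducible and admits a faithful algebraic action of an algebraic torus with a dense open orbit. $\mathrm{Aut}(X)$ is the group of automorphisms of the $k$-variety $X$. *)

(* Defs.v *)
From HB Require Import structures.
From mathcomp Require Import all_boot all_order all_algebra.
From mathcomp Require Import boolp classical_sets functions cardinality.
From mathcomp Require Import mpoly.

Set Implicit Arguments.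
Unset Strict Implicit.
Unset Printing Implicit Defensive.

Import GRing.Theory.
Local Open Scope classical_set_scope.
Local Open Scope ring_scope.

(* Over an algebraically closed field an affine variety is determined by its  *)
(* closed points, so it is represented by a Zariski closed subset of some     *)
(* affine space k^n.                                                          *)

Section ZariskiClosedSets.
Variable k : fieldType.

Definition zero_locus n (S : set {mpoly k[n]}) : set {ffun 'I_n -> k} :=
  [set x | forall p, S p -> p.@[x] = 0].

Structure affVariety := AffVariety {
  ambient_dim : nat;
  locus :> set {ffun 'I_ambient_dim -> k};
  locusP : exists S, locus = zero_locus S
}.

Implicit Types X Y Z : affVariety.

Definition vclosed X (C : set X) : Prop :=
  exists S : set {mpoly k[ambient_dim X]}, C = [set x | zero_locus S (\val x)].

Definition vopen X (U : set X) : Prop := vclosed (~` U).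

Definition vdense X (A : set X) : Prop :=
  forall C : set X, vclosed C -> A `<=` C -> C = setT.

Definition irreducible_variety X : Prop :=
  [set: X] !=set0 /\
  forall C D : set X, vclosed C -> vclosed D -> C `|` D = setT ->
    C = setT \/ D = setT.

Structure irrVariety := IrrVariety {
  irr_variety :> affVariety;
  irr_varietyP : irreducible_variety irr_variety
}.

Definition regular_function X (f : X -> k) : Prop :=
  exists p : {mpoly k[ambient_dim X]}, forall x : X, f x = p.@[\val x].

Definition is_morphism X Y (f : X -> Y) : Prop :=
  forall i, regular_function (fun x : X => \val (f x) i).

Definition is_isomorphism X Y (f : X -> Y) : Prop :=
  is_morphism f /\
  exists g : Y -> X, [/\ is_morphism g, cancel f g & cancel g f].

Definition isomorphic X Y : Prop := exists f : X -> Y, is_isomorphism f.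

Lemma regular_comp X Y (f : X -> Y) (g : Y -> k) :
  is_morphism f -> regular_function g -> regular_function (g \o f).
Proof.
move=> mf [q gq]; case: (choice mf) => p fp.
exists (q \mPo [tuple p i | i < ambient_dim Y]) => x.
rewrite /= gq comp_mpoly_meval; apply: meval_eq => i.
by rewrite tnth_mktuple fp.
Qed.

Lemma morphism_id X : is_morphism (@idfun X).
Proof. by move=> i; exists 'X_i => x; rewrite mevalXU. Qed.

Lemma morphism_comp X Y Z (f : X -> Y) (g : Y -> Z) :
  is_morphism f -> is_morphism g -> is_morphism (g \o f).
Proof. by move=> mf mg i; apply: (regular_comp mf (mg i)). Qed.

Lemma isomorphism_id X : is_isomorphism (@idfun X).
Proof. by split; [|exists idfun; split=> //]; exact: morphism_id. Qed.

Lemma isomorphism_comp X Y Z (f : X -> Y) (g : Y -> Z) :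
  is_isomorphism f -> is_isomorphism g -> is_isomorphism (g \o f).
Proof.
case=> mf [f' [mf' fK f'K]] [mg [g' [mg' gK g'K]]].
split; first exact: morphism_comp.
by exists (f' \o g'); split; [exact: morphism_comp|exact: can_comp..].
Qed.

End ZariskiClosedSets.
Arguments locus {k} X : rename.

Section AutomorphismGroup.
Variables (k : fieldType) (X : affVariety k).

Record AutV := MkAut {
  aut_fun :> X -> X;
  aut_funP : `[< is_isomorphism aut_fun >]
}.

HB.instance Definition _ := [isSub for aut_fun].
HB.instance Definition _ := [Choice of AutV by <:].

Lemma aut_inv_ex (f : AutV) : exists g : AutV, cancel f g /\ cancel g f.
Proof.
have /asboolP[mf [g [mg fK gK]]] := aut_funP f.
suff ig : `[< is_isomorphism g >] by exists (MkAut ig).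
by apply/asboolP; split=> //; exists f.
Qed.

Definition aut_id : AutV := MkAut (asboolT (isomorphism_id X)).
Definition aut_mul (f g : AutV) : AutV :=
  MkAut (asboolT (isomorphism_comp (asboolW (aut_funP g))
                                   (asboolW (aut_funP f)))).
Definition aut_inv (f : AutV) : AutV := sval (cid (aut_inv_ex f)).

Fact aut_mulA : associative aut_mul.
Proof. by move=> f g h; apply: val_inj. Qed.
Fact aut_mul1 : left_id aut_id aut_mul.
Proof. by move=> f; apply: val_inj. Qed.
Fact aut_1mul : right_id aut_id aut_mul.
Proof. by move=> f; apply: val_inj. Qed.
Fact aut_mulV : left_inverse aut_id aut_inv aut_mul.
Proof.
move=> f; apply: val_inj; apply/funext=> x /=.
by rewrite /aut_inv; case: cid => g [fK _] /=; rewrite fK.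
Qed.
Fact aut_Vmul : right_inverse aut_id aut_inv aut_mul.
Proof.
move=> f; apply: val_inj; apply/funext=> x /=.
by rewrite /aut_inv; case: cid => g [_ gK] /=; rewrite gK.
Qed.

HB.instance Definition _ :=
  isGroup.Build AutV aut_mulA aut_mul1 aut_1mul aut_mulV aut_Vmul.

End AutomorphismGroup.

Section CoordinateRing.
Variables (k : fieldType) (X : irrVariety k).

Definition regular_pred : pred (X -> k) := [pred f | `[< regular_function f >]].

Fact regular_subring : subring_closed regular_pred.
Proof.
split=> [|f g /asboolP[p fp] /asboolP[q gq]|f g /asboolP[p fp] /asboolP[q gq]].
- by apply/asboolP; exists 1 => x; rewrite meval1.
- by apply/asboolP; exists (p - q) => x; rewrite mevalB -fp -gq.
- by apply/asboolP; exists (p * q) => x; rewrite mevalM -fp -gq.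
Qed.
HB.instance Definition _ :=
  GRing.isSubringClosed.Build (X -> k) regular_pred regular_subring.

Record coord_ring := MkRegular {
  regular_fun :> X -> k;
  regular_funP : regular_fun \in regular_pred
}.

HB.instance Definition _ := [isSub for regular_fun].
HB.instance Definition _ := [Choice of coord_ring by <:].
HB.instance Definition _ :=
  GRing.SubChoice_isSubComPzRing.Build _ _ coord_ring
    (GRing.subringClosedP _).

Fact coord_ring_oner_neq0 : 1 != 0 :> coord_ring.
Proof.
have [[x _] _] := irr_varietyP X.
by apply/eqP => /(congr1 (fun f : coord_ring => f x)) /eqP; rewrite oner_eq0.
Qed.
HB.instance Definition _ :=
  GRing.PzSemiRing_isNonZero.Build coord_ring coord_ring_oner_neq0.

Definition coord_ring_unit : pred coord_ring :=
  [pred f | `[< exists g, g * f = 1 >]].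
Definition coord_ring_inv (f : coord_ring) : coord_ring :=
  if pselect (exists g, g * f = 1) is left ex then sval (cid ex) else f.

Fact coord_ring_mulVr : {in coord_ring_unit, left_inverse 1 coord_ring_inv *%R}.
Proof.
move=> f /asboolP fU; rewrite /coord_ring_inv; case: pselect => // ex.
by case: cid.
Qed.
Fact coord_ring_unitP (f g : coord_ring) : g * f = 1 -> coord_ring_unit f.
Proof. by move=> gf; apply/asboolP; exists g. Qed.
Fact coord_ring_inv_out : {in [predC coord_ring_unit], coord_ring_inv =1 id}.
Proof.
move=> f /asboolP fU; rewrite /coord_ring_inv.
by case: pselect => // ex; case: fU.
Qed.
HB.instance Definition _ := GRing.ComNzRing_hasMulInverse.Build coord_ring
  coord_ring_mulVr coord_ring_unitP coord_ring_inv_out.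

Lemma regular_zeros_closed (f : coord_ring) : vclosed [set x | f x = 0].
Proof.
have /asboolP[p fp] := regular_funP f.
exists [set p]; apply/seteqP; split=> x /=.
  by move=> fx q ->; rewrite -fp.
by move=> /(_ p erefl); rewrite -fp.
Qed.

Fact coord_ring_mulf_eq0 (f g : coord_ring) :
  f * g = 0 -> (f == 0) || (g == 0).
Proof.
move=> fg0; have [_ irrX] := irr_varietyP X.
have h0 (h : coord_ring) : [set x | h x = 0] = setT -> h = 0.
  move=> hT; apply: val_inj; apply/funext=> x.
  by have : [set x | h x = 0] x by rewrite hT.
have [|/h0->|/h0->] :=
    irrX _ _ (regular_zeros_closed f) (regular_zeros_closed g).
- apply/seteqP; split=> // x _.
  have /eqP := congr1 (fun h : coord_ring => h x) fg0.
  by rewrite mulf_eq0 => /orP[]/eqP; [left|right].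
- by rewrite eqxx.
- by rewrite eqxx orbT.
Qed.
HB.instance Definition _ := GRing.ComUnitRing_isIntegral.Build coord_ring
  coord_ring_mulf_eq0.

Definition normal_variety : Prop :=
  forall z : {fraction coord_ring},
    integralOver (@FracField.tofrac coord_ring) z ->
    exists f : coord_ring, z = FracField.tofrac f.

End CoordinateRing.

Section Product.
Variables (k : fieldType) (X Y : affVariety k).
Let m := ambient_dim X.
Let n := ambient_dim Y.

Definition ffun_fst (z : {ffun 'I_(m + n) -> k}) : {ffun 'I_m -> k} :=
  [ffun i => z (lshift n i)].
Definition ffun_snd (z : {ffun 'I_(m + n) -> k}) : {ffun 'I_n -> k} :=
  [ffun j => z (rshift m j)].

Definition prod_locus : set {ffun 'I_(m + n) -> k} :=
  [set z | locus X (ffun_fst z) /\ locus Y (ffun_snd z)].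

Fact prod_locusP : exists S, prod_locus = zero_locus S.
Proof.
have [S XS] := locusP X; have [T YT] := locusP Y.
pose f (p : {mpoly k[m]}) : {mpoly k[m + n]} :=
  p \mPo [tuple 'X_(lshift n i) | i < m].
pose g (p : {mpoly k[n]}) : {mpoly k[m + n]} :=
  p \mPo [tuple 'X_(rshift m i) | i < n].
have fE p (z : {ffun _}) : (f p).@[z] = p.@[ffun_fst z].
  rewrite comp_mpoly_meval; apply: meval_eq => i.
  by rewrite tnth_mktuple mevalXU ffunE.
have gE p (z : {ffun _}) : (g p).@[z] = p.@[ffun_snd z].
  rewrite comp_mpoly_meval; apply: meval_eq => i.
  by rewrite tnth_mktuple mevalXU ffunE.
exists ((f @` S) `|` (g @` T)); apply/seteqP; split=> z; rewrite /prod_locus /=.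
  rewrite XS YT => -[Xz Yz] _ [[p Sp <-]|[p Tp <-]].
    by rewrite fE; apply: Xz.
  by rewrite gE; apply: Yz.
move=> h; rewrite XS YT; split=> p Sp.
  by rewrite -fE; apply: h; left; exists p.
by rewrite -gE; apply: h; right; exists p.
Qed.

Definition prod_variety : affVariety k := AffVariety prod_locusP.

Definition prod_fst (z : prod_variety) : X :=
  SigSub (mem_set (set_mem (valP z)).1).
Definition prod_snd (z : prod_variety) : Y :=
  SigSub (mem_set (set_mem (valP z)).2).

End Product.

(* G_m^n is embedded in k^(n + n) by t |-> (t, t^-1).                         *)
Section Torus.
Variables (k : fieldType) (n : nat).

Definition torus_locus : set {ffun 'I_(n + n) -> k} :=
  [set t | forall i : 'I_n, t (lshift n i) * t (rshift n i) = 1].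

Fact torus_locusP : exists S, torus_locus = zero_locus S.
Proof.
exists [set 'X_(lshift n i) * 'X_(rshift n i) - 1 | i in [set: 'I_n]].
apply/seteqP; split=> t /= h.
  by move=> _ [i _ <-]; rewrite mevalB mevalM !mevalXU meval1 h subrr.
move=> i; have /eqP := h _ (ex_intro2 _ _ i I erefl).
by rewrite mevalB mevalM !mevalXU meval1 subr_eq0 => /eqP.
Qed.

Definition Gm : affVariety k := AffVariety torus_locusP.

Lemma GmP (t : Gm) i : \val t (lshift n i) * \val t (rshift n i) = 1.
Proof. exact: (set_mem (valP t)). Qed.

Fact torus_one_subproof : torus_locus [ffun=> 1].
Proof. by move=> i; rewrite !ffunE mulr1. Qed.
Definition torus_one : Gm := SigSub (mem_set torus_one_subproof).

Fact torus_mul_subproof (s t : Gm) :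
  torus_locus [ffun i => \val s i * \val t i].
Proof. by move=> i; rewrite !ffunE mulrACA !GmP mulr1. Qed.
Definition torus_mul (s t : Gm) : Gm :=
  SigSub (mem_set (torus_mul_subproof s t)).

End Torus.

Section Toric.
Variable k : fieldType.

Definition is_torus (X : affVariety k) : Prop :=
  exists n : nat, isomorphic X (Gm k n).

Definition torus_action n (X : affVariety k) (a : Gm k n -> X -> X) : Prop :=
  [/\ forall x, a (torus_one k n) x = x,
      forall s t x, a (torus_mul s t) x = a s (a t x)
    & is_morphism (fun z : prod_variety (Gm k n) X =>
                     a (prod_fst z) (prod_snd z))].

Definition faithful_action n (X : affVariety k) (a : Gm k n -> X -> X) : Prop :=
  forall t, (forall x, a t x = x) -> t = torus_one k n.

Definition torus_orbit n (X : affVariety k) (a : Gm k n -> X -> X) (x : X) :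
  set X := range (a^~ x).

Definition toric (X : irrVariety k) : Prop :=
  normal_variety X /\
  exists (n : nat) (a : Gm k n -> X -> X),
    [/\ torus_action a, faithful_action a
      & exists x, vopen (torus_orbit a x) /\ vdense (torus_orbit a x)].

End Toric.

(* Main.v *)
(* Choose a facet of the weight monoid S of the toric variety X. Its Demazure
   roots e give commuting one-parameter unipotent groups U_e in Aut(X),
   normalised by the torus T through the characters e.

   The image of U_e in Aut(Y) consists of unipotent automorphisms. Otherwise a
   maximal subspace of O(Y) stable under the image and missing all
   (v - 1)^j f yields a nontrivial character chi of (k, +). Since k is
   uncountable, infinitely many a in k have an image of bounded degree, and on
   an irreducible family of those every chi(t a) is a polynomial function. It
   has polynomial 2^i-th roots chi(t a / 2^i) for all i, hence is constant on
   the family (again by uncountability and Noetherianity), which is absurd.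

   So U_e acts on Y as exp(tau_e(a) d_e) with d_e locally nilpotent, and a
   double centraliser argument makes tau_e an automorphism of the field k.
   For f in ker d_e, exp(f d_e) comes from an automorphism of X centralising
   enough to be a product of root automorphisms of the same facet. Hence ker d_e
   is spanned by weight vectors of T with one-dimensional weight spaces, and all
   the tau_e agree. Integrating along d_e gives the same for O(Y).

   The weights of T on O(Y), read through tau, thus form a saturated monoid Q
   which spans the lattice; using all facets, Q is contained in S. Exchanging
   X and Y gives S = Q, so O(X) and O(Y) are both the monoid algebra k[S].
   Not being a torus means that S has a facet at all. *)

From HB Require Import structures.
Require Import Defs.
From mathcomp Require Import all_boot all_order all_algebra.
From mathcomp Require Import boolp classical_sets functions cardinality.
From mathcomp Require Import mpoly.
From mathcomp Require Import ring zify.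

Set Implicit Arguments.
Unset Strict Implicit.
Unset Printing Implicit Defensive.

Import Order.TTheory GRing.Theory Num.Theory.
Local Open Scope classical_set_scope.
Local Open Scope ring_scope.

(** * Noetherian rings and uncountable families *)

(** An abstract group isomorphism need not respect degrees, one-parameter subgroups or constants.
    What it does respect is commutation, so everything carried from X to Y is phrased through
    centralizers, and scalars come back only up to a field automorphism tau. The torus of X thus
    acts on O(Y) through characters twisted by tau; the twist disappears at the end, since two
    monoid algebras of the same monoid are identified over k through their monomials. Uncountability
    mostly enters by one trick, used three times. When V - z is invertible, in a suitable sense, for
    uncountably many scalars z, these inverses form an uncountable family in a space of countable
    dimension. A linear relation among them, cleared of denominators, is a nonzero polynomial
    relation for V, and it splits because k is algebraically closed. This gives the eigenvalues
    behind chi, the countability of the shifts that make a nonconstant function invertible, and the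
    surjectivity of the field endomorphism whose inverse is tau. *)

Section Noetherian.

Definition in_ideal (R : comNzRingType) (a : nat -> R) (m : nat) (x : R) : Prop :=
  exists r : nat -> R, x = \sum_(j < m) r j * a j.

(** The ascending chain condition for ideals generated by initial segments. Stating it on sequences
    suits the later proofs by contradiction, each of which builds one sequence that never
    stabilises. The case m = 0 means [a 0 = 0]. *)
Definition noetherian (R : comNzRingType) : Prop :=
  forall a : nat -> R, exists m, in_ideal a m (a m).

Variable R : comNzRingType.
Implicit Types (a : nat -> R) (x y : R).

Lemma in_ideal_gen a m i : (i < m)%N -> in_ideal a m (a i).
Proof.
move=> im; exists (fun j => (j == i)%:R).
rewrite (bigD1 (Ordinal im)) //= eqxx mul1r big1 ?addr0 // => j.
by rewrite -val_eqE /= => /negbTE ->; rewrite mul0r.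
Qed.

Lemma in_ideal0 a m : in_ideal a m 0.
Proof. by exists (fun=> 0); rewrite big1 // => j _; rewrite mul0r. Qed.

Lemma in_idealD a m x y :
  in_ideal a m x -> in_ideal a m y -> in_ideal a m (x + y).
Proof.
move=> [r ->] [s ->]; exists (fun j => r j + s j).
by rewrite -big_split; apply: eq_bigr => j _; rewrite mulrDl.
Qed.

Lemma in_idealM a m x y : in_ideal a m y -> in_ideal a m (x * y).
Proof.
move=> [r ->]; exists (fun j => x * r j).
by rewrite mulr_sumr; apply: eq_bigr => j _; rewrite mulrA.
Qed.

Lemma in_ideal_sum a m n (x : 'I_n -> R) :
  (forall i, in_ideal a m (x i)) -> in_ideal a m (\sum_(i < n) x i).
Proof.
by move=> ax; elim/big_ind: _ => //; [exact: in_ideal0 | exact: in_idealD].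
Qed.

Lemma in_ideal_trans a b m n x :
  (forall i, (i < m)%N -> in_ideal b n (a i)) -> in_ideal a m x ->
  in_ideal b n x.
Proof.
move=> ab [r ->]; apply: in_ideal_sum => i.
by apply: in_idealM; apply: ab.
Qed.

Lemma in_ideal_leq a m n x : (m <= n)%N -> in_ideal a m x -> in_ideal a n x.
Proof.
by move=> mn; apply: in_ideal_trans => i im; apply: in_ideal_gen (leq_trans im mn).
Qed.

End Noetherian.

Lemma noetherian_surj (R P : comNzRingType) (g : {rmorphism P -> R}) :
  (forall x, exists y, g y = x) -> noetherian P -> noetherian R.
Proof.
move=> /choice[h gh] nP a; have [m [r hr]] := nP (h \o a).
exists m, (g \o r); rewrite -[LHS]gh.
have /= -> := hr; rewrite rmorph_sum; apply: eq_bigr => j _.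
by rewrite rmorphM /= gh.
Qed.

Lemma noetherian_field (k : fieldType) : noetherian k.
Proof.
move=> a; have [a0|a0] := eqVneq (a 0%N) 0.
  by exists 0%N, a; rewrite big_ord0.
by exists 1%N, (fun=> a 1%N / a 0%N); rewrite big_ord1 divfK.
Qed.

(** Hilbert's basis theorem by minimal degrees. In the ideal [I] of a sequence that never
    stabilises, each [g i] has least degree among the elements outside the span of the previous
    ones; a relation between leading coefficients then contradicts minimality. *)
Lemma noetherian_poly (R : comNzRingType) :
  noetherian R -> noetherian {poly R}.
Proof.
move=> nR f; apply: contrapT => /forallNP nf.
pose I (x : {poly R}) := exists m, in_ideal f m x.
pose span (s : seq {poly R}) := in_ideal (nth 0 s) (size s).
have next s : (forall x, x \in s -> I x) ->
    exists x, [/\ I x, ~ span s x & forall y, I y -> ~ span s y ->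
      (size x <= size y)%N].
  move=> sI.
  have [J fJ] : exists J, forall i, (i < size s)%N -> in_ideal f J (nth 0 s i).
    elim: s sI {nf} => [|y s IH] sI; first by exists 0%N.
    have [|J fJ] := IH; first by move=> x xs; apply: sI; rewrite inE xs orbT.
    have [J' fJ'] := sI y (mem_head _ _).
    exists (maxn J J') => -[_|i /fJ] /=.
      by apply: in_ideal_leq fJ'; rewrite leq_maxr.
    by apply: in_ideal_leq; rewrite leq_maxl.
  have ex : exists n, `[< exists x, [/\ I x, ~ span s x & size x = n] >].
    exists (size (f J)); apply/asboolP; exists (f J); split=> //.
      by exists J.+1; apply: in_ideal_gen.
    by move=> sf; apply: (nf J); apply: in_ideal_trans sf.
  case: (ex_minnP ex) => n /asboolP[x [Ix sx <-]] xmin.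
  exists x; split=> // y Iy sy; apply: xmin; apply/asboolP.
  by exists y.
pose nxt s := if pselect (forall x, x \in s -> I x) is left h
  then sval (cid (next s h)) else 0.
have nxtP t : (forall x, x \in t -> I x) -> [/\ I (nxt t), ~ span t (nxt t)
    & forall y, I y -> ~ span t y -> (size (nxt t) <= size y)%N].
  by rewrite /nxt => tI; case: pselect => // h; case: cid.
pose s := fix s i := if i is j.+1 then rcons (s j) (nxt (s j)) else [::].
have sS i : s i.+1 = rcons (s i) (nxt (s i)) by [].
have sI i x : x \in s i -> I x.
  elim: i x => // i IH x; rewrite sS mem_rcons inE => /orP[/eqP->|/IH//].
  by rewrite /nxt; case: pselect => // h; case: cid => y [].
pose g i := nxt (s i).
have gP i : [/\ I (g i), ~ span (s i) (g i) & forall y, I y -> ~ span (s i) y ->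
      (size (g i) <= size y)%N].
  exact: nxtP (sI i).
have size_s i : size (s i) = i by elim: i => // i IH; rewrite sS size_rcons IH.
have nth_s i j : (j < i)%N -> nth 0 (s i) j = g j.
  elim: i => // i IH; rewrite sS nth_rcons size_s ltnS leq_eqVlt.
  by case/orP => [/eqP->|ji]; [rewrite ltnn eqxx | rewrite ji IH].
have spanE i x : span (s i) x <-> in_ideal g i x.
  rewrite /span size_s; split; apply: in_ideal_trans => j ji.
    by rewrite nth_s //; apply: in_ideal_gen.
  by rewrite -(nth_s _ _ ji); apply: in_ideal_gen.
have [m [r gr]] := nR (fun i => lead_coef (g i)).
have [Im gm minm] := gP m.
have szg j : (j < m)%N -> (size (g j) <= size (g m))%N.
  move=> jm; have [_ _] := gP j; apply=> // /spanE gj; apply: gm; apply/spanE.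
  by apply: in_ideal_leq gj; apply: ltnW.
have gm0 : g m != 0 by apply/eqP=> gm0; apply: gm; rewrite gm0; apply: in_ideal0.
(* By [gr], [z] has the same leading term as [g m], so [g m - z] is a smaller element of [I] that is
   still outside the span. *)
pose z := \sum_(j < m) (r j *: 'X^(size (g m) - size (g j))) * g j.
have zs : in_ideal g m z by exists (fun j => r j *: 'X^(size (g m) - size (g j))).
have Iz : I z.
  have [J fJ] : exists J, forall i, (i < m)%N -> in_ideal f J (g i).
    elim: (m) => [|n [J fJ]]; first by exists 0%N.
    have [[J' fJ'] _ _] := gP n.
    exists (maxn J J') => i; rewrite ltnS leq_eqVlt => /orP[/eqP->|/fJ].
      by apply: in_ideal_leq fJ'; rewrite leq_maxr.
    by apply: in_ideal_leq; rewrite leq_maxl.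
  by exists J; apply: in_ideal_trans zs.
have Iy : I (g m - z).
  have [[J1 h1] [J2 h2]] := (Im, Iz); exists (maxn J1 J2).
  apply: in_idealD; first by apply: in_ideal_leq h1; rewrite leq_maxl.
  rewrite -mulN1r; apply: in_idealM.
  by apply: in_ideal_leq h2; rewrite leq_maxr.
have := minm _ Iy; move/(_ _)/wrap => [].
  move=> /spanE h; apply: gm; apply/spanE.
  by rewrite -[g m](subrK z); apply: in_idealD.
apply/negP; rewrite -ltnNge.
rewrite [ltnRHS](_ : _ = (size (g m)).-1.+1); last first.
  by rewrite prednK // lt0n size_poly_eq0.
rewrite ltnS; apply/leq_sizeP => i; rewrite leq_eqVlt => /orP[/eqP<-|].
  rewrite coefB [_`_(_.-1)]gr coef_sum -sumrB big1 // => j _.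
  rewrite -scalerAl coefZ coefXnM.
  have jm := szg _ (ltn_ord j).
  have gj0 : (0 < size (g j))%N.
    rewrite lt0n size_poly_eq0; apply/eqP => gj0.
    by have [_ + _] := gP j; rewrite gj0; apply; apply: in_ideal0.
  rewrite ifF; last by apply/negbTE; rewrite -leqNgt; lia.
  by rewrite (_ : (_ - _)%N = (size (g j)).-1) ?subrr //; lia.
rewrite prednK ?lt0n ?size_poly_eq0 // => gmi.
rewrite coefB nth_default // coef_sum big1 ?subr0 // => j _.
rewrite -scalerAl coefZ coefXnM.
have jm := szg _ (ltn_ord j).
case: ifP => _; first by rewrite mulr0.
rewrite nth_default ?mulr0 //; apply: leq_trans (leq_sub2r _ gmi); rewrite subKn //.
Qed.

Lemma mpoly_surj (k : comNzRingType) n (P : comNzRingType)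
    (g : {rmorphism P -> {mpoly k[n]}}) :
  (forall a, exists y, g y = a%:MP) -> (forall i, exists y, g y = 'X_i) ->
  forall p, exists y, g y = p.
Proof.
move=> gC /choice[h gh] p; elim/mpolyind: p => [|a m p _ _ [y <-]].
  by exists 0; rewrite rmorph0.
have [z gz] := gC a.
exists (z * \prod_(i < n) h i ^+ m i + y).
rewrite rmorphD rmorphM rmorph_prod /= gz mul_mpolyC mpolyXE_id.
by congr (_ *: _ + _); apply: eq_bigr => i _; rewrite rmorphXn /= gh.
Qed.

(** Evaluating at the last variable maps [{poly {mpoly k[n]}}] onto [{mpoly k[n.+1]}], and
    noetherianity passes to images. *)
Lemma noetherian_mpoly (k : fieldType) n : noetherian {mpoly k[n]}.
Proof.
elim: n => [|n /noetherian_poly nP].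
  apply: (@noetherian_surj _ k (@mpolyC 0 k)) (@noetherian_field k).
  by apply: mpoly_surj => [a|[]//]; exists a.
pose g : {rmorphism {poly {mpoly k[n]}} -> {mpoly k[n.+1]}} :=
  horner_eval 'X_ord_max \o map_poly (@mwiden n k).
apply: (@noetherian_surj _ _ g) nP; apply: mpoly_surj => [a|i].
  by exists (a%:MP)%:P; rewrite /g /= map_polyC /horner_eval hornerC /= mwidenC.
have [j ->|->] := unliftP ord_max i; last first.
  by exists 'X; rewrite /g /= map_polyX /horner_eval hornerX.
exists ('X_j)%:P; rewrite /g /= map_polyC /horner_eval hornerC /= mwidenX mnmwiden1.
by congr 'X__; apply: val_inj => /=; rewrite /bump leqNgt ltn_ord.
Qed.

Section Uncountable.

Lemma uncountable_bounded (T : Type) (C : set T) (d : T -> nat) :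
  ~ countable C -> exists m, ~ countable (C `&` [set x | (d x <= m)%N]).
Proof.
move=> nC; apply: contrapT => /forallNP h; apply: nC.
have -> : C = \bigcup_(m in [set: nat]) (C `&` [set x | (d x <= m)%N]).
  apply/seteqP; split=> [x Cx|x [m _ []//]].
  by exists (d x) => //; split => /=.
by apply: bigcup_countable => // m _; apply: contrapT (h m).
Qed.

Lemma uncountable_infinite (T : Type) (C : set T) :
  ~ countable C -> infinite_set C.
Proof. by move=> nC /finite_set_countable. Qed.

Lemma infinite_inj (T : Type) (C : set T) : infinite_set C ->
  exists2 c : nat -> T, injective c & forall n, C (c n).
Proof.
move=> /infiniteP /card_leP[f]; exists (fun n => \val (f (to_setT n))).
  by move=> i j /val_inj /(in2TT 'inj_f) /(congr1 \val).
by move=> n; apply: set_mem (valP (f (to_setT n))).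
Qed.

(** Tuples of polynomials form a space of countable dimension: infinitely many members of the family
    share a degree bound and lie in one finite-dimensional space. One coefficient vector serves all
    [r] components at once, which later kills a derivation on all generators simultaneously. *)
Lemma uncountable_dep (k : fieldType) (T : Type) (C : set T) (r N : nat)
    (F : T -> 'I_r -> {mpoly k[N]}) : ~ countable C ->
  exists m (x : 'I_m -> T) (a : 'I_m -> k),
    [/\ injective x, forall i, C (x i), exists i, a i != 0 &
        forall l, \sum_i a i *: F (x i) l = 0].
Proof.
move=> nC.
have [d /uncountable_infinite /infinite_inj[c cI cC]] :=
  uncountable_bounded (fun x => \max_l msize (F x l)) nC.
pose I : finType := ('I_r * 'X_{1..N < d})%type.
(* One row more than there are coefficients below the degree bound, so the rows are dependent. *)
pose M : 'M[k]_(#|I|.+1, #|I|) :=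
  \matrix_(i, j) let z : I := enum_val j in (F (c i) z.1)@_(val z.2).
have : kermx M != 0.
  rewrite kermx_eq0; apply/negP => /eqP rM.
  by have := rank_leq_col M; rewrite rM ltnn.
case/rowV0Pn => v /sub_kermxP vM v0.
exists #|I|.+1, (fun i => c i), (fun i => v 0 i); split.
- by move=> i j /cI /val_inj.
- by move=> i; have [] := cC i.
- apply: contrapT => /forallNP h; case/eqP: v0; apply/rowP => i.
  by rewrite mxE; apply/eqP; apply: contrapT => /negP; apply: h.
- move=> l; apply/mpolyP => m; rewrite raddf_sum /= mcoeff0.
  have [md|md] := ltnP (mdeg m) d.
    have := congr1 (fun A : 'rV_#|I| => A 0 (enum_rank (l, BMultinom md))) vM.
    rewrite [RHS]mxE mxE; apply: etrans; apply: eq_bigr => i _.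
    by rewrite mcoeffZ mxE enum_rankK.
  rewrite big1 // => i _; rewrite mcoeffZ memN_msupp_eq0 ?mulr0 //.
  apply: contraL md => /msize_mdeg_lt lt; rewrite -ltnNge.
  apply: leq_trans lt _; have [_ /=] := cC i; apply: leq_trans.
  exact: (leq_bigmax l).
Qed.

End Uncountable.

Section LagrangeCombination.
Variables (k : fieldType) (m : nat) (a x : 'I_m -> k).

(* The numerator of the partial fraction [\sum_j a j / (X - x j)]. *)
Definition lagrange_comb : {poly k} :=
  \sum_j a j *: \prod_(l | l != j) ('X - (x l)%:P).

(** Evaluation at the node [x j] keeps only the [j]-th summand. *)
Lemma lagrange_comb_neq0 : injective x -> (exists j, a j != 0) ->
  lagrange_comb != 0.
Proof.
move=> xI [j aj]; apply/eqP => /(congr1 (fun p => p.[x j])) /eqP.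
rewrite horner0 horner_sum (bigD1 j) //= [X in _ + X]big1 ?addr0 => [|i ij].
  rewrite hornerZ mulf_eq0 (negbTE aj) horner_prod /= prodf_seq_eq0.
  case/hasP => l _ /andP[lj]; rewrite !hornerE subr_eq0 => /eqP /xI jl.
  by rewrite jl eqxx in lj.
rewrite hornerZ horner_prod (bigD1 j) 1?eq_sym //=.
by rewrite hornerXsubC subrr mul0r mulr0.
Qed.

End LagrangeCombination.

(** * Subspaces, weight vectors and linear functionals *)

Section Weights.
Variables (k : fieldType) (R : pzRingType) (c : {rmorphism k -> R}).

Definition klinear (g : R -> R) : Prop :=
  (forall x y, g (x + y) = g x + g y) /\ (forall a x, g (c a * x) = c a * g x).

Definition subspace (N : set R) : Prop :=
  [/\ N 0, forall x y, N x -> N y -> N (x + y) & forall a x, N x -> N (c a * x)].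

Lemma subspaceB N x y : subspace N -> N x -> N y -> N (x - y).
Proof.
move=> [_ ND NZ] Nx Ny; apply: ND => //.
by rewrite -mulN1r -(rmorph1 c) -rmorphN; apply: NZ.
Qed.

Lemma subspace_sum N (I : Type) (r : seq I) (P : pred I) (x : I -> R) :
  subspace N -> (forall i, P i -> N (x i)) -> N (\sum_(i <- r | P i) x i).
Proof. by move=> [N0 ND _] Nx; elim/big_ind: _. Qed.

Lemma klinear0 g : klinear g -> g 0 = 0.
Proof. by case=> gD _; apply: (addIr (g 0)); rewrite -gD !add0r. Qed.

Lemma klinearB g x y : klinear g -> g (x - y) = g x - g y.
Proof.
move=> gl; case: (gl) => gD _; apply: (addIr (g y)).
by rewrite -gD !subrK.
Qed.

Lemma klinear_sum g (I : Type) (r : seq I) (P : pred I) (x : I -> R) :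
  klinear g -> g (\sum_(i <- r | P i) x i) = \sum_(i <- r | P i) g (x i).
Proof. by move=> gl; apply: (big_morph g) => [y z|]; [case: gl | exact: klinear0]. Qed.

(** The operator [g t - w j t] kills [x j], preserves the other weight lines and multiplies [x i] by
    a nonzero scalar, which shortens the sum. The operators are merely linear, so the lemma also
    covers conjugation on a space of derivations and translation on a space of functions. *)
Lemma weight_component (U : Type) (I : eqType) (g : U -> R -> R)
    (w : I -> U -> k) (x : I -> R) (N : set R) (r : seq I) :
  (forall t, klinear (g t)) -> subspace N -> (forall t y, N y -> N (g t y)) ->
  uniq r ->
  {in r &, forall i j, i != j -> exists t, w i t != w j t} ->
  {in r, forall i t, g t (x i) = c (w i t) * x i} ->
  N (\sum_(i <- r) x i) -> {in r, forall i, N (x i)}.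
Proof.
move=> gl Nsub Ng; have [n] := ubnP (size r).
elim: n r x => // n IH r x; rewrite ltnS => szr ur wr gx Nr i ir.
have [/eqP si|] := boolP (r == [:: i]).
  by move: Nr; rewrite si big_seq1.
move=> ri; have [j jr ji] : exists2 j, j \in r & j != i.
  have : has (predC1 i) r.
    apply: contraNT ri => /hasPn h.
    case: r ir ur {szr wr gx Nr} h => // a [|b s] //= ir ur h.
      by move: ir; rewrite inE => /eqP->.
    have := h a (mem_head _ _); have := h b; rewrite !inE eqxx orbT /= !negbK.
    by move=> /(_ isT) /eqP bi /eqP ai; move: ur; rewrite ai bi inE eqxx.
  by case/hasP => j jr ji; exists j.
have [t wt] := wr _ _ jr ir ji.
have wij : w i t - w j t != 0 by rewrite subr_eq0 eq_sym.
pose x' l := c (w l t - w j t) * x l.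
suff : N (x' i).
  case: Nsub => _ _ NZ /(NZ (w i t - w j t)^-1).
  by rewrite /x' mulrA -rmorphM mulVf // rmorph1 mul1r.
have iremj : i \in rem j r by rewrite mem_rem_uniq // !inE eq_sym ji.
apply: (IH (rem j r)) => //.
- by rewrite size_rem // -ltnS prednK // -has_predT; apply/hasP; exists j.
- exact: rem_uniq.
- by move=> a b /mem_rem ar /mem_rem br; apply: wr.
- move=> l /mem_rem lr s; rewrite /x'; case: (gl s) => _ ->.
  by rewrite gx // !mulrA -!rmorphM mulrC.
have -> : \sum_(l <- rem j r) x' l =
    g t (\sum_(l <- r) x l) - c (w j t) * \sum_(l <- r) x l.
  rewrite klinear_sum // mulr_sumr -sumrB.
  rewrite [RHS](perm_big _ (perm_to_rem jr)) big_cons gx // subrr /= add0r.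
  rewrite big_seq [RHS]big_seq; apply: eq_bigr => l /mem_rem lr.
  by rewrite gx // /x' rmorphB mulrBl.
apply: subspaceB => //; first exact: Ng.
by case: Nsub => _ _; apply.
Qed.

End Weights.

(** Zorn's lemma is run on the sets whose union with [A0] satisfies [P]. The empty chain then
    corresponds to [A0] itself, so [Pchain] is only asked about nonempty chains. *)
Lemma Zorn_above (T : Type) (P : set (set T)) (A0 : set T) : P A0 ->
  (forall F : set (set T), F !=set0 -> F `<=` P -> total_on F subset ->
    P (\bigcup_(X in F) X)) ->
  exists A, [/\ P A, A0 `<=` A & forall B, A `<=` B -> P B -> B `<=` A].
Proof.
move=> PA0 Pchain.
have [|A [PA Amax]] := @Zorn_bigcup T [set X | P (A0 `|` X)].
  move=> F FP Ftot /=; have [F0|] := pselect (F !=set0); last first.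
    by move/set0P/negP; rewrite negbK => /eqP->; rewrite bigcup_set0 setU0.
  have -> : A0 `|` \bigcup_(X in F) X =
      \bigcup_(Y in [set A0 `|` X | X in F]) Y.
    apply/seteqP; split=> x.
      move=> [A0x|[X FX Xx]]; last by exists (A0 `|` X); [exists X | right].
      by case: F0 => X FX; exists (A0 `|` X); [exists X | left].
    by move=> [_ [X FX <-]] [?|?]; [left | right; exists X].
  apply: Pchain => [|_ [X FX <-]|_ _ [X FX <-] [Y FY <-]].
  - by case: F0 => X FX; exists (A0 `|` X); exists X.
  - exact: FP.
  - by have [XY|YX] := Ftot _ _ FX FY; [left | right]; apply: setUS.
exists (A0 `|` A); split=> // B AB PB; apply: contrapT => nBA.
apply: (Amax B); last by rewrite /= setUidr // => x A0x; apply: AB; left.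
split=> [x Ax|BA]; first by apply: AB; right.
by apply: nBA => x /BA; right.
Qed.

Section Functional.
Variables (k : fieldType) (R : pzRingType) (c : {rmorphism k -> R}).

Lemma subspace_chain (F : set (set R)) : F !=set0 ->
  (forall N, F N -> subspace c N) -> total_on F subset ->
  subspace c (\bigcup_(N in F) N).
Proof.
move=> [N0 FN0] Fsub Ftot; split=> [|x y [X FX Xx] [Y FY Yy]|a x [X FX Xx]].
- by exists N0 => //; case: (Fsub _ FN0).
- have [XY|YX] := Ftot _ _ FX FY.
    by exists Y => //; case: (Fsub _ FY) => _ D _; apply: D => //; apply: XY.
  by exists X => //; case: (Fsub _ FX) => _ D _; apply: D => //; apply: YX.
- by exists X => //; case: (Fsub _ FX) => _ _; apply.
Qed.

(** A subspace [H] containing [N] and maximal among those missing [f] is a complement of the line of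
    [f]; the functional reads off the coefficient of [f] modulo [H]. *)
Lemma functional_ex (N : set R) (f : R) : subspace c N -> ~ N f ->
  exists l : R -> k, [/\ forall x y, l (x + y) = l x + l y,
    forall a x, l (c a * x) = a * l x, forall x, N x -> l x = 0 & l f = 1].
Proof.
move=> Nsub Nf.
have [||H [[Hsub Hf] NH Hmax]] := @Zorn_above R [set X | subspace c X /\ ~ X f] N.
- by [].
- move=> F F0 FP Ftot; split; last by move=> [X /FP[]].
  by apply: subspace_chain => // X /FP[].
have [H0 HD HZ] := Hsub.
have HB := subspaceB Hsub.
have ex x : exists a, H (x - c a * f).
  have [Hx|Hx] := pselect (H x).
    by exists 0; rewrite rmorph0 mul0r subr0.
  have [a [h [Hh fE]]] : exists a h, H h /\ f = h + c a * x.
    apply: contrapT => nex; apply: Hx.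
    apply: (Hmax [set y | exists a h, H h /\ y = h + c a * x]).
    - by move=> h Hh; exists 0, h; rewrite rmorph0 mul0r addr0.
    - split=> //; split.
      + by exists 0, 0; rewrite rmorph0 mul0r addr0.
      + move=> _ _ [a [h [Hh ->]]] [b [g [Hg ->]]]; exists (a + b), (h + g).
        by split; [apply: HD | rewrite rmorphD mulrDl addrACA].
      + move=> b _ [a [h [Hh ->]]]; exists (b * a), (c b * h).
        by split; [apply: HZ | rewrite rmorphM mulrDr mulrA].
    - by exists 1, 0; rewrite rmorph1 mul1r add0r.
  have a0 : a != 0.
    by apply/eqP => a0; apply: Hf; rewrite fE a0 rmorph0 mul0r addr0.
  exists a^-1; rewrite fE mulrDr mulrA -rmorphM mulVf // rmorph1 mul1r.
  rewrite opprD addrCA subrr addr0 -mulNr -rmorphN; exact: HZ.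
have uniq x a b : H (x - c a * f) -> H (x - c b * f) -> a = b.
  move=> Ha Hb; apply/eqP; rewrite -subr_eq0; apply: contrapT => /negP ab.
  apply: Hf; rewrite -[f]mul1r -(rmorph1 c) -(mulVf ab) rmorphM -mulrA.
  apply: HZ; rewrite rmorphB mulrBl.
  suff <- : (x - c b * f) - (x - c a * f) = c a * f - c b * f by apply: HB.
  by rewrite opprB addrC addrA subrK.
have [l lP] := choice ex; exists l; split=> [x y|a x|x Nx|].
- apply: (uniq (x + y)) => //.
  by rewrite rmorphD mulrDl opprD addrACA; apply: HD.
- by apply: (uniq (c a * x)) => //; rewrite rmorphM -mulrA -mulrBr; apply: HZ.
- by apply: (uniq x) => //; rewrite rmorph0 mul0r subr0; apply: NH.
- by apply: (uniq f) => //; rewrite rmorph1 mul1r subrr.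
Qed.

End Functional.

(** * Algebra automorphisms and polynomials in an operator *)

Section Automorphisms.
Variables (k : fieldType) (R : comNzRingType) (c : {rmorphism k -> R}).

(** Endomorphisms stay plain functions, so that a group isomorphism can be given as a map [Phi] on
    functions, constrained only on those satisfying [kaut], and extensionality yields equalities
    between composites. *)
Definition kend (f : R -> R) : Prop :=
  [/\ forall x y, f (x + y) = f x + f y, forall x y, f (x * y) = f x * f y
    & forall a, f (c a) = c a].

Definition kaut (f : R -> R) : Prop := kend f /\ bijective f.

Lemma kend_klinear f : kend f -> klinear c f.
Proof. by move=> [fD fM fc]; split=> // a x; rewrite fM fc. Qed.

Lemma kend1 f : kend f -> f 1 = 1.
Proof. by move=> [_ _ fc]; rewrite -(rmorph1 c) fc. Qed.

Lemma kendB f : kend f -> {morph f : x y / x - y}.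
Proof.
by move=> fe x y; have [fD fM fc] := fe; rewrite fD -mulN1r -(rmorph1 c) -rmorphN
  fM fc rmorphN rmorph1 mulN1r.
Qed.

Lemma kend_rmorph f : kend f -> exists g : {rmorphism R -> R}, f =1 g.
Proof.
move=> fe; have [fD fM fc] := fe.
pose m1 := GRing.isZmodMorphism.Build R R f (kendB fe).
pose m2 := GRing.isMonoidMorphism.Build R R f (conj (kend1 fe) fM).
pose g : {rmorphism R -> R} := HB.pack_for {rmorphism R -> R} f m1 m2.
by exists g.
Qed.

Lemma kend_comp f g : kend f -> kend g -> kend (f \o g).
Proof.
move=> [fD fM fc] [gD gM gc]; split=> [x y|x y|a] /=; first by rewrite gD fD.
  by rewrite gM fM.
by rewrite gc fc.
Qed.

Lemma kaut_id : kaut id. Proof. by split=> //; exists id. Qed.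

Lemma kaut_comp f g : kaut f -> kaut g -> kaut (f \o g).
Proof. by move=> [? ?] [? ?]; split; [apply: kend_comp | apply: bij_comp]. Qed.

Lemma kaut_inv f : kaut f -> exists g, [/\ kaut g, cancel f g & cancel g f].
Proof.
move=> [[fD fM fc] [g fK gK]]; exists g; split=> //; split; last by exists f.
split=> [x y|x y|a]; apply: (can_inj fK); rewrite ?gK ?fD ?fM ?fc ?gK //.
Qed.

Lemma rmorph_mmap (S T : comNzRingType) (h : {rmorphism S -> T}) (N : nat)
    (K : nzRingType) (e : {rmorphism K -> S}) (y : 'I_N -> S) (F : {mpoly K[N]}) :
  h (mmap e y F) = mmap (h \o e) (h \o y) F.
Proof.
rewrite /mmap rmorph_sum; apply: eq_bigr => m _; rewrite rmorphM /=.
by congr (_ * _); rewrite /mmap1 rmorph_prod; apply: eq_bigr => i _; rewrite rmorphXn.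
Qed.

Lemma kend_mmap f N (y : 'I_N -> R) F : kend f ->
  f (mmap c y F) = mmap c (f \o y) F.
Proof.
move=> fe; have [_ _ fc] := fe; have [g fg] := kend_rmorph fe.
rewrite fg rmorph_mmap; apply: eq_bigr => m _ /=; rewrite -fg fc.
by congr (_ * _); apply: eq_bigr => i _; rewrite /= fg.
Qed.

Definition generates N (y : 'I_N -> R) : Prop := forall b, exists F, b = mmap c y F.

Lemma uncountable_dep_gen N (y : 'I_N -> R) (T : Type) (C : set T) (r : nat)
    (x : T -> 'I_r -> R) : generates y -> ~ countable C ->
  exists m (z : 'I_m -> T) (a : 'I_m -> k),
    [/\ injective z, forall i, C (z i), exists i, a i != 0 &
        forall l, \sum_i c (a i) * x (z i) l = 0].
Proof.
move=> gen nC.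
have /choice[F FP] t : exists F : 'I_r -> _, forall l, x t l = mmap c y (F l).
  by have [F FE] := choice (fun l => gen (x t l)); exists F.
have [m [z [a [zI zC a0 rel]]]] := uncountable_dep F nC.
exists m, z, a; split=> // l.
have := congr1 (mmap c y) (rel l); rewrite rmorph0 rmorph_sum => {2}<-.
by apply: eq_bigr => i _; rewrite FP -mul_mpolyC rmorphM /= mmapC.
Qed.

End Automorphisms.

Section PolynomialOfOperator.
Variables (k : fieldType) (R : comNzRingType) (c : {rmorphism k -> R}).
Variables (v : R -> R) (vl : klinear c v).

Definition op_eval (p : {poly k}) (x : R) : R :=
  \sum_(i < size p) c p`_i * iter i v x.

Lemma op_eval_widen n (p : {poly k}) x : (size p <= n)%N ->
  op_eval p x = \sum_(i < n) c p`_i * iter i v x.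
Proof.
move=> pn; rewrite /op_eval (big_ord_widen n (fun i => c p`_i * iter i v x)) //.
rewrite big_mkcond; apply: eq_bigr => i _; case: ltnP => // ip.
by rewrite nth_default // rmorph0 mul0r.
Qed.

Lemma op_evalD p q x : op_eval (p + q) x = op_eval p x + op_eval q x.
Proof.
rewrite !(@op_eval_widen (maxn (size p) (size q))) ?leq_maxl ?leq_maxr ?size_polyD //.
rewrite -big_split; apply: eq_bigr => i _ /=.
by rewrite coefD rmorphD mulrDl.
Qed.

Lemma op_evalZ a p x : op_eval (a *: p) x = c a * op_eval p x.
Proof.
rewrite (@op_eval_widen (size p)) ?size_scale_leq // mulr_sumr.
by apply: eq_bigr => i _; rewrite coefZ rmorphM mulrA.
Qed.

Lemma op_eval0 x : op_eval 0 x = 0.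
Proof. by rewrite /op_eval size_poly0 big_ord0. Qed.

Lemma op_eval1 x : op_eval 1 x = x.
Proof. by rewrite /op_eval size_poly1 big_ord1 coef1 rmorph1 mul1r. Qed.

Lemma op_evalX p x : op_eval ('X * p) x = v (op_eval p x).
Proof.
rewrite (@op_eval_widen (size p).+1); last first.
  have [->|p0] := eqVneq p 0; first by rewrite mulr0 size_poly0.
  by rewrite mulrC size_mulX.
rewrite big_ord_recl coefXM eqxx rmorph0 mul0r add0r (klinear_sum _ _ _ vl).
by apply: eq_bigr => i _; rewrite lift0 coefXM /=; case: vl => _ ->.
Qed.

Lemma op_eval_XsubC z p x :
  op_eval (('X - z%:P) * p) x = v (op_eval p x) - c z * op_eval p x.
Proof.
rewrite mulrBl mul_polyC op_evalD op_evalX; congr (_ + _).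
by rewrite -scaleN1r op_evalZ op_evalZ rmorphN1 mulN1r.
Qed.

Lemma op_eval_klinear p : klinear c (op_eval p).
Proof.
have it i : klinear c (iter i v).
  elim: i => // i [D Z]; case: vl => vD vZ.
  by split=> *; rewrite !iterS ?D ?Z ?vD ?vZ.
split=> [x y|a x].
  by rewrite -big_split; apply: eq_bigr => i _; case: (it i) => -> _; rewrite mulrDr.
rewrite mulr_sumr; apply: eq_bigr => i _; case: (it i) => _ ->.
by rewrite mulrCA.
Qed.

Lemma op_eval_comm p g : klinear c g -> (forall x, g (v x) = v (g x)) ->
  forall x, g (op_eval p x) = op_eval p (g x).
Proof.
move=> gl gv x; rewrite (klinear_sum _ _ _ gl); apply: eq_bigr => i _.
case: gl => _ ->; congr (_ * _).
by elim: (i : nat) => // j IH; rewrite !iterS gv IH.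
Qed.

Lemma op_eval_prodE p q x : op_eval (p * q) x = op_eval p (op_eval q x).
Proof.
elim/poly_ind: p => [|p a IH] in q x *; first by rewrite mul0r !op_eval0.
rewrite mulrDl op_evalD mul_polyC op_evalZ [p * 'X]mulrC -mulrA op_evalX IH.
by rewrite op_evalD op_evalX -[a%:P]mulr1 mul_polyC op_evalZ op_eval1.
Qed.

End PolynomialOfOperator.

(** * A character from a group action that is not unipotent *)

Section Character.
Variables (k : closedFieldType) (R : comNzRingType) (c : {rmorphism k -> R}).
Variables (N : nat) (y : 'I_N -> R).
Hypothesis k_unc : ~ countable [set: k].
Hypothesis y_gen : generates c y.

Variables (A : zmodType) (v : A -> R -> R).
Hypothesis v_lin : forall a, klinear c (v a).
Hypothesis v0 : forall x, v 0 x = x.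
Hypothesis vD : forall a b x, v (a + b) x = v a (v b x).

Let v_comm a b x : v a (v b x) = v b (v a x).
Proof. by rewrite -!vD addrC. Qed.

Definition orbit_comb (l : seq (k * A)) (x : R) : R :=
  \sum_(p <- l) c p.1 * v p.2 x.

Let orbit_lin l : klinear c (orbit_comb l).
Proof.
split=> [x z|a x].
  by rewrite -big_split; apply: eq_bigr => p _; case: (v_lin p.2) => -> _; rewrite mulrDr.
by rewrite mulr_sumr; apply: eq_bigr => p _; case: (v_lin p.2) => _ ->; rewrite mulrCA.
Qed.

Let orbit_comm l g : klinear c g -> (forall b x, g (v b x) = v b (g x)) ->
  forall x, g (orbit_comb l x) = orbit_comb l (g x).
Proof.
move=> gl gv x; rewrite (klinear_sum _ _ _ gl); apply: eq_bigr => p _.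
by case: gl => _ ->; rewrite gv.
Qed.

Variables (a0 : A) (f : R).
Let T x := v a0 x - x.
Hypothesis Tf : forall j, iter j T f != 0.

Let T_lin : klinear c T.
Proof.
rewrite /T; case: (v_lin a0) => D Z; split=> *; rewrite ?D ?Z ?mulrBr //.
by rewrite opprD addrACA.
Qed.

Let iterT_lin j : klinear c (iter j T).
Proof.
by elim: j => // j [D Z]; case: T_lin => TD TZ; split=> *; rewrite !iterS ?D ?Z ?TD ?TZ.
Qed.

Let T_comm g : klinear c g -> (forall b x, g (v b x) = v b (g x)) ->
  forall j x, g (iter j T x) = iter j T (g x).
Proof.
move=> gl gv; elim=> // j IH x; rewrite !iterS /T; case: (gl) => D Z.
by rewrite D -mulN1r -(rmorphN1 c) Z gv IH rmorphN1 mulN1r.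
Qed.

Let iterT_comm j b x : iter j T (v b x) = v b (iter j T x).
Proof. by rewrite (@T_comm (v b)) // => *; rewrite v_comm. Qed.

(* The subspace is maximal among the stable ones that contain no [iter j T f]. *)
Lemma character_ex : exists (M : set R) (chi : A -> k),
  [/\ subspace c M, forall a x, M x -> M (v a x), ~ M f, ~ M (T f)
    & forall a, M (v a f - c (chi a) * f)].
Proof.
pose P (M : set R) := [/\ subspace c M, forall a x, M x -> M (v a x)
   & forall j, ~ M (iter j T f)].
have [||M [[Msub Mv MT] _ Mmax]] := @Zorn_above R P [set 0].
- split; first by split=> [//|x z -> ->|a x ->]; rewrite ?addr0 ?mulr0.
    by move=> a x ->; apply: klinear0 (v_lin a).
  by move=> j /eqP; apply/negP.
- move=> F F0 FP Ftot; split.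
  + by apply: subspace_chain => // X /FP[].
  + by move=> a x [X FX Xx]; exists X => //; have [_ h _] := FP X FX; apply: h.
  + by move=> j [X /FP[_ _ h]] /h.
have [M0 MD MZ] := Msub.
have MBB := subspaceB Msub.
have M_orbit l x : M x -> M (orbit_comb l x).
  by move=> Mx; apply: (subspace_sum _ Msub) => p _; apply: MZ; apply: Mv.
have MiterT j x : M x -> M (iter j T x).
  by move=> Mx; elim: j => // j IH; rewrite iterS; apply: MBB => //; apply: Mv.
have Mop a p x : M x -> M (op_eval c (v a) p x).
  move=> Mx; apply: (subspace_sum _ Msub) => i _; apply: MZ.
  by elim: (i : nat) => // j IH; rewrite iterS; apply: Mv.
(* [M] together with the orbit of [x] spans a larger stable subspace, which by maximality must
   contain some [iter j T f]. *)
have key1 x : ~ M x -> exists j l m, M m /\ iter j T f = m + orbit_comb l x.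
  move=> Mx; apply: contrapT => nex; apply: Mx.
  apply: (Mmax [set z | exists m l, M m /\ z = m + orbit_comb l x]).
  - by move=> m Mm; exists m, [::]; rewrite /orbit_comb big_nil addr0.
  - split; first split.
    + by exists 0, [::]; rewrite /orbit_comb big_nil addr0.
    + move=> _ _ [m [l [Mm ->]]] [m' [l' [Mm' ->]]]; exists (m + m'), (l ++ l').
      by split; [apply: MD | rewrite /orbit_comb big_cat addrACA].
    + move=> b _ [m [l [Mm ->]]]; exists (c b * m), [seq (b * p.1, p.2) | p <- l].
      split; first exact: MZ.
      rewrite mulrDr /orbit_comb big_map mulr_sumr; congr (_ + _).
      by apply: eq_bigr => p _; rewrite rmorphM mulrA.
    + move=> b _ [m [l [Mm ->]]]; exists (v b m), [seq (p.1, b + p.2) | p <- l].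
      split; first exact: Mv.
      rewrite /orbit_comb big_map; case: (v_lin b) => -> _; congr (_ + _).
      rewrite (klinear_sum _ _ _ (v_lin b)); apply: eq_bigr => p _.
      by case: (v_lin b) => _ ->; rewrite vD.
    + by move=> j [m [l [Mm E]]]; apply: nex; exists j, l, m.
  - exists 0, [:: (1, 0)]; split=> //.
    by rewrite /orbit_comb big_seq1 v0 rmorph1 mul1r add0r.
(* If a split polynomial in [v a] sends [iter j T f] into [M], one of its roots is an eigenvalue of
   [v a] on [f] modulo [M]. When z is not one, [key1] writes some [iter i T f] as a combination of
   translates of [v a f - c z * f] modulo [M]; raising j by i therefore absorbs the factor of z. *)
have key2 a (s : seq k) j : M (op_eval c (v a) (\prod_(z <- s) ('X - z%:P)) (iter j T f)) ->
    exists z, M (v a f - c z * f).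
  elim: s j => [|z s IH] j; first by rewrite big_nil op_eval1 => /MT.
  have [Mz _|Mz] := pselect (M (v a f - c z * f)); first by exists z.
  rewrite big_cons op_eval_XsubC //.
  have [i [l [m [Mm E]]]] := key1 _ Mz.
  set q := \prod_(_ <- s) _ => h; apply: (IH (j + i)%N); rewrite -/q.
  have ql := op_eval_klinear (v_lin a) q.
  have qv b x : op_eval c (v a) q (v b x) = v b (op_eval c (v a) q x).
    by rewrite (op_eval_comm q (v_lin b)) // => *; rewrite v_comm.
  rewrite iterD E; case: (iterT_lin j) => -> _; case: (ql) => -> _.
  apply: MD; first by apply: Mop; apply: MiterT.
  rewrite (orbit_comm _ (iterT_lin j)); last by move=> *; rewrite iterT_comm.
  rewrite (orbit_comm _ ql qv).
  apply: M_orbit; move: h; congr (M _).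
  rewrite (klinearB _ _ (iterT_lin j)) (klinearB _ _ ql).
  case: (iterT_lin j) => _ ->; case: (ql) => _ ->.
  by rewrite iterT_comm qv.
(* Without eigenvalues, [key1] makes [orbit_comb (l z)] act like T^(j z) / (v a - z) on [f] modulo
   [M]. Uncountably many z share a bound [J]; a relation between these resolvents, multiplied by all
   [v a - z i], puts [lagrange_comb b z] evaluated at [v a] on [iter J T f] into [M], and [key2]
   produces an eigenvalue. *)
have key3 a : exists z, M (v a f - c z * f).
  apply: contrapT => /forallNP nz.
  have [j /choice[l /choice[m hm]]] : exists j : k -> nat, forall z, exists l m,
      M m /\ iter (j z) T f = m + orbit_comb l (v a f - c z * f).
    by have [j jP] := choice (fun z => key1 _ (nz z)); exists j.
  have [J CJ] := uncountable_bounded j k_unc.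
  pose x z (_ : 'I_1) := iter (J - j z) T (orbit_comb (l z) f).
  have [n [z [b [zI zC b0 rel]]]] := uncountable_dep_gen x y_gen CJ.
  have xz i : v a (x (z i) 0) - c (z i) * x (z i) 0 =
      iter J T f - iter (J - j (z i)) T (m (z i)).
    have [Mm E] := hm (z i).
    have [_ /= jJ] := zC i.
    rewrite -{1}(subnK jJ) iterD E; have [D Z] := iterT_lin (J - j (z i)).
    rewrite D addrAC subrr add0r /x -iterT_comm -Z.
    rewrite -(klinearB _ _ (iterT_lin _)) (orbit_comm _ (v_lin a)) //.
    rewrite (klinearB _ _ (orbit_lin _)).
    by case: (orbit_lin (l (z i))) => _ ->.
  pose q i := \prod_(r | r != i) ('X - (z r)%:P) : {poly k}.
  have Mq : M (op_eval c (v a) (lagrange_comb b z) (iter J T f)).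
    have : op_eval c (v a) (lagrange_comb b z) (iter J T f) =
        \sum_i c (b i) * op_eval c (v a) (q i) (iter (J - j (z i)) T (m (z i))).
      rewrite /lagrange_comb (big_morph (fun p => op_eval c (v a) p (iter J T f))
        (fun p q => op_evalD c (v a) p q _) (op_eval0 c (v a) _)).
      apply/eqP; rewrite -subr_eq0 -sumrB.
      have al := op_eval_klinear (v_lin a).
      have := congr1 (op_eval c (v a) (\prod_r ('X - (z r)%:P))) (rel 0).
      rewrite (klinear0 (al _)) (klinear_sum _ _ _ (al _)) => rel0.
      apply/eqP; apply: etrans rel0; apply: eq_bigr => i _.
      case: (al (\prod_r ('X - (z r)%:P))) => _ ->.
      rewrite op_evalZ -mulrBr -(klinearB _ _ (al _)) -xz; congr (_ * _).
      rewrite [in RHS](bigD1 i) //= -/(q i) [in RHS]mulrC op_eval_prodE //.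
      congr (op_eval _ _ _ _).
      by rewrite -['X - _]mulr1 op_eval_XsubC // op_eval1.
    move=> ->; apply: (subspace_sum _ Msub) => i _; apply: MZ; apply: Mop.
    by apply: MiterT; case: (hm (z i)).
  have [r lagE] := closed_field_poly_normal (lagrange_comb b z).
  have lc0 : lead_coef (lagrange_comb b z) != 0.
    by rewrite lead_coef_eq0; apply: lagrange_comb_neq0.
  have [w /nz[]] : exists w, M (v a f - c w * f).
  apply: (key2 a r J).
  move: Mq; rewrite lagE op_evalZ => /(MZ (lead_coef (lagrange_comb b z))^-1).
  by rewrite mulrA -rmorphM mulVf // rmorph1 mul1r.
have [chi chiP] := choice key3.
by exists M, chi; split=> // [/(MT 0%N)|/(MT 1%N)].
Qed.

End Character.

(** * Functions on irreducible families of parameters *)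

Section IrreducibleSubset.
Variables (k : fieldType) (T : Type) (M : nat) (pt : T -> 'I_M -> k).

(** Irreducibility of the Zariski closure of the points [pt a], [a] in [S], expressed by primality
    of its vanishing ideal. *)
Definition irreducible_set (S : set T) : Prop := forall F G : {mpoly k[M]},
  (forall a, S a -> F.@[pt a] * G.@[pt a] = 0) ->
  (forall a, S a -> F.@[pt a] = 0) \/ (forall a, S a -> G.@[pt a] = 0).

(** An infinite set that is not irreducible is covered by two zero sets, one of which cuts out an
    infinite proper part. Repeating this forever gives polynomials each vanishing on all later sets
    but not on its own, against noetherianity. *)
Lemma irreducible_subset (S0 : set T) : infinite_set S0 ->
  exists S, [/\ S `<=` S0, infinite_set S & irreducible_set S].
Proof.
move=> S0inf; apply: contrapT => /forallNP nex.
have next (S : set T) : S `<=` S0 -> infinite_set S -> exists q : set T * {mpoly k[M]},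
    [/\ q.1 `<=` S, infinite_set q.1, forall a, q.1 a -> q.2.@[pt a] = 0
      & ~ forall a, S a -> q.2.@[pt a] = 0].
  move=> SS0 Sinf; apply: contrapT => nq; case: (nex S); split=> // F G FG.
  apply: contrapT => /not_orP[nF nG].
  have FGu : S = (S `&` [set a | F.@[pt a] = 0]) `|` (S `&` [set a | G.@[pt a] = 0]).
    apply/seteqP; split=> a; last by move=> [[]|[]].
    by move=> Sa; have /eqP := FG a Sa; rewrite mulf_eq0 => /orP[]/eqP; [left|right].
  have [Ffin|Finf] := pselect (finite_set (S `&` [set a | F.@[pt a] = 0])).
    have [Gfin|Ginf] := pselect (finite_set (S `&` [set a | G.@[pt a] = 0])).
      by apply: Sinf; rewrite FGu finite_setU.
    by apply: nq; exists (S `&` [set a | G.@[pt a] = 0], G); split=> //= a [].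
  by apply: nq; exists (S `&` [set a | F.@[pt a] = 0], F); split=> //= a [].
pose nxt (S : set T) := if pselect (S `<=` S0 /\ infinite_set S) is left h
  then sval (cid (next S h.1 h.2)) else (set0, 0).
have nxtP S : S `<=` S0 -> infinite_set S -> [/\ (nxt S).1 `<=` S,
    infinite_set (nxt S).1, forall a, (nxt S).1 a -> (nxt S).2.@[pt a] = 0
      & ~ forall a, S a -> (nxt S).2.@[pt a] = 0].
  by rewrite /nxt => h1 h2; case: pselect => [h|[]//]; case: cid.
pose S i := iter i (fun S => (nxt S).1) S0.
have SP i : S i `<=` S0 /\ infinite_set (S i).
  elim: i => [|i [h1 h2]]; first by split; [exact: subset_refl | exact: S0inf].
  have [h3 h4 _ _] := nxtP _ h1 h2.
  by split=> //; apply: subset_trans h1.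
have Sdec i j : (i <= j)%N -> S j `<=` S i.
  elim: j => [|j IH]; first by rewrite leqn0 => /eqP->.
  rewrite leq_eqVlt => /orP[/eqP->//|/IH]; apply: subset_trans.
  by have [h1 h2] := SP j; have [] := nxtP _ h1 h2.
have [m [r hr]] := @noetherian_mpoly k M (fun i => (nxt (S i)).2).
have [h1 h2] := SP m; have [_ _ _] := nxtP _ h1 h2; apply=> a Sa.
rewrite hr raddf_sum big1 // => j _; rewrite /= mevalM.
have [h3 h4] := SP j; have [_ _ -> //] := nxtP _ h3 h4; first by rewrite mulr0.
exact: (Sdec j.+1 m).
Qed.

End IrreducibleSubset.

Section Rigidity.
Variables (k : closedFieldType) (T : Type) (M : nat) (pt : T -> 'I_M -> k).
Hypothesis k_unc : ~ countable [set: k].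
Variable S : set T.
Hypotheses (S0 : S !=set0) (S_irr : irreducible_set pt S).

(** A function with finitely many values on an irreducible set is constant there. *)
Lemma irreducible_root (U : {mpoly k[M]}) (p : {poly k}) : p != 0 ->
  (forall a, S a -> p.[U.@[pt a]] = 0) -> exists z, forall a, S a -> U.@[pt a] = z.
Proof.
move=> p0; have [r ->] := closed_field_poly_normal p.
move=> h; have {h} : forall a, S a -> (\prod_(z <- r) (U - z%:MP)).@[pt a] = 0.
  move=> a /h; rewrite hornerZ => /eqP; rewrite mulf_eq0 lead_coef_eq0 (negbTE p0) /=.
  rewrite horner_prod rmorph_prod => /eqP pr0; apply: etrans pr0; apply: eq_bigr => z _.
  by rewrite hornerXsubC /= mevalB mevalC.
elim: r => [|z r IH] h.
  by case: S0 => a /h /eqP; rewrite big_nil meval1 oner_eq0.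
have [a Sa|h'|/IH//] := @S_irr (U - z%:MP) (\prod_(z <- r) (U - z%:MP)).
  by have := h a Sa; rewrite big_cons mevalM.
by exists z => a /h' /eqP; rewrite mevalB mevalC subr_eq0 => /eqP.
Qed.

(** A linear relation among uncountably many inverses of U - z becomes, after clearing denominators,
    a nonzero polynomial vanishing on the values of [U], so [U] would be constant. *)
Lemma countable_unit_shift (U : {mpoly k[M]}) :
  ~ (exists z, forall a, S a -> U.@[pt a] = z) ->
  countable [set z | exists r : {mpoly k[M]}, forall a, S a ->
    r.@[pt a] * (U.@[pt a] - z) = 1].
Proof.
move=> nU; apply: contrapT => nC.
set C := [set z | _] in nC *.
pose r z : {mpoly k[M]} := if pselect (C z) is left h then sval (cid h) else 0.
have rP z a : C z -> S a -> (r z).@[pt a] * (U.@[pt a] - z) = 1.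
  by rewrite /r => Cz Sa; case: pselect => // h; case: cid => /= ? ->.
have [n [z [b [zI zC b0 rel]]]] := uncountable_dep (fun z (_ : 'I_1) => r z) nC.
apply: nU; apply: (irreducible_root (lagrange_comb_neq0 zI b0)) => a Sa.
have := congr1 (meval (pt a)) (rel 0); rewrite raddf_sum meval0 /=.
move=> /(congr1 ( *%R (\prod_l (U.@[pt a] - z l)))); rewrite mulr0 => h.
apply: etrans h; rewrite mulr_sumr horner_sum; apply: eq_bigr => i _.
rewrite hornerZ mevalZ [in RHS](bigD1 i) //= horner_prod.
rewrite (eq_bigr (fun l => U.@[pt a] - z l)); last by move=> l _; rewrite hornerXsubC.
set q := \prod_(_ | _) _.
transitivity (b i * q * ((r (z i)).@[pt a] * (U.@[pt a] - z i))); last by ring.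
by rewrite rP // mulr1.
Qed.

(* For suitable c0 the functions U_i - c0^(1/2^i) form a divisor chain, which
   stops; then some U_i + c0^(1/2^i) is invertible, which c0 was chosen to
   prevent. *)
Lemma rigidity (U : nat -> {mpoly k[M]}) :
  (forall i a, S a -> (U i.+1).@[pt a] ^+ 2 = (U i).@[pt a]) ->
  exists z, forall a, S a -> (U 0%N).@[pt a] = z.
Proof.
move=> Usq; apply: contrapT => nU0.
have Upow i a : S a -> (U i).@[pt a] ^+ (2 ^ i) = (U 0%N).@[pt a].
  by move=> Sa; elim: i => // i <-; rewrite expnS exprM Usq.
have nU i : ~ exists z, forall a, S a -> (U i).@[pt a] = z.
  by move=> [z zP]; apply: nU0; exists (z ^+ (2 ^ i)) => a Sa; rewrite -(Upow i) // zP.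
pose E i := [set z | exists r : {mpoly k[M]}, forall a, S a ->
    r.@[pt a] * ((U i).@[pt a] - z) = 1].
(* Each [E i] is countable, so such a c0 exists; if z is minus a 2^i-th root of c0, then z is not in
   [E i], that is, adding this root to [U i] does not give a unit. *)
have [c0 c0P] : exists c0, ~ (\bigcup_(i in [set: nat]) [set (- z) ^+ (2 ^ i) | z in E i]) c0.
  apply: contrapT => /forallNP h; apply: k_unc.
  apply: (@sub_countable _ _ _ (\bigcup_(i in [set: nat]) [set (- z) ^+ (2 ^ i) | z in E i])).
    by apply: subset_card_le => z _; apply: contrapT (h z).
  apply: bigcup_countable => // i _.
  by apply: sub_countable (card_image_le _ _) _; apply: countable_unit_shift (nU i).
have sqrt_ex (z : k) : exists w, w ^+ 2 = z.
  have [w wP] := @solve_monicpoly k 2 (fun i => if i == 0%N then z else 0) isT.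
  by exists w; rewrite wP big_ord_recr big_ord1 /= mul0r addr0 mulr1.
have [sq sqP] := choice sqrt_ex.
pose cs i := iter i sq c0.
have cspow i : cs i ^+ (2 ^ i) = c0.
  by elim: i => // i IH; rewrite expnS exprM /cs iterS sqP.
have csE i : ~ E i.+1 (- cs i.+1).
  by move=> h; apply: c0P; exists i.+1 => //; exists (- cs i.+1); rewrite ?opprK.
have [W WE] : exists W : nat -> {mpoly k[M]},
    forall i a, (W i).@[pt a] = (U i).@[pt a] - cs i.
  by exists (fun i => U i - (cs i)%:MP) => i a; rewrite mevalB mevalC.
have WS i a : S a -> (W i).@[pt a] = (W i.+1).@[pt a] * ((U i.+1).@[pt a] + cs i.+1).
  by move=> Sa; rewrite !WE -subr_sqr Usq // [cs i.+1]iterS sqP.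
have Wdiv j m : (j <= m)%N -> exists t : {mpoly k[M]}, forall a, S a ->
    (W j).@[pt a] = t.@[pt a] * (W m).@[pt a].
  elim: m => [|m IH]; first by rewrite leqn0 => /eqP ->; exists 1 => a _; rewrite meval1 mul1r.
  rewrite leq_eqVlt => /orP[/eqP->|/IH[t tP]]; first by exists 1 => a _; rewrite meval1 mul1r.
  exists (t * (U m.+1 + (cs m.+1)%:MP)) => a Sa.
  by rewrite tP // WS // mevalM mevalD mevalC -mulrA [(W _).@[_] * _]mulrC.
have [[|m] [r rP]] := @noetherian_mpoly k M W.
  apply: (nU 0%N); exists (cs 0%N) => a Sa; apply/eqP; rewrite -subr_eq0.
  have := congr1 (meval (pt a)) rP.
  by rewrite big_ord0 WE meval0 => ->.
have /choice[t tP] j : exists t : {mpoly k[M]}, forall a, S a -> (j <= m)%N ->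
    (W j).@[pt a] = t.@[pt a] * (W m).@[pt a].
  have [/Wdiv[t tP]|jm] := leqP j m; first by exists t => a Sa _; apply: tP.
  by exists 0.
pose Q := \sum_(j < m.+1) r j * t j.
have QP a : S a -> (W m.+1).@[pt a] = Q.@[pt a] * (W m).@[pt a].
  move=> Sa; rewrite {1}rP !raddf_sum mulr_suml; apply: eq_bigr => j _ /=.
  by rewrite !mevalM -mulrA (tP j a Sa) //; apply: (ltn_ord j).
have [a Sa|h|h] := @S_irr (W m.+1) (1 - Q * (U m.+1 + (cs m.+1)%:MP)).
- rewrite mevalB meval1 mevalM mevalD mevalC mulrBr mulr1 {1}QP // WS //.
  by apply/eqP; rewrite subr_eq0; apply/eqP; ring.
- apply: (nU m.+1); exists (cs m.+1) => a /h /eqP.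
  by rewrite WE subr_eq0 => /eqP.
- apply: (csE m); exists Q => a /h /eqP.
  by rewrite mevalB meval1 mevalM mevalD mevalC subr_eq0 opprK => /eqP.
Qed.

End Rigidity.

(** * Unipotence of a one-parameter family normalised by scalings *)

Section UnipotentFamily.
Variables (k : closedFieldType) (R : comNzRingType) (c : {rmorphism k -> R}).
Variables (N : nat) (y : 'I_N -> R).
Hypothesis k_char0 : [pchar k] =i pred0.
Hypothesis k_unc : ~ countable [set: k].
Hypothesis y_gen : generates c y.

Variable v : k -> R -> R.
Hypothesis v_aut : forall a, kaut c (v a).
Hypothesis vD : forall a b x, v (a + b) x = v a (v b x).
Hypothesis v_homog : forall t, t != 0 ->
  exists g, kaut c g /\ forall a x, g (v a x) = v (t * a) (g x).

(** The coordinates [pt a] are the coefficients of polynomials expressing [v a] on the generators,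
    with bounded degree for infinitely many [a]. Nothing algebraic is known about how [v a] depends
    on [a]; only linear functionals of [v a x] are polynomial in [pt a]. *)
Lemma family_coordinates : exists M (pt : k -> 'I_M -> k) (S : set k),
  [/\ infinite_set S, irreducible_set pt S &
   forall (l : R -> k) x, (forall y z, l (y + z) = l y + l z) ->
     (forall a z, l (c a * z) = a * l z) ->
     exists U : {mpoly k[M]}, forall a, S a -> l (v a x) = U.@[pt a]].
Proof.
have [P PP] : exists P : k -> 'I_N -> {mpoly k[N]}, forall a i, v a (y i) = mmap c y (P a i).
  have h a : exists P : 'I_N -> {mpoly k[N]}, forall i, v a (y i) = mmap c y (P i).
    by have [P PP] := choice (fun i => y_gen (v a (y i))); exists P.
  by have [P PP] := choice h; exists P.
have [d /uncountable_infinite S0inf] :=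
  uncountable_bounded (fun a => \max_i msize (P a i)) k_unc.
set S0 := _ `&` _ in S0inf.
pose I : finType := ('I_N * 'X_{1..N < d})%type.
pose pt a (j : 'I_#|I|) := let z : I := enum_val j in (P a z.1)@_(val z.2).
have [S [SS0 Sinf Sirr]] := irreducible_subset pt S0inf.
exists #|I|, pt, S; split=> // l x lD lZ.
(* With coefficients in [R], the monomials in [y] become constants and only the coordinates of [a]
   vary; [l] is later applied coefficient by coefficient. *)
have yQ i : exists Q : {mpoly R[#|I|]}, forall a, S a -> v a (y i) = Q.@[c \o pt a].
  exists (\sum_(m : 'X_{1..N < d}) mmap1 y m *: 'X_(enum_rank ((i, m) : I))) => a /SS0[_ /= da].
  rewrite PP raddf_sum /= (mmapE d); last first.
    by apply: leq_trans da; apply: (leq_bigmax i).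
  apply: eq_bigr => m _; rewrite mevalZ mevalXU /= /pt enum_rankK /= mulrC.
  by [].
have [Qy QyP] := choice yQ.
have [F ->] := y_gen x.
pose Q := mmap (@mpolyC #|I| R \o c) Qy F.
have QP a : S a -> v a (mmap c y F) = Q.@[c \o pt a].
  move=> Sa; case: (v_aut a) => va _; rewrite (kend_mmap _ _ va) /Q rmorph_mmap.
  apply: eq_bigr => m _ /=; rewrite mevalC; congr (_ * _).
  by apply: eq_bigr => i _ /=; rewrite QyP.
exists (\sum_(m <- msupp Q) l Q@_m *: 'X_[m]) => a Sa.
have l0 : l 0 = 0 by apply: (addIr (l 0)); rewrite -lD !add0r.
rewrite QP // mevalE raddf_sum (big_morph l lD l0); apply: eq_bigr => m _ /=.
rewrite mevalZ mevalX mulrC -[RHS]mulrC -lZ rmorph_prod; congr (l (_ * _)).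
by apply: eq_bigr => i _; rewrite rmorphXn.
Qed.

Lemma unipotent_family a0 f : exists j, iter j (fun z => v a0 z - z) f = 0.
Proof.
apply: contrapT => /forallNP nf.
have v_lin a : klinear c (v a) by case: (v_aut a) => /kend_klinear.
have v0 x : v 0 x = x.
  by case: (v_aut 0) => _ /bij_inj; apply; rewrite -vD addr0.
have [|M [chi [Msub Mv Mf MTf Mchi]]] :=
  @character_ex k R c N y k_unc y_gen k v v_lin v0 vD a0 f.
  by move=> j; apply/eqP; apply: nf.
have [l [lD lZ lM lf]] := functional_ex Msub Mf.
have lB x z : l (x - z) = l x - l z.
  by apply: (addIr (l z)); rewrite -lD !subrK.
have lchi a : l (v a f) = chi a.
  by have /eqP := lM _ (Mchi a); rewrite lB lZ lf mulr1 subr_eq0 => /eqP.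
have chiD a b : chi (a + b) = chi a * chi b.
  have [_ MD MZ] := Msub.
  have /lM/eqP : M (v (a + b) f - c (chi a * chi b) * f).
    have -> : v (a + b) f - c (chi a * chi b) * f =
        v a (v b f - c (chi b) * f) + c (chi b) * (v a f - c (chi a) * f).
      rewrite (klinearB _ _ (v_lin a)) vD; case: (v_lin a) => _ ->.
      by rewrite rmorphM; ring.
    by apply: MD; [apply: Mv | apply: MZ].
  by rewrite lB lchi lZ lf mulr1 subr_eq0 => /eqP.
have chi0 : chi 0 = 1 by rewrite -lchi v0.
have chia0 : chi a0 != 1.
  by apply/eqP => e; apply: MTf; have := Mchi a0; rewrite e rmorph1 mul1r.
have [m [pt [S [Sinf Sirr Scoord]]]] := family_coordinates.
(* A scaling [g] turns [v a] into [v (t * a)], and [l \o g] is again a linear functional; hence the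
   same coordinates [pt a] work for every [t]. *)
have chiU t : t != 0 -> exists U : {mpoly k[m]}, forall a, S a -> chi (t * a) = U.@[pt a].
  move=> t0; have [g [gaut gv]] := v_homog t0.
  have [g' [_ gK g'K]] := kaut_inv gaut; case: gaut => -[gD gM gc] _.
  have [||U UP] := Scoord (l \o g) (g' f).
  - by move=> x z /=; rewrite gD lD.
  - by move=> a x /=; rewrite gM gc lZ.
  by exists U => a Sa; rewrite -UP //= gv g'K lchi.
have two0 : 2%:R != 0 :> k by rewrite (pcharf0P _).1.
have chi_const t : t != 0 -> exists z, forall a, S a -> chi (t * a) = z.
  move=> t0.
  have /choice[U UP] i : exists U : {mpoly k[m]}, forall a, S a ->
      chi (t / 2%:R ^+ i * a) = U.@[pt a].
    by apply: chiU; rewrite mulf_neq0 // invr_neq0 // expf_neq0.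
  have [||z zP] := @rigidity k k m pt k_unc S _ Sirr U.
  - exact: infinite_setN0.
  - move=> i a Sa; rewrite -!UP // expr2 -chiD; congr chi.
    by rewrite exprS; field; rewrite expf_neq0.
  by exists z => a Sa; rewrite -(zP a Sa) -UP // expr0 divr1.
have [s sI sS] := infinite_inj Sinf.
have s01 : s 0%N - s 1%N != 0 by rewrite subr_eq0; apply/eqP => /sI.
have a00 : a0 != 0 by apply: contraNneq chia0 => ->; rewrite chi0.
(* With this scale the two parameters become t s_0 = a0 + t s_1, so constancy of chi on the scaled
   family forces [chi a0 = 1]. *)
have t0 : a0 / (s 0%N - s 1%N) != 0 by rewrite mulf_neq0 // invr_neq0.
have [z zP] := chi_const _ t0; set t := a0 / _ in t0 zP.
have z0 : z != 0.
  rewrite -(zP (s 0%N)) //; apply/eqP => e; have /eqP := chiD (t * s 0%N) (- (t * s 0%N)).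
  by rewrite subrr chi0 e mul0r oner_eq0.
case/eqP: chia0; apply: (mulfI z0); rewrite mulr1 -{1}(zP _ (sS 1%N)) -chiD.
by rewrite -(zP (s 0%N)) //; congr chi; rewrite /t; field.
Qed.

End UnipotentFamily.

(** * Locally nilpotent derivations *)

Section LocallyNilpotent.
Variables (k : fieldType) (R : idomainType) (c : {rmorphism k -> R}).
Hypothesis k_char0 : [pchar k] =i pred0.

Lemma alg_natr_eq0 n : (n%:R == 0 :> R) = (n == 0%N).
Proof. by rewrite -(rmorph_nat c) fmorph_eq0 (pcharf0P _).1. Qed.

(** In characteristic zero the naturals form an infinite set of test points. Since a flow at n is
    the n-th iterate of its exponential, identities between automorphisms become identities between
    flows in this way. *)
Lemma poly_nat_ext (p q : {poly R}) : (forall n, p.[n%:R] = q.[n%:R]) -> p = q.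
Proof.
move=> pq; apply/eqP; rewrite -subr_eq0; apply: contraT => pq0.
have := @max_poly_roots _ (p - q) [seq i%:R | i <- iota 0 (size (p - q))] pq0.
rewrite size_map size_iota ltnn; apply.
  by apply/allP => _ /mapP[i _ ->]; rewrite rootE hornerD hornerN pq subrr.
rewrite map_inj_in_uniq ?iota_uniq // => i j _ _.
wlog ij : i j / (i <= j)%N.
  by move=> h; case: (leqP i j) => [/h//|/ltnW/h h' /esym/h' ->].
move/eqP; rewrite eq_sym -subr_eq0 -natrB // alg_natr_eq0 subn_eq0 => ji.
by apply/eqP; rewrite eqn_leq ij.
Qed.

Definition lnd (d : R -> R) : Prop :=
  [/\ forall x y, d (x + y) = d x + d y, forall x y, d (x * y) = d x * y + x * d y,
      forall a, d (c a) = 0 & forall x, exists j, iter j d x = 0].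

Lemma lnd_klinear d : lnd d -> klinear c d.
Proof. by move=> [dD dM dc _]; split=> // a x; rewrite dM dc mul0r add0r. Qed.

Lemma lnd0 d : lnd d -> d 0 = 0.
Proof. by move/lnd_klinear/klinear0. Qed.

Lemma iter_lnd_ge d x i j : lnd d -> (i <= j)%N -> iter i d x = 0 -> iter j d x = 0.
Proof.
move=> dl /subnK <- xi; rewrite iterD xi.
by elim: (j - i)%N => // n IH; rewrite iterS IH lnd0.
Qed.

Definition nil_index (d : R -> R) (x : R) : nat :=
  if pselect (exists j, iter j d x = 0) is left h then sval (cid h) else 0%N.

(** The polynomial exp(t d) x in t. By [coef_flow] its coefficients do not depend on the bound that
    [nil_index] happens to choose. *)
Definition flow (d : R -> R) (x : R) : {poly R} :=
  \poly_(j < nil_index d x) (c (j`!%:R^-1) * iter j d x).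

(** The map exp(h d). It is an endomorphism for every [h] in [R], but the exponent law needs [h] in
    the kernel of [d]. *)
Definition lnd_exp (d : R -> R) (h x : R) : R := (flow d x).[h].

Lemma coef_flow d x j : lnd d -> (flow d x)`_j = c (j`!%:R^-1) * iter j d x.
Proof.
move=> dl; rewrite coef_poly; case: ltnP => // ij.
rewrite (@iter_lnd_ge _ _ (nil_index d x)) ?mulr0 // /nil_index.
by case: pselect => [h|[]]; [case: cid | case: dl].
Qed.

Lemma flow_coef0 d x : lnd d -> (flow d x)`_0 = x.
Proof. by move=> dl; rewrite coef_flow // fact0 invr1 rmorph1 mul1r. Qed.

Lemma flow_coef1 d x : lnd d -> (flow d x)`_1 = d x.
Proof. by move=> dl; rewrite coef_flow // (_ : 1`! = 1)%N // invr1 rmorph1 mul1r. Qed.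

Lemma deriv_flow d x : lnd d -> (flow d x)^`() = flow d (d x).
Proof.
move=> dl; apply/polyP => i; rewrite coef_deriv !coef_flow // -iterSr.
rewrite -[LHS]mulr_natl mulrA -(rmorph_nat c) -rmorphM; congr (c _ * _).
by rewrite factS natrM invfM mulVKf // (pcharf0P _).1.
Qed.

Lemma poly_deriv_ext (p q : {poly R}) : p`_0 = q`_0 -> p^`() = q^`() -> p = q.
Proof.
move=> e0 e; apply/polyP => -[//|i]; have /eqP := congr1 (fun r : {poly R} => r`_i) e.
rewrite !coef_deriv -subr_eq0 -mulrnBl -mulr_natl mulf_eq0 alg_natr_eq0 /= subr_eq0.
by move/eqP.
Qed.

Lemma flowD d x y : lnd d -> flow d (x + y) = flow d x + flow d y.
Proof.
move=> dl; apply/polyP => i; rewrite coefD !coef_flow // -mulrDr; congr (_ * _).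
by elim: i => // i IH; rewrite !iterS IH; case: dl => ->.
Qed.

Lemma flow0 d : lnd d -> flow d 0 = 0.
Proof. by move=> dl; apply: (addIr (flow d 0)); rewrite -flowD // !add0r. Qed.

Lemma flow_ker d x : lnd d -> d x = 0 -> flow d x = x%:P.
Proof.
move=> dl dx; apply: poly_deriv_ext; first by rewrite flow_coef0 // coefC.
by rewrite deriv_flow // derivC dx flow0.
Qed.

(** Both sides have the same constant term, and the Leibniz rule reduces their derivatives to pairs
    with a smaller sum of nilpotency orders. *)
Lemma flowM d x y : lnd d -> flow d (x * y) = flow d x * flow d y.
Proof.
move=> dl; have [_ dM _ dN] := dl.
have [[i xi] [j yj]] := (dN x, dN y).
have [n] := ubnP (i + j)%N; elim: n => // n IH in i j x y xi yj *.
rewrite ltnS => ijn; apply: poly_deriv_ext.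
  by rewrite coef0M !flow_coef0.
rewrite derivM !deriv_flow // dM flowD //; congr (_ + _).
  case: i xi ijn => [/= -> _|i]; first by rewrite lnd0 // mul0r flow0 // mul0r.
  by rewrite iterSr => xi ijn; apply: (IH i j).
case: j yj ijn => [/= -> _|j]; first by rewrite lnd0 // mulr0 flow0 // mulr0.
by rewrite iterSr => yj; rewrite addnS => ijn; apply: (IH i j).
Qed.

(** The Taylor coefficients of the flow at a shifted argument; this is the form that [nderiv_taylor]
    needs for the exponent law. *)
Lemma flow_coef d x j : lnd d -> flow d (flow d x)`_j = (flow d x)^`N(j).
Proof.
move=> dl; apply: (mulfI (x := (j`!%:R : {poly R}))).
  by rewrite -polyC_natr polyC_eq0 alg_natr_eq0 -lt0n fact_gt0.
rewrite [RHS]mulr_natl -nderivn_def.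
have -> : (flow d x)^`(j) = flow d (iter j d x).
  by elim: j => [|j IH]; rewrite ?derivn0 // derivnS IH deriv_flow.
rewrite -polyC_natr -(flow_ker dl (_ : d j`!%:R = 0)) -?flowM //; last first.
  by rewrite -(rmorph_nat c); case: dl.
rewrite coef_flow // mulrA -(rmorph_nat c) -rmorphM mulfV ?rmorph1 ?mul1r //.
by rewrite (pcharf0P _).1 // -lt0n fact_gt0.
Qed.

Lemma lnd_exp_kend d h : lnd d -> kend c (lnd_exp d h).
Proof.
move=> dl; split=> [x y|x y|a]; rewrite /lnd_exp ?flowD ?flowM ?hornerE //.
by rewrite flow_ker ?hornerC //; case: dl.
Qed.

Lemma lnd_exp0 d x : lnd d -> lnd_exp d 0 x = x.
Proof. by move=> dl; rewrite /lnd_exp horner_coef0 flow_coef0. Qed.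

Lemma lnd_exp_ker d h x : lnd d -> d x = 0 -> lnd_exp d h x = x.
Proof. by move=> dl dx; rewrite /lnd_exp flow_ker // hornerC. Qed.

Lemma lnd_exp_deg1 d h x : lnd d -> d (d x) = 0 -> lnd_exp d h x = x + h * d x.
Proof.
move=> dl ddx; have -> : lnd_exp d h x = (x%:P + d x *: 'X).[h].
  congr (_.[_]); apply: poly_deriv_ext.
    by rewrite flow_coef0 // coefD coefC coefZ coefX /= mulr0 addr0.
  by rewrite deriv_flow // flow_ker // derivD derivC derivZ derivX add0r alg_polyC.
by rewrite !hornerE mulrC.
Qed.

Lemma lnd_expD d g h x : lnd d -> d h = 0 ->
  lnd_exp d (g + h) x = lnd_exp d g (lnd_exp d h x).
Proof.
move=> dl dh; rewrite {3}/lnd_exp horner_coef.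
have [f fE] := kend_rmorph (lnd_exp_kend g dl).
rewrite fE rmorph_sum /lnd_exp nderiv_taylor; last exact: mulrC.
apply: eq_bigr => i _; rewrite rmorphM rmorphXn -!fE (lnd_exp_ker _ dl dh).
by rewrite [in RHS]/lnd_exp flow_coef.
Qed.

Lemma lnd_exp_kaut d h : lnd d -> d h = 0 -> kaut c (lnd_exp d h).
Proof.
move=> dl dh; split; first exact: lnd_exp_kend.
have dNh : d (- h) = 0 by rewrite -sub0r (klinearB _ _ (lnd_klinear dl)) lnd0 // dh subrr.
by exists (lnd_exp d (- h)) => x; rewrite -lnd_expD // ?addNr ?subrr lnd_exp0.
Qed.

Lemma flow_conj g d d' x : kend c g -> lnd d -> lnd d' ->
  (forall z, g (d z) = d' (g z)) -> flow d' (g x) = map_poly g (flow d x).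
Proof.
move=> gk dl d'l gd; have [f fE] := kend_rmorph gk.
rewrite (eq_map_poly fE); apply/polyP => i; rewrite coef_map /= !coef_flow // rmorphM /=.
rewrite -!fE; case: gk => _ _ ->; congr (_ * _).
by elim: i => // i IH; rewrite !iterS gd IH.
Qed.

Lemma lnd_exp_conj g d d' h x : kend c g -> lnd d -> lnd d' ->
  (forall z, g (d z) = d' (g z)) -> g (lnd_exp d h x) = lnd_exp d' (g h) (g x).
Proof.
move=> gk dl d'l gd; rewrite /lnd_exp (flow_conj _ gk dl) //.
by have [f fE] := kend_rmorph gk; rewrite (eq_map_poly fE) !fE horner_map.
Qed.

Lemma iter_lnd_scale d a j x : lnd d -> d a = 0 ->
  iter j (fun x => a * d x) x = a ^+ j * iter j d x.
Proof.
move=> dl da; have [dD dM dc dN] := dl.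
elim: j => [|j IH]; first by rewrite mul1r.
have aj : d (a ^+ j) = 0.
  elim: j {IH} => [|j IH]; first by rewrite expr0 -(rmorph1 c) dc.
  by rewrite exprS dM da IH mul0r mulr0 addr0.
by rewrite !iterS IH dM aj mul0r add0r exprS mulrA.
Qed.

Lemma lnd_scale d a : lnd d -> d a = 0 -> lnd (fun x => a * d x).
Proof.
move=> dl da; have [dD dM dc dN] := dl; split=> [x y|x y|b|x].
- by rewrite dD mulrDr.
- by rewrite dM; ring.
- by rewrite dc mulr0.
- by have [j xj] := dN x; exists j; rewrite iter_lnd_scale // xj mulr0.
Qed.

Lemma lnd_exp_scale d a h x : lnd d -> d a = 0 ->
  lnd_exp (fun x => a * d x) h x = lnd_exp d (h * a) x.
Proof.
move=> dl da; rewrite /lnd_exp.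
have E : flow (fun x => a * d x) x = \poly_(i < size (flow d x)) (a ^+ i * (flow d x)`_i).
  apply/polyP => i; rewrite coef_flow; last exact: lnd_scale.
  rewrite coef_poly iter_lnd_scale // mulrCA -coef_flow //; case: ltnP => // si.
  by rewrite nth_default // mulr0.
rewrite E horner_poly horner_coef; apply: eq_bigr => i _.
by rewrite exprMn; ring.
Qed.

Lemma horner_flow_nat d x n : lnd d -> (flow d x).[n%:R] = iter n (lnd_exp d 1) x.
Proof.
move=> dl; elim: n => [|n IH]; first by rewrite horner_coef0 flow_coef0.
rewrite iterS -IH -lnd_expD //; last by rewrite -(rmorph_nat c); case: dl.
by rewrite /lnd_exp -[1]/(1%:R) -natrD.
Qed.

Lemma lnd_exp_inj d d' : lnd d -> lnd d' -> lnd_exp d 1 =1 lnd_exp d' 1 -> d =1 d'.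
Proof.
move=> dl d'l e x; rewrite -(flow_coef1 x dl) -(flow_coef1 x d'l).
suff -> : flow d x = flow d' x by [].
apply: poly_nat_ext => n; rewrite !horner_flow_nat //.
by elim: n => // n IH; rewrite !iterS IH e.
Qed.

Lemma lnd_exp_comm g d : kend c g -> lnd d ->
  (forall x, g (lnd_exp d 1 x) = lnd_exp d 1 (g x)) -> forall x, g (d x) = d (g x).
Proof.
move=> gk dl ge x; rewrite -(flow_coef1 x dl) -(flow_coef1 (g x) dl).
have [f fE] := kend_rmorph gk; rewrite !fE -coef_map.
suff -> : map_poly f (flow d x) = flow d (f x) by [].
apply: poly_nat_ext => n; rewrite -[in LHS](rmorph_nat f) horner_map /=.
rewrite !horner_flow_nat // -!fE.
by elim: n => // n IH; rewrite !iterS ge IH.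
Qed.

Lemma lnd_exp_comm_klinear D d a x : klinear c D -> lnd d ->
  (forall z, D (d z) = d (D z)) -> D (lnd_exp d (c a) x) = lnd_exp d (c a) (D x).
Proof.
move=> Dl dl Dd; set n := maxn (size (flow d x)) (size (flow d (D x))).
rewrite /lnd_exp !(@horner_coef_wide _ n) ?leq_maxl ?leq_maxr //.
rewrite (klinear_sum _ _ _ Dl); apply: eq_bigr => i _.
have E y : c (i`!%:R^-1) * y * c a ^+ i = c (i`!%:R^-1 * a ^+ i) * y.
  by rewrite rmorphM rmorphXn; ring.
rewrite !coef_flow // !E; case: Dl => _ ->; congr (_ * _).
by elim: (i : nat) => // j IH; rewrite !iterS Dd IH.
Qed.

(** If n -> v^n x is interpolated by a polynomial [F x], the logarithm of [v] is its linear
    coefficient. Uniqueness of interpolation makes [F] multiplicative and compatible with shifts;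
    the former gives the Leibniz rule, the latter shows that [d] differentiates [F], hence local
    nilpotence. *)
Lemma lnd_of_interpolation v : kend c v ->
  (forall x, exists F : {poly R}, forall n, F.[n%:R] = iter n v x) ->
  exists d, [/\ lnd d, v =1 lnd_exp d 1 & forall x, forall n, (flow d x).[n%:R] = iter n v x].
Proof.
move=> vk /choice[F FP]; have [vD vM vc] := vk.
have itk n : kend c (iter n v).
  by elim: n => // n [D M C]; split=> *; rewrite !iterS ?D ?M ?C.
have F0 x : (F x)`_0 = x by rewrite -horner_coef0 -[0]/(0%:R) FP.
pose d x := (F x)`_1.
have FD x y : F (x + y) = F x + F y.
  by apply: poly_nat_ext => n; rewrite hornerD !FP; case: (itk n).
have FM x y : F (x * y) = F x * F y.
  by apply: poly_nat_ext => n; rewrite hornerM !FP; case: (itk n).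
have FC a : F (c a) = (c a)%:P.
  by apply: poly_nat_ext => n; rewrite hornerC !FP; case: (itk n).
have Fshift x l : F (iter l v x) = F x \Po ('X + l%:R%:P).
  apply: poly_nat_ext => n; rewrite horner_comp !hornerE FP -iterD.
  by rewrite -natrD FP.
have Fv x : F (v x) = map_poly v (F x).
  have [f fE] := kend_rmorph vk; rewrite (eq_map_poly fE).
  apply: poly_nat_ext => n; rewrite -[in RHS](rmorph_nat f) horner_map /= -fE !FP.
  by rewrite -iterSr iterS.
have dv x : d (v x) = v (d x).
  by have [f fE] := kend_rmorph vk; rewrite /d Fv (eq_map_poly fE) coef_map /= fE.
have Fd x : F (d x) = (F x)^`().
  apply: poly_nat_ext => n; rewrite FP.
  have -> : iter n v (d x) = d (iter n v x).
    by elim: n => // n IH; rewrite !iterS IH dv.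
  rewrite /d Fshift -[(_ \Po _)`_1]mulr1n -[1%N]/(0.+1) -coef_deriv deriv_comp.
  by rewrite derivD derivX derivC addr0 mulr1 -horner_coef0 horner_comp !hornerE.
have Fit j x : F (iter j d x) = (F x)^`(j).
  by elim: j => [|j IH]; rewrite ?derivn0 // iterS Fd IH derivnS.
have dl : lnd d.
  split=> [x y|x y|a|x]; rewrite /d ?FD ?coefD ?FC ?coefC //.
    by rewrite FM coefM big_ord_recr big_ord1 /= !F0 addrC mulrC [X in _ + X]mulrC mulrC.
  exists (size (F x)); rewrite -/d -[LHS]F0 Fit.
  suff -> : (F x)^`(size (F x)) = 0 by rewrite coef0.
  by apply/polyP => i; rewrite coef_derivn coef0 nth_default ?mul0rn // leq_addr.
have flowF x : flow d x = F x.
  apply/polyP => i; rewrite coef_flow // -[iter i d x]F0 Fit coef_derivn addn0 ffactnn.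
  rewrite -[(F x)`__ *+ _]mulr_natl mulrA -(rmorph_nat c) -rmorphM mulVf ?rmorph1 ?mul1r //.
  by rewrite (pcharf0P _).1 // -lt0n fact_gt0.
exists d; split=> // [x|x n]; last by rewrite flowF FP.
by rewrite /lnd_exp flowF -[1]/(1%:R) FP.
Qed.

Lemma binomial_poly i : exists B : {poly R}, forall n, B.[n%:R] = 'C(n, i)%:R.
Proof.
exists ((c i`!%:R^-1) *: \prod_(l < i) ('X - l%:R%:P)) => n.
have i0 : i`!%:R != 0 :> k by rewrite (pcharf0P _).1 // -lt0n fact_gt0.
rewrite hornerZ horner_prod.
suff -> : \prod_(l < i) ('X - l%:R%:P).[n%:R] = (n ^_ i)%:R :> R.
  by rewrite -bin_ffact natrM mulrCA -(rmorph_nat c i`!) -rmorphM mulVf // rmorph1 mulr1.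
have [ni|ni] := ltnP n i.
  rewrite ffact_small // (bigD1 (Ordinal ni)) //=.
  by rewrite hornerXsubC subrr mul0r.
rewrite ffact_prod natr_prod; apply: eq_bigr => l _.
by rewrite hornerXsubC natrB // ltnW // (leq_trans (ltn_ord l)).
Qed.

Lemma iter_binomial v x m n : kend c v -> iter m (fun z => v z - z) x = 0 ->
  iter n v x = \sum_(i < m) 'C(n, i)%:R * iter i (fun z => v z - z) x.
Proof.
move=> vk; set T := fun z => _ => Tm.
elim: n => [|n IH].
  case: m Tm => [/= ->|m _]; first by rewrite big_ord0.
  rewrite big_ord_recl bin0 mul1r big1 ?addr0 // => i _.
  by rewrite bin0n mul0r.
have [f fE] := kend_rmorph vk.
rewrite iterS IH fE rmorph_sum.
transitivity (\sum_(i < m) 'C(n, i)%:R * iter i.+1 T x +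
    \sum_(i < m) 'C(n, i)%:R * iter i T x).
  rewrite -big_split; apply: eq_bigr => i _.
  by rewrite rmorphM rmorph_nat /= -mulrDr -fE /T subrK.
case: m Tm {IH} => [|m] Tm; first by rewrite !big_ord0 addr0.
rewrite [X in X + _]big_ord_recr Tm /= mulr0 addr0 !big_ord_recl !bin0 addrCA.
congr (_ + _); rewrite -big_split; apply: eq_bigr => i _.
by rewrite /= -mulrDl -natrD /bump /= !add1n binS addnC.
Qed.

(** Writing v = 1 + T, the binomial expansion of v^n x stops, and binomial coefficients are
    polynomials in n in characteristic zero. *)
Lemma unipotent_lnd v : kend c v ->
  (forall x, exists j, iter j (fun z => v z - z) x = 0) ->
  exists2 d, lnd d & v =1 lnd_exp d 1.
Proof.
move=> vk vN; suff /(lnd_of_interpolation vk)[d [dl ve _]] :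
  forall x, exists F : {poly R}, forall n, F.[n%:R] = iter n v x by exists d.
move=> x; have [m Tm] := vN x; have [B BP] := choice binomial_poly.
exists (\sum_(i < m) iter i (fun z => v z - z) x *: B i) => n.
rewrite (iter_binomial n vk Tm) horner_sum; apply: eq_bigr => i _.
by rewrite hornerZ BP mulrC.
Qed.

(** The iterates of the composite are interpolated by [G], the polynomial exp(t d) exp(t d') x,
    whose linear coefficient is the sum of the derivations. *)
Lemma lnd_add d d' : lnd d -> lnd d' ->
  (forall x, lnd_exp d 1 (lnd_exp d' 1 x) = lnd_exp d' 1 (lnd_exp d 1 x)) ->
  lnd (fun x => d x + d' x) /\
  forall x, lnd_exp (fun x => d x + d' x) 1 x = lnd_exp d 1 (lnd_exp d' 1 x).
Proof.
move=> dl d'l comm; set v := lnd_exp d 1 in comm *; set v' := lnd_exp d' 1 in comm *.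
have vk : kend c v := lnd_exp_kend 1 dl; have v'k : kend c v' := lnd_exp_kend 1 d'l.
have itv n x : iter n (v \o v') x = iter n v (iter n v' x).
  have cm m z : iter m v (v' z) = v' (iter m v z).
    by elim: m => // m IH; rewrite !iterS IH comm.
  by elim: n => // n IH; rewrite !iterS IH /= -cm.
pose G x := \sum_(j < size (flow d' x)) flow d (flow d' x)`_j * 'X^j.
have GP x n : (G x).[n%:R] = iter n (v \o v') x.
  rewrite itv -horner_flow_nat // horner_sum -horner_flow_nat //.
  have [f fE] := kend_rmorph (lnd_exp_kend n%:R dl).
  rewrite -/(lnd_exp d n%:R _) fE horner_coef rmorph_sum; apply: eq_bigr => j _.
  rewrite hornerM hornerXn rmorphM rmorphXn -!fE; congr (_ * _ ^+ _).
  by rewrite lnd_exp_ker // -(rmorph_nat c); case: dl.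
have [|e [el eE eF]] := @lnd_of_interpolation (v \o v') (kend_comp vk v'k).
  by move=> x; exists (G x).
have ee x : e x = d x + d' x.
  rewrite -flow_coef1 //.
  have -> : flow e x = G x by apply: poly_nat_ext => n; rewrite eF GP.
  rewrite coef_sum.
  have E (j : nat) : (flow d (flow d' x)`_j * 'X^j)`_1 =
     if j == 0%N then d x else if j == 1%N then d' x else 0.
    rewrite coefMXn; case: j => [|[|j]] //=.
      by rewrite flow_coef0 // flow_coef1.
    by rewrite flow_coef0 // flow_coef1.
  transitivity (\sum_(j < maxn 2 (size (flow d' x))) (flow d (flow d' x)`_j * 'X^j)`_1).
    rewrite (big_ord_widen (maxn 2 (size (flow d' x))) (fun j => (flow d (flow d' x)`_j * 'X^j)`_1)) ?leq_maxr //.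
    rewrite big_mkcond; apply: eq_bigr => j _; case: ltnP => // sj.
    by rewrite (nth_default 0 sj) flow0 // mul0r coef0.
  under eq_bigr => j _ do rewrite E.
  have -> : maxn 2 (size (flow d' x)) = (maxn 2 (size (flow d' x)) - 2).+2 by lia.
  by rewrite !big_ord_recl /= big1 ?addr0 // => i _.
have -> : (fun x => d x + d' x) = e by apply/funext => x; rewrite ee.
by split=> // x; rewrite -eE.
Qed.

End LocallyNilpotent.

(** * Lattice monoids, facets and roots *)

Section Lattice.
Variable n : nat.
Local Notation M := 'rV[int]_n.

Definition dot (r m : M) : int := \sum_i r 0 i * m 0 i.

Lemma dotC r m : dot r m = dot m r.
Proof. by apply: eq_bigr => i _; rewrite mulrC. Qed.

Fact dot_is_linear r : linear_for *%R (dot r).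
Proof.
move=> a x y; rewrite /dot mulr_sumr -big_split; apply: eq_bigr => i _ /=.
by rewrite !mxE mulrDr mulrCA.
Qed.
HB.instance Definition _ r :=
  GRing.isLinear.Build int M int _ (dot r) (dot_is_linear r).

Lemma dotDl r r' m : dot (r + r') m = dot r m + dot r' m.
Proof. by rewrite !(dotC _ m) linearD. Qed.

Lemma dotZl a r m : dot (a *: r) m = a * dot r m.
Proof. by rewrite !(dotC _ m) linearZ. Qed.

Lemma dot0l m : dot 0 m = 0.
Proof. by rewrite dotC linear0. Qed.

Lemma dot_delta r i : dot r (delta_mx 0 i) = r 0 i.
Proof.
rewrite /dot (bigD1 i) //= mxE !eqxx mulr1 big1 ?addr0 // => j /negbTE ji.
by rewrite mxE ji mulr0.
Qed.

Lemma dot_eq0 r : (forall m, dot r m = 0) -> r = 0.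
Proof. by move=> h; apply/rowP => i; rewrite -dot_delta h mxE. Qed.

Lemma dot_gt0 m : m != 0 -> 0 < dot m m.
Proof.
move=> m0; rewrite lt0r sumr_ge0 ?andbT => [|i _]; last by rewrite -expr2 sqr_ge0.
apply: contra m0 => /eqP; rewrite /dot => h; apply/eqP/rowP => i; rewrite mxE.
have h0 j : 0 <= m 0 j * m 0 j by rewrite -expr2 sqr_ge0.
have /eqP : m 0 i * m 0 i = 0 by apply: (psumr_eq0P (fun j _ => h0 j) h).
by rewrite mulf_eq0 orbb => /eqP.
Qed.

(** Membership in the rational cone of [g], with the common denominator [K] cleared. *)
Definition cone_mem N (g : 'I_N -> M) (m : M) : Prop :=
  exists (K : int) (a : 'I_N -> int),
    [/\ 0 < K, forall i, 0 <= a i & K *: m = \sum_i a i *: g i].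

(** Induction on the generators. If the form [r] found for the first ones is negative on the last
    one, everything is projected along [gN] onto the hyperplane r = 0, scaled by [p] to stay
    integral, and a separating form for the projections is corrected by a multiple of [r]. *)
Lemma farkas N (g : 'I_N -> M) (m : M) : cone_mem g m \/
  exists r, (forall i, 0 <= dot r (g i)) /\ dot r m < 0.
Proof.
elim: N g m => [|N IH] g m.
  have [->|m0] := eqVneq m 0.
    by left; exists 1, (fun=> 0); split=> //; rewrite scaler0 big_ord0.
  right; exists (- m); split=> [[]//|].
  by rewrite -scaleN1r dotZl mulN1r oppr_lt0 dot_gt0.
pose gN := g ord_max; pose g' i := g (widen_ord (leqnSn N) i).
have gE a : \sum_i a i *: g i =
    \sum_i a (widen_ord (leqnSn N) i) *: g' i + a ord_max *: gN.
  by rewrite big_ord_recr.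
have [[K [a [K0 a0 E]]]|[r [rg rm]]] := IH g' m.
  left; exists K, (fun i => if unlift ord_max i is Some j then a j else 0).
  split=> // [i|]; first by case: unlift.
  rewrite gE unlift_none scale0r addr0 E; apply: eq_bigr => i _.
  have -> : widen_ord (leqnSn N) i = lift ord_max i.
    by apply: val_inj; rewrite /= /bump leqNgt ltn_ord.
  by rewrite liftK.
have split_ord (P : 'I_N.+1 -> Prop) :
    (forall i, P (widen_ord (leqnSn N) i)) -> P ord_max -> forall i, P i.
  move=> h1 h2 i; case: (unliftP ord_max i) => [j ->|-> //].
  rewrite (_ : lift _ _ = widen_ord (leqnSn N) j) //.
  by apply: val_inj; rewrite /= /bump leqNgt ltn_ord.
have [rN|rN] := leP 0 (dot r gN).
  by right; exists r; split=> //; apply: split_ord.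
pose p := - dot r gN; have p0 : 0 < p by rewrite oppr_gt0.
have [[K [a [K0 a0 E]]]|[r' [r'h r'm]]] :=
  IH (fun i => dot r (g' i) *: gN + p *: g' i) (dot r m *: gN + p *: m).
  left; exists (K * p), (fun i => if unlift ord_max i is Some j then a j * p
    else \sum_i a i * dot r (g' i) - K * dot r m).
  split=> [|i|]; first by rewrite mulr_gt0.
    case: unlift => [j|]; first by rewrite mulr_ge0 // ltW.
    rewrite subr_ge0; apply: (@le_trans _ _ 0).
      by rewrite mulr_ge0_le0 // ltW.
    by apply: sumr_ge0 => j _; rewrite mulr_ge0 // rg.
  rewrite gE unlift_none.
  have -> : \sum_i (if unlift ord_max (widen_ord (leqnSn N) i) is Some j then a j * p
      else \sum_i a i * dot r (g' i) - K * dot r m) *: g' i = \sum_i a i *: (p *: g' i).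
    apply: eq_bigr => i _.
    have -> : widen_ord (leqnSn N) i = lift ord_max i.
      by apply: val_inj; rewrite /= /bump leqNgt ltn_ord.
    by rewrite liftK scalerA.
  rewrite scalerBl scaler_suml addrA -big_split /=.
  under eq_bigr do rewrite -scalerA -scalerDr addrC.
  by rewrite -E scalerDr !scalerA addrAC subrr add0r.
right; exists (p *: r' + dot r' gN *: r); split.
  apply: split_ord => [i|].
    have := r'h i; rewrite linearD !linearZ /= dotDl !dotZl /g'.
    by congr (is_true (0 <= _)); ring.
  by rewrite dotDl !dotZl -/gN /p; lia.
move: r'm; rewrite linearD !linearZ /= dotDl !dotZl.
by congr (is_true (_ < 0)); ring.
Qed.

Lemma common_denominator (I : finType) (f : I -> rat) :
  exists (K : int) (h : I -> int), 0 < K /\ forall i, K%:~R * f i = (h i)%:~R.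
Proof.
exists (\prod_i denq (f i)), (fun i => (\prod_(j | j != i) denq (f j)) * numq (f i)).
split=> [|i]; first by apply: prodr_gt0 => i _; apply: denq_gt0.
rewrite (bigD1 i) //= -[X in _ * X](divq_num_den (f i)) !intrM.
by field; rewrite intr_eq0 denq_neq0.
Qed.

Lemma separating_form N (g : 'I_N -> M) (P : pred 'I_N) (x : M) :
  (exists (K : int) (b : 'I_N -> int), [/\ 0 < K, forall i, ~~ P i -> b i = 0 &
     K *: x = \sum_i b i *: g i]) \/
  exists r, (forall i, P i -> dot r (g i) = 0) /\ dot r x != 0.
Proof.
pose G : 'M[rat]_(N, n) := \matrix_(i, j) (if P i then (g i 0 j)%:~R else 0).
pose X : 'rV[rat]_n := \row_j (x 0 j)%:~R.
have [/submxP[D XD]|XG] := boolP (X <= G)%MS.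
  left; have [K [b [K0 bE]]] := common_denominator (fun i => D 0 i).
  exists K, (fun i => if P i then b i else 0).
  split=> // [i /negbTE -> //|].
  apply/rowP => j; apply: (@intr_inj rat).
  have := congr1 (fun A : 'rV_n => K%:~R * A 0 j) XD; rewrite !mxE intrM => ->.
  rewrite summxE mulr_sumr raddf_sum /=; apply: eq_bigr => i _.
  rewrite !mxE; case: ifP => _; last by rewrite !mulr0 mul0r.
  by rewrite mulrA bE intrM.
right; have : X *m cokermx G != 0 by rewrite -submxE.
have := mulmx_coker G; move: (cokermx G) => Ck GCk /rV0Pn[l Xl].
have [K [b [K0 bE]]] := common_denominator (fun j => Ck j l).
exists (\row_j b j).
have dE (y : M) : (dot (\row_j b j) y)%:~R = K%:~R * ((\row_j (y 0 j)%:~R : 'rV[rat]_n) *m Ck) 0 l.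
  rewrite raddf_sum mxE mulr_sumr; apply: eq_bigr => j _ /=.
  by rewrite !mxE intrM -bE; ring.
split=> [i Pi|].
  apply: (@intr_inj rat); rewrite dE.
  have -> : (\row_j (g i 0 j)%:~R : 'rV[rat]_n) = row i G.
    by apply/rowP => j; rewrite !mxE Pi.
  by rewrite -row_mul GCk !mxE mulr0.
rewrite -(@intr_eq0 rat) dE mulf_neq0 //.
by rewrite intr_eq0 gt_eqF.
Qed.

(** The least positive value of [r] divides every value, in particular all coordinates. *)
Lemma primitive_form (r : M) : r != 0 ->
  exists (d : int) (r0 x : M), [/\ 0 < d, r = d *: r0 & dot r0 x = 1].
Proof.
move=> r0.
have ex : exists d : nat, `[< (0 < d)%N /\ exists x, dot r x = d%:Z >].
  exists `|dot r r|%N; apply/asboolP; have := dot_gt0 r0; split; first by lia.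
  by exists r; lia.
case: (ex_minnP ex) => d /asboolP[d0 [x xd]] dmin.
have dvd y : (d%:Z %| dot r y)%Z.
  apply/dvdz_mod0P; apply: contrapT => /eqP nz.
  have := divz_eq (dot r y) d%:Z.
  have m0 : (0 <= dot r y %% d)%Z by apply: modz_ge0; lia.
  have m1 : (dot r y %% d < d)%Z by rewrite ltz_mod; lia.
  set q := (_ %/ _)%Z => E.
  have /dmin : `[< (0 < `|dot r y %% d|%Z)%N /\ exists x, dot r x = `|(dot r y %% d)%Z|%N%:Z >].
    apply/asboolP; split; first by lia.
    by exists (y - q *: x); rewrite linearB linearZ /= xd; lia.
  by lia.
pose q i := (r ord0 i %/ d)%Z.
have rE : r = d%:Z *: \row_i q i.
  by apply/rowP => i; rewrite !mxE mulrC divzK // -dot_delta.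
exists d%:Z, (\row_i q i), x; split=> //; apply: (@mulfI _ d%:Z); first by lia.
by rewrite -dotZl -rE xd mulr1.
Qed.

(** Among the forms that separate [m] from the cone, one vanishing on the largest number of
    generators is a facet normal: if its zeros did not span a hyperplane, it could be tilted until
    one more generator becomes a zero. *)
Lemma facet_ex N (g : 'I_N -> M) (m : M) :
  (forall r, (forall i, dot r (g i) = 0) -> r = 0) -> ~ cone_mem g m ->
  exists r, [/\ forall i, 0 <= dot r (g i), dot r m < 0, exists x, dot r x = 1 &
    forall x, dot r x = 0 -> exists (K : int) (b : 'I_N -> int),
      [/\ 0 < K, forall i, dot r (g i) != 0 -> b i = 0 & K *: x = \sum_i b i *: g i]].
Proof.
move=> gspan mg; have [//|r0P] := farkas g m.
have ex : exists z : nat, `[< exists r, [/\ forall i, 0 <= dot r (g i), dot r m < 0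
    & #|[pred i | dot r (g i) == 0]| = z] >].
  by case: r0P => r [r1 r2]; exists #|[pred i | dot r (g i) == 0]|; apply/asboolP; exists r.
have [z|z /asboolP[r [rg rm zE]] zmax] := @ex_maxnP _ N ex.
  move=> /asboolP[r [_ _ <-]]; rewrite -[leqRHS]card_ord; exact: max_card.
have rspan x : dot r x = 0 -> exists (K : int) (b : 'I_N -> int),
    [/\ 0 < K, forall i, dot r (g i) != 0 -> b i = 0 & K *: x = \sum_i b i *: g i].
  move=> rx; have [//|[s [sg sx]]] := separating_form g (fun i => dot r (g i) == 0) x.
  exfalso.
  (* The combination of [r] and [s] that vanishes on [m], so that tilting by it keeps the value on
     [m] negative; it also vanishes on the zeros of [r]. *)
  pose t0 := dot r m *: s - dot s m *: r.
  have t0D y : dot t0 y = dot r m * dot s y - dot s m * dot r y.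
    by rewrite dotDl -scaleNr !dotZl mulNr.
  have t00 : t0 != 0.
    apply/eqP => t00; have := t0D x; rewrite t00 dot0l rx mulr0 subr0 => /esym /eqP.
    by rewrite mulf_eq0 (negbTE sx) orbF lt_eqF.
  have [i0 ti0] : exists i, dot t0 (g i) != 0.
    apply: contrapT => /forallNP h; case/eqP: t00; apply: gspan => i.
    by apply/eqP; apply: contrapT => /negP /h.
  have [t [tg tm [i1 ti1]]] : exists t, [/\ forall i, dot r (g i) = 0 -> dot t (g i) = 0,
      dot t m = 0 & exists i, dot t (g i) < 0].
    have tg i : dot r (g i) = 0 -> dot t0 (g i) = 0.
      by move=> e; rewrite t0D e sg ?e ?eqxx // !mulr0 subrr.
    have tm : dot t0 m = 0 by rewrite t0D mulrC subrr.
    have [lt|] := ltP (dot t0 (g i0)) 0; first by exists t0; split=> //; exists i0.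
    rewrite le_eqVlt eq_sym (negbTE ti0) /= => gt.
    exists (- t0); rewrite -scaleN1r; split.
    - by move=> i /tg; rewrite dotZl => ->; rewrite mulr0.
    - by rewrite dotZl tm mulr0.
    - by exists i0; rewrite dotZl mulN1r oppr_lt0.
  (* The multiple of [t] at which the tilted form reaches zero on [g i]. At the minimum a new
     generator is killed and all values are still nonnegative. *)
  pose q i := (dot r (g i))%:~R / (- dot t (g i))%:~R : rat.
  case: (@arg_minP _ _ _ i1 (fun i => dot t (g i) < 0) q ti1) => i ti qmin.
  pose w := (- dot t (g i)) *: r + dot r (g i) *: t.
  have wD y : dot w y = - dot t (g i) * dot r y + dot r (g i) * dot t y.
    by rewrite dotDl !dotZl.
  have wg j : 0 <= dot w (g j).
    rewrite wD; have [tj|tj] := ltP (dot t (g j)) 0; last first.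
      by rewrite addr_ge0 // mulr_ge0 // oppr_ge0 ltW.
    have := qmin j tj; rewrite /q ler_pdivrMr ?ltr0z ?oppr_gt0 //.
    rewrite mulrAC ler_pdivlMr ?ltr0z ?oppr_gt0 // -!intrM ler_int; lia.
  have : (z < #|[pred j | dot w (g j) == 0%R]|)%N.
    rewrite -zE; apply: proper_card; apply/properP; split.
      by apply/fintype.subsetP => j; rewrite !inE wD => /eqP e; rewrite (tg j e) e !mulr0 addr0.
    exists i; rewrite !inE; first by rewrite wD; apply/eqP; lia.
    by apply/eqP => /tg e; rewrite e ltxx in ti.
  rewrite ltnNge => /negP; apply; apply: zmax; apply/asboolP; exists w; split=> //.
  by rewrite wD tm mulr0 addr0 pmulr_rlt0 ?oppr_gt0.
have r0 : r != 0 by apply: contraTneq rm => ->; rewrite dot0l ltxx.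
have [d [s [x [d0 rE sx]]]] := primitive_form r0.
have dE y : dot r y = d * dot s y by rewrite rE dotZl.
exists s; split=> [i||| y sy].
- by have := rg i; rewrite dE pmulr_rge0.
- by move: rm; rewrite dE pmulr_rlt0.
- by exists x.
- have [|K [b [K0 b0 E]]] := rspan y; first by rewrite dE sy mulr0.
  by exists K, b; split=> // i si; apply: b0; rewrite dE mulf_neq0 // gt_eqF.
Qed.

End Lattice.

Section AffineMonoid.
Variable n : nat.
Local Notation M := 'rV[int]_n.
Implicit Types (S : set M) (r e m x s : M).

(** The weight monoids of normal affine toric varieties. Nonzero invertible elements are allowed,
    and a torus corresponds to the full lattice. *)
Record lattice_monoid S : Prop := LatticeMonoid {
  lmon0 : S 0;
  lmonD : forall x y, S x -> S y -> S (x + y);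
  lmon_fg : exists N (g : 'I_N -> M), (forall i, S (g i)) /\
    forall s, S s -> exists a : 'I_N -> nat, s = \sum_i g i *+ a i;
  lmon_gen : forall x, exists s s', [/\ S s, S s' & x = s - s'];
  lmon_sat : forall K x, (0 < K)%N -> S (x *+ K) -> S x
}.

(** [r] is the primitive inner normal of a facet; the last field says that the face r = 0 has
    codimension one. *)
Record facet S r : Prop := Facet {
  facet_ge0 : forall s, S s -> 0 <= dot r s;
  facet_prim : exists x, dot r x = 1;
  facet_span : forall x, dot r x = 0 -> exists K p p', [/\ (0 < K)%N, S p /\ S p',
    dot r p = 0 /\ dot r p' = 0 & x *+ K = p - p']
}.

(* Demazure roots: [root S r e] says that the derivation of degree [e] of
   [k[S]] sending the monomial [s] to [dot r s] times the monomial [s + e] is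
   well defined and locally nilpotent. *)
Definition root S r e : Prop :=
  dot r e = -1 /\ forall s, S s -> 0 < dot r s -> S (s + e).

Variable S : set M.
Hypothesis SM : lattice_monoid S.

Lemma lmon_muln x K : S x -> S (x *+ K).
Proof.
move=> Sx; elim: K => [|K IH]; first by rewrite mulr0n; apply: lmon0.
by rewrite mulrS; apply: (lmonD SM).
Qed.

Lemma lmon_sum (I : Type) (l : seq I) (P : pred I) (x : I -> M) :
  (forall i, P i -> S (x i)) -> S (\sum_(i <- l | P i) x i).
Proof. by move=> Sx; elim/big_ind: _ => //; [apply: lmon0 | apply: lmonD]. Qed.

(** Saturation places [m] outside the rational cone, where [facet_ex] applies. *)
Lemma facet_separates m : ~ S m -> exists r, facet S r /\ dot r m < 0.
Proof.
move=> nSm; have [N [g [Sg gS]]] := lmon_fg SM.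
have Sint (b : 'I_N -> int) : (forall i, 0 <= b i) -> S (\sum_i b i *: g i).
  move=> b0; apply: lmon_sum => i _.
  by rewrite -[b i]gez0_abs // -natz scaler_nat; apply: lmon_muln.
have [||r [rg rm rx rspan]] := @facet_ex n N g m.
- move=> r rg; apply: dot_eq0 => x; have [s [s' [Ss Ss' ->]]] := lmon_gen SM x.
  have rS t : S t -> dot r t = 0.
    move=> /gS[a ->]; rewrite linear_sum big1 // => i _.
    by rewrite raddfMn /= rg mul0rn.
  by rewrite linearB /= !rS // subrr.
- move=> [K [a [K0 a0 E]]]; apply: nSm; apply: (lmon_sat SM (K := `|K|%N)); first by lia.
  by rewrite -scaler_nat natz gez0_abs ?ltW // E; apply: Sint.
exists r; split=> //; split=> // [s /gS[a ->]|x /rspan[K [b [K0 b0 E]]]].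
  rewrite linear_sum; apply: sumr_ge0 => i _ /=.
  by rewrite raddfMn /=; apply: mulrn_wge0.
pose bp i := if 0 <= b i then b i else 0; pose bn i := if 0 <= b i then 0 else - b i.
have dot0 (b' : 'I_N -> int) : (forall i, b i = 0 -> b' i = 0) ->
    dot r (\sum_i b' i *: g i) = 0.
  move=> bb'; rewrite linear_sum big1 // => i _ /=; rewrite linearZ /=.
  have [->|ri] := eqVneq (dot r (g i)) 0; first by rewrite mulr0.
  by rewrite bb' ?b0 ?mul0r.
exists `|K|%N, (\sum_i bp i *: g i), (\sum_i bn i *: g i); split; first by lia.
- by split; apply: Sint => i; rewrite /bp /bn; case: ifP => //; lia.
- by split; apply: dot0 => i; rewrite /bp /bn => ->; rewrite ?oppr0 lexx.
- rewrite -scaler_nat natz gez0_abs ?ltW // E -sumrB; apply: eq_bigr => i _.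
  by rewrite -scalerBl /bp /bn; case: ifP => _; rewrite ?subr0 // sub0r opprK.
Qed.

Variable r : M.
Hypothesis Sr : facet S r.

(** [m0], the sum of the generators on the facet, lies in its relative interior: inverting it turns
    [S] into the whole half-space of [r]. *)
Lemma facet_shift : exists m0, [/\ S m0, dot r m0 = 0 &
  forall x, 0 <= dot r x -> exists N, S (x + m0 *+ N)].
Proof.
have [N [g [Sg gS]]] := lmon_fg SM.
pose m0 := \sum_(i | dot r (g i) == 0) g i.
have Sm0 : S m0 by apply: lmon_sum.
have rm0 : dot r m0 = 0 by rewrite linear_sum big1 // => i /eqP.
(* Only generators on the face occur in [p], and a large multiple of [m0] contains each of them
   often enough. *)
have A p : S p -> dot r p = 0 -> exists K, S (m0 *+ K - p).
  move=> /gS[a ->] rp; exists (\sum_i a i)%N.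
  have a0 i : dot r (g i) != 0 -> a i = 0%N.
    move=> ri; have h0 j : 0 <= dot r (g j *+ a j).
      by rewrite raddfMn mulrn_wge0 // (facet_ge0 Sr).
    move: rp; rewrite linear_sum /= => /(psumr_eq0P (fun j _ => h0 j))/(_ i isT)/eqP.
    by rewrite raddfMn mulrn_eq0 (negbTE ri) orbF => /eqP.
  have : forall i, (a i <= \sum_i a i)%N by move=> i; rewrite (bigD1 i) //= leq_addr.
  move: (\sum_i a i)%N => K aK.
  rewrite (bigID (fun i => dot r (g i) == 0)) /= [X in _ - (_ + X)]big1 => [|i /a0->]; last first.
    by rewrite mulr0n.
  rewrite addr0 /m0 -sumrMnl -sumrB; apply: lmon_sum => i _.
  by rewrite -mulrnBr; [apply: lmon_muln | apply: aK].
have B x : dot r x = 0 -> exists K, S (x + m0 *+ K).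
  move=> /(facet_span Sr)[K [p [p' [K0 [Sp Sp'] [rp rp'] E]]]].
  have [L SL] := A p' Sp' rp'; exists L; apply: (lmon_sat SM K0).
  have -> : (x + m0 *+ L) *+ K = p + (m0 *+ L - p') + m0 *+ L *+ K.-1.
    rewrite mulrnDl E -[in LHS](prednK K0) [(m0 *+ L) *+ _.+1]mulrS.
    by rewrite addrA; congr (_ + _); rewrite addrA addrAC.
  apply: (lmonD SM); first exact: (lmonD SM).
  by apply: lmon_muln; apply: lmon_muln.
exists m0; split=> // x; rewrite le_eqVlt => /orP[/eqP/esym/B//|lx].
have [y1 ry1] := facet_prim Sr; have [s [s' [Ss Ss' E]]] := lmon_gen SM y1.
have rs : 0 < dot r s.
  by have := facet_ge0 Sr Ss'; move: ry1; rewrite E linearB /=; lia.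
have [|K SK] := B (x *+ `|dot r s| - s *+ `|dot r x|).
  rewrite linearB /= !raddfMn /= mulNrn -[dot r x *+ _]mulr_natl -[dot r s *+ _]mulr_natl !natz.
  by rewrite !gez0_abs ?ltW // mulrC subrr.
exists K; apply: (lmon_sat SM (K := `|dot r s|%N)); first by lia.
have h0 : (0 < `|dot r s|)%N by lia.
have -> : (x + m0 *+ K) *+ `|dot r s| =
    x *+ `|dot r s| - s *+ `|dot r x| + m0 *+ K + s *+ `|dot r x| + m0 *+ K *+ `|dot r s|.-1.
  rewrite mulrnDl -{2}(prednK h0) [(m0 *+ K) *+ _.+1]mulrS addrA; congr (_ + _).
  by rewrite [RHS]addrAC subrK.
apply: (lmonD SM); last by apply: lmon_muln; apply: lmon_muln.
by apply: (lmonD SM) => //; apply: lmon_muln.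
Qed.

Lemma height_one : exists s, S s /\ dot r s = 1.
Proof.
have [m0 [Sm0 rm0 h]] := facet_shift; have [x rx] := facet_prim Sr.
have [|N SN] := h x; first by rewrite rx.
by exists (x + m0 *+ N); rewrite linearD raddfMn /= rm0 mul0rn addr0.
Qed.

(** Take minus a vector of height one and add [m0] until every generator of positive height is
    shifted into [S]; in a sum of positive height one such generator absorbs the shift. *)
Lemma root_ex : exists e, root S r e.
Proof.
have [N [g [Sg gS]]] := lmon_fg SM.
have [m0 [Sm0 rm0 h]] := facet_shift; have [x rx] := facet_prim Sr.
have /choice[L LP] i : exists L, 0 < dot r (g i) -> S (g i - x + m0 *+ L).
  have [ri|_] := ltP 0 (dot r (g i)); last by exists 0%N.
  by have [|L SL] := h (g i - x); [rewrite linearB /= rx; lia | exists L].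
exists (- x + m0 *+ (\sum_i L i)); split.
  by rewrite linearD raddfMn linearN /= rm0 mul0rn addr0 rx.
move=> s /gS[a ->] rs.
have [i [ri ai]] : exists i, 0 < dot r (g i) /\ (0 < a i)%N.
  apply: contrapT => /forallNP nex; move: rs; rewrite linear_sum big1 ?ltxx // => i _.
  rewrite raddfMn /=; have := facet_ge0 Sr (Sg i); rewrite le_eqVlt => /orP[/eqP<-|ri].
    by rewrite mul0rn.
  have [->|ai] := posnP (a i); first by rewrite mulr0n.
  by case: (nex i).
have LE : (\sum_i L i = L i + (\sum_i L i - L i))%N.
  by rewrite subnKC // (bigD1 i) //= leq_addr.
have -> : \sum_j g j *+ a j + (- x + m0 *+ (\sum_i L i)) =
    (g i - x + m0 *+ L i) + m0 *+ (\sum_i L i - L i) +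
    (g i *+ (a i).-1 + \sum_(j | j != i) g j *+ a j).
  rewrite {1}LE (bigD1 i) //= -{1}(prednK ai) mulrS mulrnDr.
  by rewrite [LHS](AC (3*(1*2)) ((1*4*5)*6*(2*3))).
apply: (lmonD SM).
  by apply: (lmonD SM); [exact: LP | exact: lmon_muln].
apply: (lmonD SM); first exact: lmon_muln.
by apply: lmon_sum => j _; apply: lmon_muln.
Qed.

Lemma root_add e m : root S r e -> S m -> dot r m = 0 -> root S r (e + m).
Proof.
move=> [re he] Sm rm; split; first by rewrite linearD /= re rm addr0.
by move=> s Ss rs; rewrite addrA; apply: (lmonD SM) => //; apply: he.
Qed.

(** Adding face elements to a root gives roots, so differences of roots fill the hyperplane r = 0; a
    single root of height -1 does the rest. *)
Lemma root_generate (H : set M) : (forall x y, H x -> H y -> H (x - y)) ->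
  (forall e, root S r e -> H e) -> forall x, H x.
Proof.
move=> HB Hroot; have [e er] := root_ex.
have H0 : H 0 by rewrite -(subrr e); apply: HB; apply: Hroot.
have HN x : H x -> H (- x) by rewrite -sub0r; apply: HB.
have HD x y : H x -> H y -> H (x + y).
  by move=> Hx Hy; rewrite -(opprK y); apply: HB => //; apply: HN.
have HM x (K : int) : H x -> H (x *~ K).
  move=> Hx; have HMn j : H (x *+ j).
    by elim: j => [|j IH]; rewrite ?mulr0n // mulrS; apply: HD.
  by case: K => j; [apply: HMn | rewrite NegzE mulrNz; apply: HN; apply: HMn].
have [m0 [Sm0 rm0 h]] := facet_shift.
have A x : dot r x = 0 -> H x.
  move=> rx; have [|N SN] := h x; first by rewrite rx.
  have rr y : dot r (y + m0 *+ N) = dot r y by rewrite linearD raddfMn /= rm0 mul0rn addr0.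
  have -> : x = (e + (x + m0 *+ N)) - (e + m0 *+ N) by rewrite opprD addrACA subrr add0r addrK.
  apply: HB; apply: Hroot; apply: root_add => //; first by rewrite rr.
    exact: lmon_muln.
  by rewrite raddfMn /= rm0 mul0rn.
move=> x; rewrite -[x](addrK (e *~ dot r x)); apply: HB; last by apply: HM; apply: Hroot.
by apply: A; rewrite linearD raddfMz /=; case: er => -> _; lia.
Qed.

End AffineMonoid.

(** * Torus characters and monoid algebras *)

Section TorusCharacters.
Variables (k : fieldType) (n : nat).
Local Notation M := 'rV[int]_n.

Definition torus_pt (t : 'I_n -> k) : Prop := forall i, t i != 0.

Definition tchar (t : 'I_n -> k) (m : M) : k := \prod_i t i ^ m 0 i.

Lemma tchar0 t : tchar t 0 = 1.
Proof. by rewrite /tchar big1 // => i _; rewrite mxE expr0z. Qed.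

Lemma tcharD t x y : torus_pt t -> tchar t (x + y) = tchar t x * tchar t y.
Proof.
by move=> t0; rewrite -big_split; apply: eq_bigr => i _; rewrite mxE expfzDr.
Qed.

Lemma tchar_neq0 t x : torus_pt t -> tchar t x != 0.
Proof. by move=> t0; apply/prodf_neq0 => i _; rewrite expfz_neq0. Qed.

Lemma tcharN t x : torus_pt t -> tchar t (- x) = (tchar t x)^-1.
Proof.
move=> t0; apply: (mulfI (tchar_neq0 x t0)).
by rewrite -tcharD // subrr tchar0 mulfV // tchar_neq0.
Qed.

Definition one_ps (r : M) (s : k) : 'I_n -> k := fun i => s ^ r 0 i.

Lemma one_ps_torus r s : s != 0 -> torus_pt (one_ps r s).
Proof. by move=> s0 i; rewrite expfz_neq0. Qed.

Lemma tchar_one_ps r s m : s != 0 -> tchar (one_ps r s) m = s ^ dot r m.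
Proof.
move=> s0; rewrite /dot (big_morph (fun z => s ^ z) (fun x y => expfzDr x y s0) (expr0z s)).
by apply: eq_bigr => i _; rewrite /one_ps -exprz_exp.
Qed.

End TorusCharacters.

Lemma sum_subset_uniq (T : eqType) (V : zmodType) (r r' : seq T) (F : T -> V) :
  uniq r -> uniq r' -> {subset r <= r'} -> (forall s, s \notin r -> F s = 0) ->
  \sum_(s <- r) F s = \sum_(s <- r') F s.
Proof.
move=> ur ur' rr' F0; rewrite [RHS](bigID (mem r)) /= [X in _ + X]big1 // addr0.
rewrite -[RHS]big_filter; apply: perm_big; apply: uniq_perm => //.
  exact: filter_uniq.
by move=> s; rewrite mem_filter /=; case sr: (s \in r) => //=; rewrite rr'.
Qed.

Section ToricBasis.
Variables (k : fieldType) (R : idomainType) (c : {rmorphism k -> R}).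
Hypothesis k_char0 : [pchar k] =i pred0.
Variable n : nat.
Local Notation M := 'rV[int]_n.

(** [R] is the monoid algebra k[S] with monomials [X s]; the values of [X] off [S] are
    unconstrained. *)
Record toric_basis (S : set M) (X : M -> R) : Prop := ToricBasis {
  tb0 : X 0 = 1;
  tbD : forall s t, S s -> S t -> X (s + t) = X s * X t;
  tb_span : forall f, exists (r : seq M) (a : M -> k),
    [/\ uniq r, {in r, forall s, S s} & f = \sum_(s <- r) c (a s) * X s];
  tb_free : forall (r : seq M) (a : M -> k), uniq r -> {in r, forall s, S s} ->
    \sum_(s <- r) c (a s) * X s = 0 -> {in r, forall s, a s = 0}
}.

Variables (S : set M) (X : M -> R).
Hypothesis SM : lattice_monoid S.
Hypothesis XB : toric_basis S X.

(** The chosen expression of [f] may contain zero coefficients, so [cf] is canonical while [supp] is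
    not: freeness compares two expressions over the union of their supports. *)
Lemma tb_coefficients : exists (cf : R -> M -> k) (supp : R -> seq M),
  [/\ forall f, [/\ uniq (supp f), {in supp f, forall s, S s},
        f = \sum_(s <- supp f) c (cf f s) * X s & forall s, s \notin supp f -> cf f s = 0]
    & forall f (r : seq M) (a : M -> k), uniq r -> {in r, forall s, S s} ->
        f = \sum_(s <- r) c (a s) * X s -> forall s, cf f s = if s \in r then a s else 0].
Proof.
have [supp /choice[a aP]] := choice (tb_span XB).
pose cf f s := if s \in supp f then a f s else 0.
have cfE f : f = \sum_(s <- supp f) c (cf f s) * X s.
  by have [_ _ {1}->] := aP f; apply: eq_big_seq => s sf; rewrite /cf sf.
exists cf, supp; split=> [f|f r b ur rS fE s].
  have [us sS _] := aP f; split=> // s sf.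
  by rewrite /cf (negbTE sf).
pose b' s := if s \in r then b s else 0.
have fE' : f = \sum_(s <- r) c (b' s) * X s.
  by rewrite {1}fE; apply: eq_big_seq => x xr; rewrite /b' xr.
have [us sS _] := aP f.
pose r' := undup (supp f ++ r).
have ur' : uniq r' by apply: undup_uniq.
have h1 : {subset supp f <= r'} by move=> x xs; rewrite mem_undup mem_cat xs.
have h2 : {subset r <= r'} by move=> x xs; rewrite mem_undup mem_cat xs orbT.
have r'S : {in r', forall s, S s}.
  by move=> x; rewrite mem_undup mem_cat => /orP[/sS|/rS].
have cE (g : M -> k) (q : seq M) : uniq q -> {subset q <= r'} ->
    (forall x, x \notin q -> g x = 0) ->
    \sum_(x <- q) c (g x) * X x = \sum_(x <- r') c (g x) * X x.
  move=> uq qr' g0; apply: sum_subset_uniq => // x /g0 ->.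
  by rewrite rmorph0 mul0r.
have e : \sum_(s <- r') c (cf f s - b' s) * X s = 0.
  transitivity (\sum_(s <- supp f) c (cf f s) * X s - \sum_(s <- r) c (b' s) * X s).
    2: by rewrite -cfE -fE' subrr.
  have b'0 x : x \notin r -> b' x = 0 by rewrite /b' => /negbTE ->.
  have cf0 x : x \notin supp f -> cf f x = 0 by rewrite /cf => /negbTE ->.
  rewrite (cE _ _ us h1 cf0) (cE _ _ ur h2 b'0) -sumrB.
  by apply: eq_bigr => x _; rewrite rmorphB mulrBl.
have [sr'|sr'] := boolP (s \in r').
  by apply/eqP; rewrite -subr_eq0; apply/eqP; apply: (tb_free XB ur' r'S e).
move: sr'; rewrite mem_undup mem_cat negb_or => /andP[sf sr].
by rewrite /cf (negbTE sf) (negbTE sr).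
Qed.

Lemma tb_coord : exists (cf : R -> M -> k) (supp : R -> seq M),
  [/\ forall f, [/\ uniq (supp f), {in supp f, forall s, S s},
        f = \sum_(s <- supp f) c (cf f s) * X s & forall s, s \notin supp f -> cf f s = 0],
      forall f g s, cf (f + g) s = cf f s + cf g s,
      forall a f s, cf (c a * f) s = a * cf f s
    & forall s t, S s -> cf (X s) t = (s == t)%:R].
Proof.
have [cf [supp [sP cfP]]] := tb_coefficients.
have wide f (r' : seq M) : uniq r' -> {subset supp f <= r'} ->
    f = \sum_(s <- r') c (cf f s) * X s.
  have [ur _ fE b0] := sP f; rewrite [LHS]fE.
  move=> ur' rr'; apply: sum_subset_uniq => // s /b0 ->.
  by rewrite rmorph0 mul0r.
exists cf, supp; split=> // [f g s|a f s|s t Ss].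
- pose r' := undup (supp f ++ supp g).
  have ur' : uniq r' by apply: undup_uniq.
  have [_ fS _ f0] := sP f; have [_ gS _ g0] := sP g.
  have r'S : {in r', forall s, S s}.
    by move=> x; rewrite mem_undup mem_cat => /orP[/fS|/gS].
  rewrite (cfP (f + g) r' (fun s => cf f s + cf g s)) //.
    case: ifP => //; rewrite mem_undup mem_cat => /negbT; rewrite negb_or => /andP[sf sg].
    by rewrite f0 // g0 // addr0.
  have h1 : {subset supp f <= r'} by move=> x xs; rewrite mem_undup mem_cat xs.
  have h2 : {subset supp g <= r'} by move=> x xs; rewrite mem_undup mem_cat xs orbT.
  transitivity (\sum_(s <- r') c (cf f s) * X s + \sum_(s <- r') c (cf g s) * X s).
    by rewrite -wide // -wide.
  by rewrite -big_split; apply: eq_bigr => x _; rewrite rmorphD mulrDl.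
- have [uf fS fE f0] := sP f.
  rewrite (cfP (c a * f) (supp f) (fun s => a * cf f s)) //.
    by case: ifP => // /negbT /f0 ->; rewrite mulr0.
  by rewrite {1}fE mulr_sumr; apply: eq_bigr => x _; rewrite rmorphM mulrA.
- rewrite (cfP (X s) [:: s] (fun=> 1)) //.
  + by rewrite inE eq_sym; case: eqP.
  + by move=> x; rewrite inE => /eqP ->.
  + by rewrite big_seq1 rmorph1 mul1r.
Qed.

Lemma tb_ind (P : R -> Prop) : (forall f g, P f -> P g -> P (f + g)) ->
  (forall a f, P f -> P (c a * f)) -> (forall s, S s -> P (X s)) -> forall f, P f.
Proof.
move=> PD PZ PX f; have [r [a [ur rS ->]]] := tb_span XB f.
have P0 : P 0 by rewrite -(mul0r (X 0)) -(rmorph0 c); apply: PZ; apply: PX; apply: lmon0.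
rewrite big_seq; elim/big_ind: _ => // s sr.
by apply: PZ; apply: PX; apply: rS.
Qed.

Lemma tb_ext (D D' : R -> R) : klinear c D -> klinear c D' ->
  (forall s, S s -> D (X s) = D' (X s)) -> D =1 D'.
Proof.
move=> [DD DZ] [DD' DZ'] e; apply: tb_ind => // [f g|a f] h.
  by move=> h'; rewrite DD DD' h h'.
by rewrite DZ DZ' h.
Qed.

Lemma tb_linear_ext (phi : M -> R) :
  exists D, klinear c D /\ forall s, S s -> D (X s) = phi s.
Proof.
have [cf [supp [sP cfD cfZ cfX]]] := tb_coord.
pose D f := \sum_(s <- supp f) c (cf f s) * phi s.
have DE f (r' : seq M) : uniq r' -> {subset supp f <= r'} ->
    D f = \sum_(s <- r') c (cf f s) * phi s.
  have [ur _ _ b0] := sP f.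
  move=> ur' rr'; apply: sum_subset_uniq => // s /b0 ->.
  by rewrite rmorph0 mul0r.
exists D; split; first split.
- move=> f g; pose r' := undup (supp f ++ supp g ++ supp (f + g)).
  have ur' : uniq r' by apply: undup_uniq.
  rewrite !(DE _ r') //; last 3 first.
  + by move=> x xs; rewrite mem_undup !mem_cat xs !orbT.
  + by move=> x xs; rewrite mem_undup !mem_cat xs.
  + by move=> x xs; rewrite mem_undup !mem_cat xs !orbT.
  by rewrite -big_split; apply: eq_bigr => s _; rewrite cfD rmorphD mulrDl.
- move=> a f; pose r' := undup (supp f ++ supp (c a * f)).
  have ur' : uniq r' by apply: undup_uniq.
  rewrite !(DE _ r') //; last 2 first.
  + by move=> x xs; rewrite mem_undup !mem_cat xs.
  + by move=> x xs; rewrite mem_undup !mem_cat xs !orbT.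
  by rewrite mulr_sumr; apply: eq_bigr => s _; rewrite cfZ rmorphM mulrA.
- move=> s Ss; rewrite (DE _ (undup (s :: supp (X s)))) ?undup_uniq //; last first.
    by move=> x xs; rewrite mem_undup inE xs orbT.
  have sr : s \in undup (s :: supp (X s)) by rewrite mem_undup mem_head.
  rewrite (bigD1_seq s sr (undup_uniq _)) /=.
  rewrite cfX // eqxx rmorph1 mul1r big1 ?addr0 // => t ts.
  by rewrite cfX // eq_sym (negbTE ts) rmorph0 mul0r.
Qed.

Lemma tb_kend D : klinear c D -> D 1 = 1 ->
  (forall s t, S s -> S t -> D (X s * X t) = D (X s) * D (X t)) -> kend c D.
Proof.
move=> Dl D1 DM; have [DD DZ] := Dl; split=> // [|a]; last first.
  by rewrite -[c a]mulr1 DZ D1 mulr1.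
apply: tb_ind => [f g hf hg y|a f h y|s Ss].
- by rewrite mulrDl !DD hf hg mulrDl.
- by rewrite -mulrA !DZ h mulrA.
apply: tb_ind => [f g hf hg|a f h|t St].
- by rewrite mulrDr !DD hf hg mulrDr.
- by rewrite mulrCA !DZ h mulrCA.
- exact: DM.
Qed.

Lemma tb_neq0 s : S s -> X s != 0.
Proof.
move=> Ss; apply/eqP => X0.
have h : {in [:: s], forall t, S t} by move=> t; rewrite inE => /eqP->.
have := @tb_free _ _ XB [:: s] (fun=> 1) isT h.
by rewrite big_seq1 X0 mulr0 => /(_ erefl s (mem_head _ _)) /eqP; rewrite oner_eq0.
Qed.

Lemma torus_action_ex : exists T : ('I_n -> k) -> R -> R, forall t, torus_pt t ->
  kaut c (T t) /\ forall s, S s -> T t (X s) = c (tchar t s) * X s.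
Proof.
have /choice[T TP] (t : 'I_n -> k) := tb_linear_ext (fun s => c (tchar t s) * X s).
exists T => t t0; have [Tl TX] := TP t.
have kt t' : torus_pt t' -> kend c (T t').
  move=> t'0; have [Tl' TX'] := TP t'; apply: tb_kend => // [|s s' Ss Ss'].
    by rewrite -(tb0 XB) TX' ?tchar0 ?rmorph1 ?mul1r //; apply: lmon0.
  rewrite -(tbD XB) // !TX' //; last exact: lmonD.
  by rewrite tcharD // (tbD XB) // rmorphM; ring.
split=> //; split; first exact: kt.
have t'0 : torus_pt (fun i => (t i)^-1) by move=> i; rewrite invr_neq0.
have [Tl' TX'] := TP (fun i => (t i)^-1).
have inv s : tchar (fun i => (t i)^-1) s * tchar t s = 1.
  rewrite /tchar -big_split big1 // => i _ /=.
  by rewrite exprz_inv -expfzDr // addNr expr0z.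
have inv' s : tchar t s * tchar (fun i => (t i)^-1) s = 1 by rewrite mulrC inv.
exists (T (fun i => (t i)^-1)); apply: tb_ext => //.
- by split=> *; rewrite /= ?Tl.1 ?Tl'.1 ?Tl.2 ?Tl'.2.
- by move=> s Ss; rewrite /= TX // Tl'.2 TX' // mulrA -rmorphM ?inv ?inv' rmorph1 mul1r.
- by split=> *; rewrite /= ?Tl'.1 ?Tl.1 ?Tl'.2 ?Tl.2.
- by move=> s Ss; rewrite /= TX' // Tl.2 TX // mulrA -rmorphM ?inv ?inv' rmorph1 mul1r.
Qed.

End ToricBasis.

(** * Root automorphisms of a toric algebra *)

Section RootDerivations.
Variables (k : fieldType) (R : idomainType) (c : {rmorphism k -> R}).
Hypothesis k_char0 : [pchar k] =i pred0.
Variable n : nat.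
Local Notation M := 'rV[int]_n.
Variables (S : set M) (X : M -> R).
Hypothesis SM : lattice_monoid S.
Hypothesis XB : toric_basis c S X.
Variable r : M.
Hypothesis Sr : facet S r.

Let rge0 s : S s -> 0 <= dot r s. Proof. exact: facet_ge0. Qed.

(** Each application lowers the height [dot r s] by one, and the coefficient vanishes at height
    zero; this gives local nilpotence. *)
Lemma root_derivation_ex e : root S r e -> exists d, lnd c d /\
  forall s, S s -> d (X s) = c (dot r s)%:~R * X (s + e).
Proof.
move=> [re he]; have [d [dl dX]] := tb_linear_ext XB (fun s => c (dot r s)%:~R * X (s + e)).
exists d; split=> //; have [dD dZ] := dl.
have dM : forall x y, d (x * y) = d x * y + x * d y.
  apply: (tb_ind SM XB) => [f g hf hg y|a f h y|s Ss].
  - by rewrite mulrDl !dD hf hg; ring.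
  - by rewrite -mulrA !dZ h; ring.
  apply: (tb_ind SM XB) => [f g hf hg|a f h|t St].
  - by rewrite mulrDr !dD hf hg; ring.
  - by rewrite mulrCA !dZ h; ring.
  rewrite -(tbD XB) // !dX //; last exact: (lmonD SM).
  have sh u w : S u -> S w -> c (dot r u)%:~R * X (u + w + e) = c (dot r u)%:~R * X (u + e) * X w.
    move=> Su Sw; have := rge0 Su; rewrite le_eqVlt => /orP[/eqP<-|ru].
      by rewrite mulr0z rmorph0 !mul0r.
    by rewrite addrAC (tbD XB (he _ Su ru) Sw) mulrA.
  rewrite linearD /= intrD rmorphD mulrDl sh // [s + t]addrC sh //; ring.
have d1 : d 1 = 0.
  by rewrite -(tb0 XB) dX ?linear0 ?mulr0z ?rmorph0 ?mul0r //; apply: (lmon0 SM).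
split=> // [a|]; first by rewrite -[c a]mulr1 dZ d1 mulr0.
have itl j : klinear c (iter j d).
  by elim: j => // j [D Z]; split=> *; rewrite !iterS ?D ?Z ?dD ?dZ.
have itge x i j : (i <= j)%N -> iter i d x = 0 -> iter j d x = 0.
  move=> /subnK <- xi; rewrite iterD xi; exact: klinear0 (itl _).
apply: (tb_ind SM XB) => [f g [i fi] [j gj]|a f [j fj]|s Ss].
- exists (maxn i j); case: (itl (maxn i j)) => -> _.
  by rewrite (itge _ i) ?leq_maxl // (itge _ j) ?leq_maxr // addr0.
- by exists j; case: (itl j) => _ ->; rewrite fj mulr0.
have [m] : exists m : nat, dot r s = m by exists `|dot r s|%N; have := rge0 Ss; lia.
elim: m s Ss => [|m IH] s Ss rs.
  by exists 1%N; rewrite /= dX // rs mulr0z rmorph0 mul0r.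
have [||j hj] := IH (s + e); first by apply: he => //; lia.
  by rewrite linearD /= re; lia.
by exists j.+1; rewrite iterSr dX //; case: (itl j) => _ ->; rewrite hj mulr0.
Qed.

Definition root_der (e : M) : R -> R :=
  if pselect (root S r e) is left h then sval (cid (root_derivation_ex h)) else fun=> 0.

Lemma root_der_lnd e : root S r e -> lnd c (root_der e).
Proof. by rewrite /root_der => h; case: pselect => // h'; case: cid => d []. Qed.

Lemma root_derX e s : root S r e -> S s ->
  root_der e (X s) = c (dot r s)%:~R * X (s + e).
Proof. by rewrite /root_der => h; case: pselect => // h'; case: cid => d [_ /= dX] /dX. Qed.

Lemma root_der_flat e s : root S r e -> S s -> dot r s = 0 -> root_der e (X s) = 0.
Proof. by move=> er Ss rs; rewrite root_derX // rs mulr0z rmorph0 mul0r. Qed.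

Lemma root_der_shift e m : root S r e -> S m -> dot r m = 0 ->
  root_der (e + m) =1 (fun x => X m * root_der e x).
Proof.
move=> er Sm rm; have er' := root_add SM er Sm rm.
apply: (tb_ext SM XB); first exact: lnd_klinear (root_der_lnd er').
  have [D Z] := lnd_klinear (root_der_lnd er).
  by split=> *; rewrite ?D ?Z; ring.
move=> s Ss; rewrite !root_derX //.
have := rge0 Ss; rewrite le_eqVlt => /orP[/eqP<-|rs].
  by rewrite mulr0z rmorph0 !mul0r mulr0.
by rewrite addrA (tbD XB (proj2 er _ Ss rs) Sm); ring.
Qed.

(** Both roots lower the height h by one, so either order produces the coefficient h(h - 1). *)
Lemma root_der_comm e e' : root S r e -> root S r e' ->
  forall x, root_der e (root_der e' x) = root_der e' (root_der e x).
Proof.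
move=> er er'; have [[re he] [re' he']] := (er, er').
have [D Z] := lnd_klinear (root_der_lnd er).
have [D' Z'] := lnd_klinear (root_der_lnd er').
apply: (tb_ext SM XB); [by split=> *; rewrite ?D' ?D ?Z' ?Z..|].
move=> s Ss; rewrite !root_derX // Z Z'.
have := rge0 Ss; rewrite le_eqVlt => /orP[/eqP<-|rs].
  by rewrite mulr0z rmorph0 !mul0r.
rewrite !root_derX ?linearD /= ?re ?re' -?addrA ?[e + e']addrC //; [exact: he|exact: he'].
Qed.

Definition root_aut e a : R -> R := lnd_exp c (root_der e) (c a).

Lemma root_aut_kaut e a : root S r e -> kaut c (root_aut e a).
Proof. by move=> /root_der_lnd dl; apply: lnd_exp_kaut => //; case: dl. Qed.

Lemma root_autD e a b x : root S r e ->
  root_aut e (a + b) x = root_aut e a (root_aut e b x).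
Proof.
move=> /root_der_lnd dl; rewrite /root_aut rmorphD lnd_expD //.
by case: dl.
Qed.

Lemma root_aut0 e x : root S r e -> root_aut e 0 x = x.
Proof. by move=> /root_der_lnd dl; rewrite /root_aut rmorph0 lnd_exp0. Qed.

Lemma root_aut_comm e e' a b x : root S r e -> root S r e' ->
  root_aut e a (root_aut e' b x) = root_aut e' b (root_aut e a x).
Proof.
move=> er er'; apply: lnd_exp_comm_klinear; last 2 first.
- exact: root_der_lnd.
- move=> z; symmetry; apply: lnd_exp_comm_klinear => //.
  + exact: lnd_klinear (root_der_lnd er').
  + exact: root_der_lnd.
  + by move=> y; apply: root_der_comm.
- by apply: kend_klinear; case: (root_aut_kaut a er).
Qed.

Lemma root_aut_torus e a T t x : root S r e -> torus_pt t -> kend c T ->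
  (forall s, S s -> T (X s) = c (tchar t s) * X s) ->
  T (root_aut e a x) = root_aut e (tchar t e * a) (T x).
Proof.
move=> er t0 Tk TX; have [re he] := er.
have dl := root_der_lnd er; have [TD TZ] := kend_klinear Tk.
have [dD dZ] := lnd_klinear dl; have [_ _ dc _] := dl.
rewrite /root_aut mulrC rmorphM -(lnd_exp_scale _ _ dl (dc _)).
have [_ _ Tc] := Tk; rewrite -[in RHS](Tc a).
apply: lnd_exp_conj => //; first by apply: lnd_scale.
apply: (tb_ext SM XB); [by split=> *; rewrite ?(dD, TD, dZ, TZ) ?(dD, TD, dZ, TZ); ring..|].
move=> s Ss; rewrite root_derX // TZ (TX s Ss) dZ root_derX //.
have := rge0 Ss; rewrite le_eqVlt => /orP[/eqP<-|rs].
  by rewrite mulr0z rmorph0 !mul0r !mulr0.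
by rewrite (TX _ (he _ Ss rs)) tcharD // !rmorphM; ring.
Qed.

End RootDerivations.

Lemma intr_pchar0 (k : fieldType) (z : int) :
  [pchar k] =i pred0 -> (z%:~R == 0 :> k) = (z == 0).
Proof.
move=> k0; case: z => m; first by rewrite (pcharf0P _).1.
by rewrite NegzE rmorphN oppr_eq0 (pcharf0P _).1 // oppr_eq0.
Qed.

(** * Centralizers of root automorphisms *)

Section RootCentralizer.
Variables (k : fieldType) (R : idomainType) (c : {rmorphism k -> R}).
Hypothesis k_char0 : [pchar k] =i pred0.
Variable n : nat.
Local Notation M := 'rV[int]_n.
Variables (S : set M) (X : M -> R).
Hypothesis SM : lattice_monoid S.
Hypothesis XB : toric_basis c S X.
Variable r : M.
Hypothesis Sr : facet S r.

Let rge0 s : S s -> 0 <= dot r s. Proof. exact: facet_ge0. Qed.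

Local Notation root_der := (root_der SM XB Sr).
Local Notation root_aut := (root_aut SM XB Sr).

Variable e0 : M.
Hypothesis er : root S r e0.
Let d := root_der e0.
Let dl : lnd c d. Proof. exact: root_der_lnd. Qed.
Let dX s : S s -> d (X s) = c (dot r s)%:~R * X (s + e0).
Proof. exact: root_derX. Qed.

(** [d] shifts every exponent by [e0], so no cancellation can occur: its kernel is spanned by the
    monomials of height zero. *)
Lemma flat_coef (cf : R -> M -> k) :
  (forall f g s, cf (f + g) s = cf f s + cf g s) ->
  (forall a f s, cf (c a * f) s = a * cf f s) ->
  (forall s t, S s -> cf (X s) t = (s == t)%:R) ->
  forall f s, d f = 0 -> cf f s != 0 -> dot r s = 0.
Proof.
move=> cfD cfZ cfX f s df; have [dD dZ] := lnd_klinear dl.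
have cf_d g : cf (d g) (s + e0) = (dot r s)%:~R * cf g s.
  move: g; apply: (tb_ind SM XB) => [f1 f2 h1 h2|a f1 h1|t St].
  - by rewrite dD !cfD h1 h2 mulrDr.
  - by rewrite dZ !cfZ h1 mulrCA.
  rewrite dX // cfZ (cfX t) //; have := rge0 St; rewrite le_eqVlt => /orP[/eqP rt|rt].
    rewrite -rt mulr0z mul0r; have [<-|_] := eqVneq t s; last by rewrite mulr0.
    by rewrite -rt mulr0z mul0r.
  rewrite cfX; last by case: er => _; apply.
  by rewrite (inj_eq (addIr e0)); have [->|_] := eqVneq t s; rewrite ?mulr0.
have cf0 : cf 0 (s + e0) = 0 by have := cfZ 0 0 (s + e0); rewrite mulr0 mul0r.
have := cf_d f; rewrite df cf0 => /esym /eqP; rewrite mulf_eq0 intr_pchar0 //.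
by case/orP => [/eqP//|->].
Qed.

Lemma flat_ind (P : R -> Prop) : (forall f g, P f -> P g -> P (f + g)) ->
  (forall a f, P f -> P (c a * f)) -> (forall s, S s -> dot r s = 0 -> P (X s)) ->
  forall f, d f = 0 -> P f.
Proof.
move=> PD PZ PX f df.
have [cf [supp [sP cfD cfZ cfX]]] := tb_coord XB.
have P0 : P 0.
  rewrite -(mul0r (X 0)) -(rmorph0 c); apply: PZ; apply: PX; first exact: (lmon0 SM).
  by rewrite linear0.
have [us sS -> _] := sP f; rewrite big_seq; elim/big_ind: _ => // s sf.
have [->|cf0] := eqVneq (cf f s) 0; first by rewrite rmorph0 mul0r.
by apply: PZ; apply: PX; [apply: sS | apply: (flat_coef cfD cfZ cfX df)].
Qed.

Lemma flatX s : S s -> dot r s = 0 -> d (X s) = 0.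
Proof. exact: root_der_flat. Qed.

Variable s1 : M.
Hypotheses (Ss1 : S s1) (rs1 : dot r s1 = 1).

Let Ss1e : S (s1 + e0). Proof. by case: er => _; apply; rewrite ?rs1. Qed.
Let rs1e : dot r (s1 + e0) = 0. Proof. by rewrite linearD /= rs1 (proj1 er). Qed.

Lemma der_s1 : d (X s1) = X (s1 + e0).
Proof. by rewrite dX // rs1 rmorph1 mul1r. Qed.

Lemma root_shift_muln s j : S s -> (j%:Z <= dot r s)%R -> S (s + e0 *+ j).
Proof.
move=> Ss; elim: j => [|j IH] js; first by rewrite mulr0n addr0.
have Sj : S (s + e0 *+ j) by apply: IH; lia.
rewrite mulrSr addrA; case: er => re; apply=> //.
by rewrite linearD raddfMn /= re -mulr_natl natz; lia.
Qed.

Lemma tb_exp s j : S s -> X s ^+ j = X (s *+ j).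
Proof.
move=> Ss; elim: j => [|j IH]; first by rewrite (tb0 XB).
by rewrite exprS IH mulrS (tbD XB) //; apply: lmon_muln.
Qed.

(* Multiplying by a power of the invariant [d (X s1)] makes every monomial a
   product of a power of [X s1] and an invariant. *)
Lemma slice_normal_form s l : S s -> dot r s = l%:Z ->
  [/\ S (s + e0 *+ l), dot r (s + e0 *+ l) = 0 &
   X (s1 + e0) ^+ l * X s = X s1 ^+ l * X (s + e0 *+ l)].
Proof.
move=> Ss rs; have Sl : S (s + e0 *+ l) by apply: root_shift_muln => //; rewrite rs.
split=> //.
  by rewrite linearD raddfMn /= (proj1 er) rs -mulr_natl natz; lia.
rewrite !tb_exp // -!(tbD XB) //; try exact: lmon_muln.
by rewrite mulrnDl -addrA [e0 *+ l + s]addrC.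
Qed.

(** [X s1] is a local slice of [d]: by [slice_normal_form] every monomial becomes a kernel element
    times a power of [X s1] after multiplication by an invariant, which cancels in a domain. *)
Lemma kend_slice_ext f g : kend c f -> kend c g ->
  (forall x, d x = 0 -> f x = x) -> (forall x, d x = 0 -> g x = x) ->
  f (X s1) = g (X s1) -> f =1 g.
Proof.
move=> fk gk ff gg fg; apply: (tb_ext SM XB); [exact: kend_klinear..|] => s Ss.
have [l rl] : exists l : nat, dot r s = l%:Z.
  by exists `|dot r s|%N; have := rge0 Ss; lia.
have [Sl rl0 E] := slice_normal_form Ss rl.
have X0 : X (s1 + e0) ^+ l != 0 by rewrite expf_neq0 // (tb_neq0 XB).
have [f' fE] := kend_rmorph fk; have [g' gE] := kend_rmorph gk.
have fX m : S m -> dot r m = 0 -> f' (X m) = X m.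
  by move=> Sm rm; rewrite -fE ff // flatX.
have gX m : S m -> dot r m = 0 -> g' (X m) = X m.
  by move=> Sm rm; rewrite -gE gg // flatX.
apply: (mulfI X0).
have := congr1 f' E; rewrite !rmorphM !rmorphXn /= (fX _ Ss1e rs1e) (fX _ Sl rl0) => h1; rewrite fE h1.
have := congr1 g' E; rewrite !rmorphM !rmorphXn /= (gX _ Ss1e rs1e) (gX _ Sl rl0) => h2; rewrite gE h2.
by rewrite -fE -gE fg.
Qed.

Variable u : R -> R.
Hypothesis u_aut : kaut c u.
Hypothesis u_comm : forall x, u (root_aut e0 1 x) = root_aut e0 1 (u x).
Hypothesis u_conj : forall m, S m -> dot r m = 0 -> forall x,
  u (root_aut (e0 + m) 1 (u (root_aut (e0 + m) (-1) x))) =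
  root_aut (e0 + m) 1 (u (root_aut (e0 + m) (-1) (u x))).

Let uk : kend c u. Proof. by case: u_aut. Qed.
Let ud x : u (d x) = d (u x).
Proof.
apply: (lnd_exp_comm k_char0 uk dl) => y.
by have := u_comm y; rewrite /root_aut rmorph1.
Qed.

Let u_exp h x : u (lnd_exp c d h x) = lnd_exp c d (u h) (u x).
Proof. exact: lnd_exp_conj. Qed.

Let du h : d h = 0 -> d (u h) = 0.
Proof. by move=> dh; rewrite -ud dh; apply: klinear0 (kend_klinear uk). Qed.

Lemma lnd_exp_ker_inj h h' : d h = 0 -> d h' = 0 ->
  (forall x, lnd_exp c d h x = lnd_exp c d h' x) -> h = h'.
Proof.
move=> dh dh' e.
have X0 : d (X s1) != 0 by rewrite der_s1 (tb_neq0 XB).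
apply: (mulIf X0).
have l1 := lnd_scale dl dh; have l2 := lnd_scale dl dh'.
apply: (lnd_exp_inj k_char0 l1 l2) => x.
by rewrite !lnd_exp_scale // !mul1r.
Qed.

(** Conjugation by [u] sends exp(h d) to exp(u(h) d). That [u] commutes with its conjugate by
    exp(X^m d) therefore reads u(X^m) - u^2(X^m) = X^m - u(X^m), since h is determined by exp(h
    d). *)
Lemma centralizer_square_zero m : S m -> dot r m = 0 ->
  u (u (X m) - X m) = u (X m) - X m.
Proof.
move=> Sm rm; have dm := flatX Sm rm.
have duu := du (du dm); have dum := du dm.
have dN h : d h = 0 -> d (- h) = 0.
  by move=> dh; rewrite -sub0r (klinearB _ _ (lnd_klinear dl)) dh (lnd0 dl) subrr.
have dD h h' : d h = 0 -> d h' = 0 -> d (h + h') = 0.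
  by move=> h1 h2; case: dl => -> *; rewrite h1 h2 addr0.
have E a x : root_aut (e0 + m) a x = lnd_exp c d (c a * X m) x.
  have -> : root_aut (e0 + m) a x = lnd_exp c (fun x => X m * d x) (c a) x.
    by congr (lnd_exp c _ _ _); apply/funext => y; apply: root_der_shift.
  by rewrite lnd_exp_scale.
have uN h : u (- h) = - u h.
  by rewrite -sub0r (kendB uk) (klinear0 (kend_klinear uk)) sub0r.
have := u_conj Sm rm.
have [ui [uiK uK]] : exists ui, cancel u ui /\ cancel ui u.
  by case: u_aut => _ [ui]; exists ui.
move=> h; apply/eqP; rewrite -eqr_opp; apply/eqP.
rewrite (kendB uk) !opprB; apply: lnd_exp_ker_inj => [||x].
- by apply: dD => //; apply: dN.
- by apply: dD => //; apply: dN.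
have := h (ui (ui x)); rewrite !E rmorph1 rmorphN1 mulN1r mul1r !u_exp !uN !uK.
by rewrite -!lnd_expD //; apply: dN.
Qed.

(** By linearity (u - 1)^2 vanishes on the kernel. Applied to x^2, with g = u(x) - x, it gives 2 g^2
    = 0. *)
Lemma centralizer_fixes_flat x : d x = 0 -> u x = x.
Proof.
have [uD uM uc] := uk.
have sq y : d y = 0 -> u (u y - y) = u y - y.
  apply: (@flat_ind (fun y => u (u y - y) = u y - y)) => [f g hf hg|a f hf|s]; last exact: centralizer_square_zero.
    have e : u (f + g) - (f + g) = (u f - f) + (u g - g) by rewrite uD; ring.
    by rewrite e uD hf hg.
  have e : u (c a * f) - c a * f = c a * (u f - f) by rewrite uM uc mulrBr.
  by rewrite e uM uc hf.
move=> dx; have dx2 : d (x * x) = 0 by case: dl => _ dM *; rewrite dM dx mul0r mulr0 addr0.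
set g := u x - x; have ux : u x = x + g by rewrite addrC subrK.
have ug : u g = g by apply: sq.
have := sq _ dx2; rewrite uM ux.
have -> : (x + g) * (x + g) - x * x = (x * g + x * g) + g * g by ring.
rewrite !uD !uM ux ug => e.
have : 2%:R * (g * g) == 0.
  by apply/eqP; rewrite -(subrr (x * g + x * g + g * g)) -{1}e; ring.
rewrite mulf_eq0 (alg_natr_eq0 c k_char0) /= mulf_eq0 orbb => /eqP g0.
by rewrite g0 addr0.
Qed.

Lemma tb_coef_mulX (cf : R -> M -> k) :
  (forall f g s, cf (f + g) s = cf f s + cf g s) ->
  (forall a f s, cf (c a * f) s = a * cf f s) ->
  (forall s t, S s -> cf (X s) t = (s == t)%:R) ->
  forall p f w, S p -> cf (X p * f) w = cf f (w - p).
Proof.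
move=> cfD cfZ cfX p f w Sp; move: f; apply: (tb_ind SM XB) => [f g hf hg|a f hf|s Ss].
- by rewrite mulrDr !cfD hf hg.
- by rewrite mulrCA !cfZ hf.
rewrite -(tbD XB) // !cfX //; last exact: (lmonD SM).
by rewrite [in RHS]eq_sym subr_eq [p + s]addrC eq_sym.
Qed.

Lemma root_aut_flat e a x : root S r e -> d x = 0 -> root_aut e a x = x.
Proof.
move=> er' dx; apply: (lnd_exp_ker k_char0); first exact: root_der_lnd.
have [D Z] := lnd_klinear (root_der_lnd SM XB Sr er').
move: x dx; apply: flat_ind => [f g hf hg|b f hf|s Ss rs].
- by rewrite D hf hg addr0.
- by rewrite Z hf mulr0.
- exact: root_der_flat.
Qed.

Lemma root_aut_s1 e a : root S r e -> root_aut e a (X s1) = X s1 + c a * X (s1 + e).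
Proof.
move=> er'; have dl' := root_der_lnd SM XB Sr er'.
have dX1 : root_der e (X s1) = X (s1 + e).
  by rewrite root_derX // rs1 rmorph1 mul1r.
rewrite /root_aut lnd_exp_deg1 // dX1 //; apply: root_der_flat => //.
  by case: er' => _; apply; rewrite ?rs1.
by rewrite linearD /= rs1 (proj1 er').
Qed.

Definition root_prod (L : seq (M * k)) : R -> R :=
  foldr (fun p f => root_aut p.1 p.2 \o f) id L.

Lemma root_prodE (L : seq (M * k)) : (forall p, p \in L -> root S r p.1) ->
  [/\ kend c (root_prod L), forall x, d x = 0 -> root_prod L x = x
    & root_prod L (X s1) = X s1 + \sum_(p <- L) c p.2 * X (s1 + p.1)].
Proof.
elim: L => [|p L IH] Lr; first by split; rewrite ?big_nil ?addr0.
have pr : root S r p.1 by apply: Lr; rewrite mem_head.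
have Lr' q : q \in L -> root S r q.1 by move=> qL; apply: Lr; rewrite inE qL orbT.
have [Lk Lf Ls] := IH Lr'.
have [pk _] := root_aut_kaut k_char0 SM XB Sr p.2 pr.
split=> [|x dx|]; first exact: kend_comp.
  by rewrite /= Lf // root_aut_flat.
rewrite /= Ls big_cons; case: (pk) => -> _ _; rewrite root_aut_s1 // -addrA.
congr (_ + (_ + _)); apply: root_aut_flat => //.
have [dD dZ] := lnd_klinear dl.
rewrite big_seq; elim/big_ind: _ => [|x y hx hy|q qL].
- exact: lnd0 dl.
- by rewrite dD hx hy addr0.
- rewrite dZ flatX ?mulr0 //; first by case: (Lr' q qL) => _; apply; rewrite ?rs1.
  by rewrite linearD /= rs1 (proj1 (Lr' q qL)).
Qed.

(** As [u] fixes the kernel of [d], it is determined by [u (X s1) - X s1], an element [q] of the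
    kernel. Each monomial m of [q] turns out to give a root m - s1, and the product of these root
    automorphisms agrees with [u] on the slice. *)
Lemma centralizer_root_prod : exists L : seq (M * k),
  [/\ uniq [seq p.1 | p <- L], forall p, p \in L -> root S r p.1 /\ p.2 != 0
    & u =1 root_prod L].
Proof.
have [cf [supp [sP cfD cfZ cfX]]] := tb_coord XB.
have cfM := tb_coef_mulX cfD cfZ cfX.
have fix_flat := centralizer_fixes_flat.
set q := u (X s1) - X s1.
have dq : d q = 0.
  by rewrite /q (klinearB _ _ (lnd_klinear dl)) -ud der_s1 fix_flat ?subrr ?flatX.
have uX1 : u (X s1) = X s1 + q by rewrite addrC subrK.
have [us sS qE q0] := sP q.
pose l := [seq m <- supp q | cf q m != 0].
have lP m : m \in l -> [/\ S m, dot r m = 0 & cf q m != 0].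
  rewrite mem_filter => /andP[qm mq]; split=> //; first exact: sS.
  exact: (flat_coef cfD cfZ cfX dq).
have cf_notS f x : ~ S x -> cf f x = 0.
  by move=> nSx; have [_ fS _ ->//] := sP f; apply/negP => /fS.
have [u' uE] := kend_rmorph uk.
have dexp i : d (q ^+ i) = 0.
  elim: i => [|i IH]; first by rewrite expr0 -(rmorph1 c); case: dl.
  by rewrite exprS; case: dl => _ -> *; rewrite dq IH mul0r mulr0 addr0.
have cfMn f i x : cf (f *+ i) x = i%:R * cf f x.
  by rewrite -[f *+ i]mulr_natl -(rmorph_nat c) cfZ.
have cf0 x : cf 0 x = 0 by have := cfZ 0 0 x; rewrite mulr0 mul0r.
have lroot m : m \in l -> root S r (m - s1).
  move=> /lP[Sm rm cfm]; split; first by rewrite linearB /= rm rs1.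
  move=> s Ss rs; apply: contrapT => nS.
  have [j rj] : exists j : nat, dot r s = j.+1%:Z.
    by exists `|dot r s|%N.-1; lia.
  (* Applying [u] to this identity and comparing coefficients shows that u(X^s) contains the
     exponent s + (m - s1), which must then lie in [S]. *)
  have [Sl rl E] := slice_normal_form Ss rj.
  have := congr1 u' E; rewrite !rmorphM !rmorphXn /= -!uE uX1.
  rewrite (fix_flat _ (flatX Ss1e rs1e)) (fix_flat _ (flatX Sl rl)) tb_exp //.
  set P := s + e0 *+ j.+1.
  move/(congr1 (fun f => cf f (m + s1 *+ j + P))).
  rewrite cfM; last exact: lmon_muln.
  have -> : m + s1 *+ j + P - (s1 + e0) *+ j.+1 = s + (m - s1).
    rewrite /P mulrnDl [s1 *+ j.+1]mulrSr; apply/eqP; rewrite subr_eq; apply/eqP.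
    by rewrite [RHS](AC ((1*2)*3) (((2*4)*(1*6))*(3*5))) /= addNr addr0.
  have [SP rP] : S P /\ dot r P = 0 by [].
  rewrite cf_notS // exprDn mulr_suml; clearbody P.
  rewrite (big_morph (fun f => cf f _) (fun f g => cfD f g _) (cf0 _)).
  (* Powers of [q] have height zero, so only the term linear in [q] has the height of the chosen
     exponent; its coefficient j + 1 is nonzero in characteristic zero. *)
  rewrite (bigD1 (Ordinal (isT : (1 < j.+2)%N))) //= big1 ?addr0 => [|i i1].
    rewrite mulrnAl cfMn bin1 subn1 /= expr1 tb_exp // mulrAC -(tbD XB) //; last exact: lmon_muln.
    rewrite cfM; last by apply: (lmonD SM) => //; apply: lmon_muln.
    rewrite -[m + _ + P]addrA addrK => /esym /eqP; rewrite mulf_eq0 (negbTE cfm) orbF.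
    by rewrite (pcharf0P _).1.
  rewrite mulrnAl cfMn tb_exp // mulrAC -(tbD XB) //; last exact: lmon_muln.
  rewrite cfM; last by apply: (lmonD SM) => //; apply: lmon_muln.
  apply/eqP; rewrite mulf_eq0; apply/orP; right; apply: contraNT i1 => /(flat_coef cfD cfZ cfX (dexp i)).
  rewrite linearB !linearD !raddfMn /= rm rs1 rP => h.
  by apply/eqP/val_inj => /=; have := ltn_ord i; lia.
pose L := [seq (m - s1, cf q m) | m <- l].
have LP p : p \in L -> root S r p.1 /\ p.2 != 0.
  by move=> /mapP[m ml ->]; split; [apply: lroot | case: (lP _ ml)].
exists L; split=> //.
  rewrite -map_comp map_inj_uniq ?filter_uniq //.
  by move=> x y /= /addIr.
have [Lk Lf Ls] := root_prodE (fun p pL => proj1 (LP p pL)).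
apply: kend_slice_ext => //.
rewrite Ls uX1; congr (_ + _); rewrite big_map big_filter [LHS]qE [RHS]big_mkcond.
apply: eq_bigr => m _; case: eqP => [->|_] /=; first by rewrite rmorph0 mul0r.
by rewrite addrC subrK.
Qed.

End RootCentralizer.

Lemma uniq_map_inj (T1 T2 : eqType) (f : T1 -> T2) (s : seq T1) :
  uniq [seq f x | x <- s] -> {in s &, injective f}.
Proof.
elim: s => [|z s IH] //= /andP[fz us] x y; rewrite !inE.
case/orP=> [/eqP->|xs]; case/orP=> [/eqP->|ys] // e; last exact: IH.
  by case/negP: fz; rewrite e map_f.
by case/negP: fz; rewrite -e map_f.
Qed.

Section DoubleCentralizer.
Variables (k : fieldType) (R : idomainType) (c : {rmorphism k -> R}).
Hypothesis k_char0 : [pchar k] =i pred0.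
Variable n : nat.
Local Notation M := 'rV[int]_n.
Variables (S : set M) (X : M -> R).
Hypothesis SM : lattice_monoid S.
Hypothesis XB : toric_basis c S X.
Variable r : M.
Hypothesis Sr : facet S r.

Local Notation root_aut := (root_aut SM XB Sr).

(** Root automorphisms of one facet commute, so [u] commutes with all of them and is a product of
    such. It also commutes with the torus elements on which the character [e0] is trivial, and these
    exclude every other root. *)
Lemma double_centralizer_root e0 a u : root S r e0 -> kaut c u ->
  (forall g, kaut c g -> (forall x, g (root_aut e0 a x) = root_aut e0 a (g x)) ->
    forall x, u (g x) = g (u x)) -> exists b, u =1 root_aut e0 b.
Proof.
move=> er u_aut cc; have [s1 [Ss1 rs1]] := height_one SM Sr.
have root_comm e b : root S r e -> forall x, u (root_aut e b x) = root_aut e b (u x).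
  by move=> er'; apply: cc => [|x]; [exact: root_aut_kaut | exact: root_aut_comm].
have [||L [uL LP uE]] :=
  @centralizer_root_prod k R c k_char0 n S X SM XB r Sr e0 er s1 Ss1 rs1 u u_aut.
- exact: root_comm.
- by move=> m Sm rm x; rewrite !root_comm //; apply: root_add.
have [Lk Lf Ls] := root_prodE k_char0 SM XB Sr er Ss1 rs1 (fun p pL => proj1 (LP p pL)).
have [cf [supp [sP cfD cfZ cfX]]] := tb_coord XB.
have [T TP] := torus_action_ex SM XB.
have Le0 p : p \in L -> p.1 = e0.
  move=> pL; have [pr p0] := LP p pL; apply: contrapT => pe.
  pose m := p.1 - e0; have m0 : m != 0 by rewrite subr_eq0; apply/eqP.
  have rm : dot r m = 0 by rewrite linearB /= (proj1 pr) (proj1 er) subrr.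
  (* The correction by [r] makes [w] orthogonal to [e0], which has height -1, without changing its
     product with [m], which is [dot m m] and positive. *)
  pose w := m + dot m e0 *: r.
  have two0 : 2%:R != 0 :> k by rewrite (pcharf0P _).1.
  pose t := one_ps w (2%:R : k).
  have t0 : torus_pt t by apply: one_ps_torus.
  have te0 : tchar t e0 = 1.
    by rewrite tchar_one_ps // dotDl dotZl (proj1 er) mulrN1 subrr.
  have tp : tchar t p.1 != 1.
    have -> : p.1 = m + e0 by rewrite subrK.
    rewrite tcharD // te0 mulr1 tchar_one_ps // dotDl dotZl rm mulr0 addr0.
    have := dot_gt0 m0; case: (dot m m) => // -[//|i] _.
    rewrite -exprnP -natrX -subr_eq0 -(natrB _ (n := 1)) ?expn_gt0 //.
    by rewrite (pcharf0P _).1 // subn_eq0 -ltnNge -{1}(expn0 2) ltn_exp2l.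
  have [Tk TX] := TP t t0.
  have Tu x : T t (u x) = u (T t x).
    rewrite (cc (T t)) // => y.
    by rewrite (root_aut_torus SM XB Sr a y er t0 (proj1 Tk) TX) te0 mul1r.
  have [uk _] := u_aut; have [uD uM uc] := uk; have [[TD TM Tc] _] := Tk.
  have := Tu (X s1); rewrite (TX _ Ss1) uM uc uE Ls TD TX // mulrDr => /addrI.
  rewrite (klinear_sum _ _ _ (kend_klinear (proj1 Tk))).
  move/(congr1 (fun f => cf f (s1 + p.1))).
  have cf0 x : cf 0 x = 0 by have := cfZ 0 0 x; rewrite mulr0 mul0r.
  rewrite cfZ !(big_morph (fun f => cf f _) (fun f g => cfD f g _) (cf0 _)).
  have Ss1e q : q \in L -> S (s1 + q.1).
    by move=> qL; case: (LP q qL) => -[_ h] _; apply: h; rewrite ?rs1.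
  have uniqp q : q \in L -> (s1 + q.1 == s1 + p.1) = (q == p).
    move=> qL; rewrite (inj_eq (addrI s1)); apply/eqP/eqP => [e|-> //].
    by apply: (uniq_map_inj uL) => //; apply: (addrI s1).
  have pickp (w' : M * k -> k) : \sum_(q <- L) w' q * (s1 + q.1 == s1 + p.1)%:R = w' p.
    rewrite (bigD1_seq p) ?(map_uniq uL) //= eqxx mulr1 big_seq_cond big1 ?addr0 //.
    by move=> q /andP[qL qp]; rewrite uniqp // (negbTE qp) mulr0.
  have -> : \sum_(q <- L) cf (T t (c q.2 * X (s1 + q.1))) (s1 + p.1) =
      p.2 * tchar t (s1 + p.1).
    rewrite -(pickp (fun q => q.2 * tchar t (s1 + q.1))); apply: eq_big_seq => q qL.
    by rewrite TM Tc TX ?cfZ ?cfX ?mulrA //; apply: Ss1e.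
  have -> : \sum_(q <- L) cf (c q.2 * X (s1 + q.1)) (s1 + p.1) = p.2.
    rewrite -(pickp (fun q => q.2)); apply: eq_big_seq => q qL.
    by rewrite cfZ cfX //; apply: Ss1e.
  rewrite tcharD // mulrCA; move/(mulfI (tchar_neq0 s1 t0))/(canRL (mulKf p0)).
  by rewrite mulVf // => e; case/eqP: tp.
have [L0|] := eqVneq L [::].
  by exists 0 => x; rewrite uE L0 /= root_aut0.
case: L uL Le0 uE {LP Lk Lf Ls} => [//|p [|q L]] uL Le0 uE _.
  by exists p.2 => x; rewrite uE /= (Le0 p (mem_head _ _)).
by move: uL; rewrite /= inE (Le0 p) ?(Le0 q) ?inE ?eqxx ?orbT.
Qed.

End DoubleCentralizer.

(** * The image of one root group *)

Section DerivationLemmas.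
Variables (k : fieldType) (B : idomainType) (c : {rmorphism k -> B}).
Hypothesis k_char0 : [pchar k] =i pred0.

Lemma lnd_exp_intertwine g d d' : kend c g -> lnd c d -> lnd c d' ->
  (forall x, g (lnd_exp c d 1 x) = lnd_exp c d' 1 (g x)) -> forall x, g (d x) = d' (g x).
Proof.
move=> gk dl d'l ge x; rewrite -(flow_coef1 x dl) -(flow_coef1 (g x) d'l).
have [f fE] := kend_rmorph gk; rewrite !fE -coef_map.
suff -> : map_poly f (flow c d x) = flow c d' (f x) by [].
apply: (poly_nat_ext c k_char0) => n; rewrite -[in LHS](rmorph_nat f) horner_map /=.
rewrite !(horner_flow_nat k_char0) // -!fE.
by elim: n => // n IH; rewrite !iterS ge IH.
Qed.

Lemma lnd_gen0 d N (y : 'I_N -> B) : generates c y -> lnd c d ->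
  (forall l, d (y l) = 0) -> forall x, d x = 0.
Proof.
move=> gen dl dy x.
have l0 : lnd c (fun=> 0 : B).
  by split=> *; rewrite ?addr0 ?mul0r ?mulr0 ?addr0 //; exists 1%N.
apply: (lnd_exp_inj k_char0 dl l0) => {}x; have [F ->] := gen x.
rewrite !(kend_mmap _ _ (lnd_exp_kend k_char0 1 _)) //; apply: eq_bigr => m _.
by congr (_ * _); apply: eq_bigr => i _ /=; rewrite !(lnd_exp_ker k_char0).
Qed.

End DerivationLemmas.

Section RootImage.
Variables (k : closedFieldType) (R B : idomainType).
Variables (c : {rmorphism k -> R}) (c' : {rmorphism k -> B}).
Hypothesis k_char0 : [pchar k] =i pred0.
Hypothesis k_unc : ~ countable [set: k].
Variable n : nat.
Local Notation M := 'rV[int]_n.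
Variables (S : set M) (X : M -> R).
Hypothesis SM : lattice_monoid S.
Hypothesis XB : toric_basis c S X.
Variables (N : nat) (y : 'I_N -> B).
Hypothesis y_gen : generates c' y.

Variable Phi : (R -> R) -> B -> B.
Hypothesis Phi_aut : forall f, kaut c f -> kaut c' (Phi f).
Hypothesis PhiM : forall f g, kaut c f -> kaut c g -> Phi (f \o g) = Phi f \o Phi g.
Hypothesis Phi_inj : forall f g, kaut c f -> kaut c g -> Phi f = Phi g -> f = g.
Hypothesis Phi_surj : forall g, kaut c' g -> exists2 f, kaut c f & Phi f = g.

Lemma Phi_id : Phi id = id.
Proof.
have k1 := kaut_id c; have [_ /bij_inj inj] := Phi_aut k1.
apply/funext => x; apply: inj; rewrite -[LHS]/((Phi id \o Phi id) x) -PhiM //.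
Qed.

Lemma Phi_comm f g : kaut c f -> kaut c g -> (forall x, f (g x) = g (f x)) ->
  forall x, Phi f (Phi g x) = Phi g (Phi f x).
Proof.
move=> fk gk fg x; rewrite -[LHS]/((Phi f \o Phi g) x) -PhiM //.
by rewrite (_ : f \o g = g \o f) ?(PhiM gk fk) //; apply/funext.
Qed.

Lemma Phi_comm_inv f g : kaut c f -> kaut c g ->
  (forall x, Phi f (Phi g x) = Phi g (Phi f x)) -> forall x, f (g x) = g (f x).
Proof.
move=> fk gk fg x.
suff E : f \o g = g \o f by rewrite -[LHS]/((f \o g) x) E.
apply: Phi_inj; [exact: kaut_comp..|]; rewrite (PhiM fk gk) (PhiM gk fk); exact/funext.
Qed.

Variable r : M.
Hypothesis Sr : facet S r.
Variable e : M.
Hypothesis er : root S r e.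

Local Notation root_aut := (root_aut SM XB Sr).
Let V a := Phi (root_aut e a).

Let ua a : kaut c (root_aut e a). Proof. exact: root_aut_kaut. Qed.
Let Va a : kaut c' (V a). Proof. exact: Phi_aut. Qed.

Let VD a b x : V (a + b) x = V a (V b x).
Proof.
rewrite -[RHS]/((V a \o V b) x) -PhiM //; congr (Phi _ x).
by apply/funext => z; apply: root_autD.
Qed.

Lemma root_aut_inj : injective (root_aut e).
Proof.
move=> a b ab; have [s1 [Ss1 rs1]] := height_one SM Sr.
have := congr1 (@^~ (X s1)) ab; rewrite !root_aut_s1 // => /addrI /mulIf.
move=> /(_ (tb_neq0 XB _)) h; apply: (fmorph_inj c); apply: h.
by case: er => _; apply; rewrite ?rs1.
Qed.

Let VT t T x a : torus_pt t -> kaut c T -> (forall s, S s -> T (X s) = c (tchar t s) * X s) ->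
  Phi T (V a x) = V (tchar t e * a) (Phi T x).
Proof.
move=> t0 Tk TX; rewrite -[LHS]/((Phi T \o V a) x) -[RHS]/((V _ \o Phi T) x) -!PhiM //.
congr (Phi _ x); apply/funext => z.
by rewrite /= (root_aut_torus SM XB Sr a z er t0 (proj1 Tk) TX).
Qed.

Let V_homog t : t != 0 ->
  exists g, kaut c' g /\ forall a x, g (V a x) = V (t * a) (g x).
Proof.
move=> t0; have t'0 : t^-1 != 0 by rewrite invr_neq0.
have [T TP] := torus_action_ex SM XB.
have [Tk TX] := TP _ (one_ps_torus r t'0).
exists (Phi (T (one_ps r t^-1))); split=> [|a x]; first exact: Phi_aut.
rewrite (VT _ _ (one_ps_torus r t'0) Tk TX) tchar_one_ps // (proj1 er).
by rewrite -exprnN expr1 invrK.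
Qed.

(** [D a], the logarithm of [V a], is additive in [a]. Multiplying [D 1] by a scalar s again gives
    some [D (sigma s)]; this sigma is a field automorphism, and tau is its inverse. *)
Lemma root_image : exists (d : B -> B) (tau : {rmorphism k -> k}),
  [/\ lnd c' d, exists x, d x != 0, bijective tau
    & forall a, V a = lnd_exp c' d (c' (tau a))].
Proof.
have /choice[D DP] a : exists d, lnd c' d /\ V a =1 lnd_exp c' d 1.
  have [d dl dV] := unipotent_lnd k_char0 (proj1 (Va a))
    (unipotent_family k_char0 k_unc y_gen Va VD V_homog a).
  by exists d.
have Dl a := proj1 (DP a); have DV a := proj2 (DP a).
have D_inj a b : D a =1 D b -> a = b.
  move=> ab; apply: root_aut_inj; apply: Phi_inj => //; apply/funext => x.
  by rewrite -/(V a) -/(V b) !DV; congr (lnd_exp _ _ _ _); apply/funext.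
have DD a b x : D (a + b) x = D a x + D b x.
  have [|l lE] := lnd_add k_char0 (Dl a) (Dl b).
    by move=> z; rewrite -!DV -!VD addrC.
  by apply: (lnd_exp_inj k_char0 (Dl _) l) => z; rewrite lE -!DV -VD.
have D0 x : D 0 x = 0 by apply: (addIr (D 0 x)); rewrite -DD !add0r.
have Dg t : t != 0 -> exists g, kaut c' g /\ forall a x, g (D a x) = D (t * a) (g x).
  move=> /V_homog[g [gk gV]]; exists g; split=> // a.
  apply: (lnd_exp_intertwine k_char0 (proj1 gk)) => // x.
  by rewrite -!DV gV.
(* Whatever commutes with [V 1] commutes with [D 1], fixes constants, and so commutes with exp(s D
   1). Its preimage is thus in the double centralizer of [root_aut e 1], hence in the root group. *)
have DZ1 s : exists b, forall x, c' s * D 1 x = D b x.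
  have ds : D 1 (c' s) = 0 by case: (Dl 1).
  have Ek := lnd_exp_kaut k_char0 (Dl 1) ds.
  have [f fk fE] := Phi_surj Ek.
  have [g gk gc|b fb] := @double_centralizer_root k R c k_char0 n S X SM XB r Sr e 1 f er fk.
    apply: Phi_comm_inv => // x; rewrite fE; symmetry.
    have gD z : Phi g (D 1 z) = D 1 (Phi g z).
      apply: (lnd_exp_comm k_char0 (proj1 (Phi_aut gk)) (Dl 1)) => w.
      by rewrite -!DV; apply: Phi_comm => //; apply: ua.
    rewrite (lnd_exp_conj _ _ (proj1 (Phi_aut gk)) (Dl 1) (Dl 1) gD).
    by case: (Phi_aut gk) => -[_ _ ->].
  exists b; apply: (lnd_exp_inj k_char0 (lnd_scale (Dl 1) ds) (Dl b)) => x.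
  rewrite lnd_exp_scale // mul1r -fE -DV /V.
  by congr (Phi _ x); apply/funext.
have [sigma sP] := choice DZ1.
(* Conjugation by the torus carries the case t = 1 to every nonzero t; this is what makes sigma
   multiplicative. *)
have sZ s t x : c' s * D t x = D (t * sigma s) x.
  have [->|t0] := eqVneq t 0; first by rewrite mul0r D0 mulr0.
  have [g [[gk [g' gK g'K]] gD]] := Dg t t0; rewrite -(g'K x).
  have [_ gM gc] := gk.
  by rewrite -(mulr1 t) -gD -gc -gM sP gD mulr1.
have sD : zmod_morphism sigma.
  move=> a b; apply: D_inj => x; rewrite -sP rmorphB mulrBl !sP.
  by apply/eqP; rewrite subr_eq -DD subrK.
have sM : monoid_morphism sigma.
  split=> [|a b]; apply: D_inj => x; first by rewrite -sP rmorph1 mul1r.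
  by rewrite -sP rmorphM -mulrA sP sZ mulrC.
pose m1 := GRing.isZmodMorphism.Build k k sigma sD.
pose m2 := GRing.isMonoidMorphism.Build k k sigma sM.
pose sg : {rmorphism k -> k} := HB.pack_for {rmorphism k -> k} sigma m1 m2.
have D1x : exists x, D 1 x != 0.
  apply: contrapT => /forallNP h; have /eqP : 1 = 0 :> k; last by rewrite oner_eq0.
  apply: D_inj => x; rewrite D0; apply/eqP; apply: contrapT => /negP; exact: h.
(* If t is not a value, all t - sigma(s) are invertible. A relation between the derivations [D] at
   their inverses, tested on the generators of [B], makes t a root of the sigma-image of a nonzero
   polynomial over k; that polynomial splits, so t is a value. *)
have s_surj t : exists s, sigma s = t.
  apply: contrapT => /forallNP ns.
  have ts s : t - sigma s != 0 by rewrite subr_eq0; apply/eqP => /esym /ns.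
  have [m [z [a [zI zC a0 rel]]]] :=
    uncountable_dep_gen (fun s l => D (t - sigma s)^-1 (y l)) y_gen k_unc.
  have Dsum (I : finType) (b : I -> k) x : \sum_i D (b i) x = D (\sum_i b i) x.
    by rewrite (big_morph (fun a => D a x) (fun a b => DD a b x) (D0 x)).
  have sum0 : \sum_i (t - sigma (z i))^-1 * sigma (a i) = 0.
    apply: D_inj => x; rewrite D0; apply: (lnd_gen0 k_char0 y_gen (Dl _)) => l.
    rewrite -Dsum; apply: etrans (rel l); apply: eq_bigr => i _.
    by rewrite sZ.
  have p0 := lagrange_comb_neq0 zI a0.
  have : (map_poly sg (lagrange_comb a z)).[t] = 0.
    rewrite /lagrange_comb rmorph_sum horner_sum.
    transitivity ((\prod_l (t - sigma (z l))) *
        \sum_i (t - sigma (z i))^-1 * sigma (a i)); last by rewrite sum0 mulr0.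
    rewrite mulr_sumr; apply: eq_bigr => i _.
    rewrite [X in X.[t]](map_polyZ sg) hornerZ rmorph_prod horner_prod /= [in RHS](bigD1 i) //= [LHS]mulrC.
    rewrite mulrA [_ * (t - _)^-1]mulrAC mulfV // mul1r; congr (_ * _).
    by apply: eq_bigr => j _; rewrite [X in X.[t]](map_polyXsubC sg) hornerXsubC.
  have [w ->] := closed_field_poly_normal (lagrange_comb a z).
  rewrite map_polyZ hornerZ => /eqP; rewrite mulf_eq0 fmorph_eq0 lead_coef_eq0.
  rewrite (negbTE p0) orFb rmorph_prod horner_prod prodf_seq_eq0.
  case/hasP => q _; rewrite andTb [X in X.[t]](map_polyXsubC sg) hornerXsubC /=.
  by rewrite (negbTE (ts q)).
have s_bij : bijective sigma.
  have [tau tauP] := choice s_surj; exists tau => // s.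
  by apply: (fmorph_inj sg); rewrite /= tauP.
have [tau tK sK] := s_bij.
have tD : zmod_morphism tau.
  by move=> a b; apply: (fmorph_inj sg); rewrite rmorphB /= !sK.
have tM : monoid_morphism tau.
  by split=> [|a b]; apply: (fmorph_inj sg); rewrite ?rmorph1 ?rmorphM /= !sK.
pose n1 := GRing.isZmodMorphism.Build k k tau tD.
pose n2 := GRing.isMonoidMorphism.Build k k tau tM.
pose tg : {rmorphism k -> k} := HB.pack_for {rmorphism k -> k} tau n1 n2.
exists (D 1), tg; split=> //; first by exists sigma.
move=> a; apply/funext => x.
have -> : lnd_exp c' (D 1) (c' (tg a)) x = lnd_exp c' (fun x => c' (tau a) * D 1 x) 1 x.
  by rewrite lnd_exp_scale ?mul1r //; case: (Dl 1).
rewrite DV; congr (lnd_exp _ _ _ _); apply/funext => z.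
by rewrite sP sK.
Qed.

End RootImage.

(** * The image of the roots of a facet *)

Section FieldEndomorphisms.
Variable k : fieldType.
Hypothesis k_char0 : [pchar k] =i pred0.

Lemma natr_char0 m : (m%:R == 0 :> k) = (m == 0%N).
Proof. exact: (pcharf0P _).1. Qed.

(** Comparing at s and s + 1 gives 2 f = g + h, whence (f - g)^2 = 0. *)
Lemma field_endo_square (f g h : {rmorphism k -> k}) :
  (forall s, s != 0 -> f s ^+ 2 = g s * h s) -> f =1 g.
Proof.
move=> e0; have e s : f s ^+ 2 = g s * h s.
  have [->|/e0//] := eqVneq s 0; by rewrite !rmorph0 expr2 !mul0r.
move=> s; have es := e s; have := e (s + 1); rewrite !rmorphD !rmorph1 => e1.
have e2 : 2%:R * f s = g s + h s.
  have -> : 2%:R * f s = (f s + 1) ^+ 2 - f s ^+ 2 - 1 by ring.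
  by rewrite e1 es; ring.
have : (f s - g s) ^+ 2 == 0.
  have -> : (f s - g s) ^+ 2 = f s ^+ 2 - (2%:R * f s) * g s + g s ^+ 2 by ring.
  by rewrite es e2; apply/eqP; ring.
by rewrite expf_eq0 /= subr_eq0 => /eqP.
Qed.

Lemma two_powz (a b : int) : (2%:R : k) ^ a = 2%:R ^ b -> a = b.
Proof.
wlog ab : a b / (a <= b)%R.
  by move=> h; case: (leP a b) => [/h//|/ltW/h h' /esym/h' ->].
have two0 : 2%:R != 0 :> k by rewrite natr_char0.
move=> e; have : (2%:R : k) ^ (b - a) = 1 by rewrite expfzDr // -e -expfzDr // subrr expr0z.
have : (0 <= b - a)%R by rewrite subr_ge0.
case E : (b - a) => [[|j]|//] _; first by move=> _; apply/eqP; rewrite eq_sym -subr_eq0 E.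
move/eqP; rewrite -exprnP -natrX -subr_eq0 -(natrB _ (n := 1)) ?expn_gt0 //.
by rewrite natr_char0 subn_eq0 leqNgt -{1}(expn0 2) ltn_exp2l.
Qed.

(** The value at 2, which has infinite order, gives a = b. Replacing s by j + s for all naturals j
    gives equal powers of the polynomials X + f(s) and X + g(s), hence equal roots. *)
Lemma field_endo_power (f g : {rmorphism k -> k}) (a b : int) : a != 0 ->
  (forall s, s != 0 -> f s ^ a = g s ^ b) -> f =1 g /\ a = b.
Proof.
move=> a0 e.
have ab : a = b.
  by apply: two_powz; have := e 2%:R; rewrite !rmorph_nat natr_char0; apply.
split=> //; subst b.
have [m fgm] : exists m : nat, forall s, s != 0 -> f s ^+ m.+1 = g s ^+ m.+1.
  case: a a0 e => [[|m]|m] // _ e; exists m => s s0; first exact: e.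
  by have := e s s0; rewrite NegzE -!exprnN => /invr_inj.
have all s : f s ^+ m.+1 = g s ^+ m.+1.
  by have [->|/fgm//] := eqVneq s 0; rewrite !rmorph0.
move=> s; pose P z : {poly k} := ('X + z%:P) ^+ m.+1.
have PE : P (f s) = P (g s).
  apply: (poly_nat_ext idfun k_char0) => j; rewrite /P !horner_exp !hornerE.
  by have := all (j%:R + s); rewrite !rmorphD !rmorph_nat.
have := congr1 (fun p : {poly k} => p.[- f s]) PE.
rewrite /P !horner_exp !hornerE addNr expr0n /= => /esym /eqP.
by rewrite expf_eq0 /= addrC subr_eq0 => /eqP.
Qed.

Variable n : nat.
Local Notation M := 'rV[int]_n.

Lemma tchar_separates (e e' : M) :
  (forall t : 'I_n -> k, torus_pt t -> tchar t e = tchar t e') -> e = e'.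
Proof.
move=> h; apply/eqP; rewrite -subr_eq0; apply: contraT => m0.
have two0 : 2%:R != 0 :> k by rewrite natr_char0.
have := h _ (one_ps_torus (e - e') two0); rewrite !tchar_one_ps // => /two_powz E.
by have := dot_gt0 m0; rewrite linearB /= E subrr ltxx.
Qed.

End FieldEndomorphisms.

Lemma sum_regroup (V : zmodType) (I : eqType) (l : seq (I * V)) :
  \sum_(p <- l) p.2 = \sum_(q <- undup [seq p.1 | p <- l]) \sum_(p <- l | p.1 == q) p.2.
Proof.
under [RHS]eq_bigr do rewrite big_mkcond.
rewrite exchange_big /=; apply: eq_big_seq => p pl.
rewrite (bigD1_seq p.1) ?undup_uniq ?mem_undup ?map_f //= eqxx big1 ?addr0 // => q.
by rewrite eq_sym => /negbTE ->.
Qed.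

Section WeightLemmas.
Variables (k : fieldType) (R : pzRingType) (c : {rmorphism k -> R}).

Lemma subspace0 : subspace c [set 0].
Proof. by split=> [//|x y -> ->|a x ->]; rewrite ?addr0 ?mulr0. Qed.

(** An instance of [weight_component] with the zero subspace: [f] is subtracted from the summand of
    its own weight, or added as a further index when no summand has that weight. *)
Lemma weight_single (U : Type) (I : eqType) (g : U -> R -> R)
    (w : I -> U -> k) (x : I -> R) (r : seq I) (f : R) (wf : U -> k) :
  (forall t, klinear c (g t)) -> uniq r ->
  {in r &, forall i j, i != j -> exists t, w i t != w j t} ->
  {in r, forall i t, g t (x i) = c (w i t) * x i} ->
  (forall t, g t f = c (wf t) * f) -> f = \sum_(i <- r) x i -> f != 0 ->
  exists i, [/\ i \in r, forall t, wf t = w i t & f = x i].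
Proof.
move=> gl ur wr gx gf fE f0.
have g0 t y : [set (0 : R)] y -> [set (0 : R)] (g t y).
  by move=> ->; apply: klinear0 (gl t).
have [[i [ir wfi]]|nex] := pselect (exists i, i \in r /\ forall t, wf t = w i t).
  exists i; split=> //.
  pose x' j := if j == i then x i - f else x j.
  have x'w : {in r, forall j t, g t (x' j) = c (w j t) * x' j}.
    move=> j jr t; rewrite /x'; case: eqP => [->|_]; last exact: gx.
    by rewrite (klinearB _ _ (gl t)) gx // gf wfi mulrBr.
  have : [set 0] (\sum_(j <- r) x' j).
    rewrite /= (bigD1_seq i) //= /x' eqxx.
    rewrite (eq_bigr x) => [|j /negbTE -> //].
    by rewrite addrAC -(bigD1_seq i) //= -fE subrr.
  move/(weight_component gl subspace0 g0 ur wr x'w)/(_ i ir).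
  by rewrite /x' eqxx /= => /eqP; rewrite subr_eq0 => /eqP.
exfalso; pose w' (o : option I) := if o is Some i then w i else wf.
pose x' (o : option I) := if o is Some i then x i else - f.
have h : [set 0] (\sum_(o <- None :: map Some r) x' o).
  by rewrite /= big_cons big_map -fE addNr.
have u' : uniq (None :: map Some r).
  by rewrite /= map_inj_uniq ?ur ?andbT; [apply/negP => /mapP[] | move=> ? ? []].
have d' : {in None :: map Some r &, forall o p, o != p -> exists t, w' o t != w' p t}.
  have aux i : i \in r -> exists t, wf t != w i t.
    move=> ir; apply: contrapT => /forallNP nt; apply: nex; exists i; split=> // t.
    by apply/eqP; apply: contrapT => /negP; apply: nt.
  move=> [i|] [j|]; rewrite !inE /= ?(mem_map (fun _ _ => @Some_inj _ _ _)) // => ir jr ij.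
  - exact: wr.
  - by have [t wt] := aux i ir; exists t; rewrite eq_sym.
  - exact: aux.
have gw' : {in None :: map Some r, forall o t, g t (x' o) = c (w' o t) * x' o}.
  move=> [i|]; rewrite !inE /= ?(mem_map (fun _ _ => @Some_inj _ _ _)) // => ir t.
    exact: gx.
  by rewrite /= -sub0r (klinearB _ _ (gl t)) (klinear0 (gl t)) gf !sub0r mulrN.
have := weight_component gl subspace0 g0 u' d' gw' h (mem_head _ _).
by move=> /= /eqP; rewrite oppr_eq0 (negbTE f0).
Qed.

End WeightLemmas.

(** * Height gradings from a locally nilpotent derivation *)

Section SlicedGrading.
Variables (k : fieldType) (B : idomainType) (c : {rmorphism k -> B}).
Hypothesis k_char0 : [pchar k] =i pred0.
Variables d g : B -> B.
Hypothesis dl : lnd c d.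
Hypothesis gl : klinear c g.
Hypothesis g_ker : forall f, d f = 0 -> g f = f.
Hypothesis dg : forall x, d (g x) = 2%:R * g (d x).

Let two0 : 2%:R != 0 :> k. Proof. by rewrite natr_char0. Qed.
Let dkl : klinear c d := lnd_klinear dl.

Definition level (z : int) (x : B) : Prop := g x = c (2%:R ^ z) * x.

Lemma iter_klinear j : klinear c (iter j d).
Proof.
have [D Z] := dkl.
by split=> [x y|a x]; elim: j => // j IH; rewrite !iterS IH ?D ?Z.
Qed.

Lemma level_der z x : level z x -> level (z - 1) (d x).
Proof.
have [_ dZ] := dkl; rewrite /level => zx.
have := dg x; rewrite zx dZ => e.
have c2 : c 2%:R != 0 by rewrite fmorph_eq0.
apply: (mulfI c2); rewrite [in LHS](rmorph_nat c) -e mulrA -rmorphM.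
by rewrite -{2}(expr1z 2%:R) -expfzDr // subrKC.
Qed.

Lemma level_iter z j x : level z x -> level (z - j%:Z) (iter j d x).
Proof.
move=> zx; elim: j => [|j IH]; first by rewrite subr0.
by rewrite iterS intS opprD addrCA addrC; apply: level_der.
Qed.

Lemma level_step z j x : level z x -> iter j.+1 d x = 0 -> j%:Z != z -> iter j d x = 0.
Proof.
move=> zx djx jz; apply/eqP; apply: contraNT jz => x0.
have := level_iter j zx; rewrite /level g_ker // -{1}(mul1r (iter j d x)).
move/(mulIf x0)/eqP; rewrite -(rmorph1 c) (inj_eq (fmorph_inj c)) => /eqP e.
rewrite eq_sym -subr_eq0; apply/eqP; apply: (two_powz k_char0).
by rewrite -e expr0z.
Qed.

Lemma level_kill i x : level i%:Z x -> iter i d x = 0 -> x = 0.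
Proof.
move=> ix; suff h j : (j <= i)%N -> iter i d x = 0 -> iter (i - j) d x = 0.
  by move=> /(h i (leqnn i)); rewrite subnn.
elim: j => [|j IH] ji h; first by rewrite subn0.
apply: (level_step ix); last by apply/eqP => -[]; lia.
by rewrite -subSn // subSS IH // ltnW.
Qed.

(** Each application of [d] lowers the level by one, and the last nonzero iterate lies in the
    kernel, where [g] is the identity and the level is zero. So the level counts the steps. *)
Lemma level_bound z x : level z x -> x != 0 ->
  exists i : nat, [/\ z = i%:Z, iter i d x != 0 & iter i.+1 d x = 0].
Proof.
move=> zx x0; have [_ _ _ /(_ x) h] := dl.
have {}h : exists j, iter j d x == 0 by case: h => j jx; exists j; apply/eqP.
case: (ex_minnP h) => -[/eqP /= xz|j /eqP jx jmin]; first by rewrite xz eqxx in x0.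
have j0 : iter j d x != 0 by apply/eqP => /eqP /jmin; rewrite ltnn.
exists j; split=> //; apply/eqP; apply: contraNT j0 => zj.
by apply/eqP/(level_step zx) => //; rewrite eq_sym.
Qed.

(** If x is killed by d^(j+1), then d^j x is in the kernel and g(x) - 2^j x is killed by d^j. Its
    components are divided by 2^i - 2^j, and what remains of x has level j. *)
Lemma level_decomposition j x : iter j d x = 0 ->
  exists y : nat -> B, (forall i, (i < j)%N -> level i%:Z (y i)) /\ x = \sum_(i < j) y i.
Proof.
elim: j x => [|j IH] x djx; first by exists (fun=> 0); rewrite big_ord0.
have [dD dZ] := iter_klinear j.
have dgj i z : iter i d (g z) = c (2%:R ^+ i) * g (iter i d z).
  elim: i => [|i IHi]; first by rewrite rmorph1 mul1r.
  rewrite iterS IHi; case: dkl => _ ->; rewrite dg -(rmorph_nat c) mulrA -rmorphM.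
  by rewrite -exprSr.
have [|z [zl zE]] := IH (g x - c (2%:R ^+ j) * x).
  rewrite (klinearB _ _ (iter_klinear j)) dZ dgj (g_ker djx).
  by rewrite subrr.
pose y i := if (i < j)%N then c ((2%:R ^+ i - 2%:R ^+ j)^-1) * z i else
  x - \sum_(l < j) c ((2%:R ^+ l - 2%:R ^+ j)^-1) * z l.
exists y; split=> [i|]; last first.
  rewrite big_ord_recr /= {2}/y ltnn.
  rewrite (eq_bigr (fun l : 'I_j => c ((2%:R ^+ l - 2%:R ^+ j)^-1) * z l)) => [|l _].
    by rewrite subrKC.
  by rewrite /y ltn_ord.
have [gD gZ] := gl.
rewrite ltnS leq_eqVlt => /orP[/eqP->|ij]; last first.
  by rewrite /level /y ij gZ zl // mulrCA.
rewrite /level /y ltnn (klinearB _ _ gl) (klinear_sum _ _ _ gl) mulrBr -exprnP.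
rewrite -[g x](subrK (c (2%:R ^+ j) * x)) zE addrAC addrC; congr (_ + _).
apply/eqP; rewrite subr_eq addrC; apply/eqP.
rewrite mulr_sumr -sumrB; apply: eq_bigr => l _.
rewrite gZ zl // -exprnP !mulrA -!rmorphM -mulrBl -rmorphB [_^-1 * _]mulrC -mulrBl.
rewrite mulfV ?rmorph1 ?mul1r // subr_eq0; apply/eqP => e.
have := @two_powz _ k_char0 l%:Z j%:Z; rewrite -!exprnP => /(_ e) [].
by move: (ltn_ord l) => /[swap] ->; rewrite ltnn.
Qed.

End SlicedGrading.

Section FunctionModule.
Variables (k : fieldType) (B : idomainType) (c : {rmorphism k -> B}) (T : Type).

(** Functions into [B] form a k-algebra, so that [weight_component] applies to derivations, seen as
    functions on [B], and to functions on the torus. *)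
Definition cst_rmorph (a : k) : T -> B := fun=> c a.

Fact cst_rmorph_zmod : zmod_morphism cst_rmorph.
Proof. by move=> a b; apply/funext => x; rewrite /cst_rmorph rmorphB. Qed.
Fact cst_rmorph_monoid : monoid_morphism cst_rmorph.
Proof.
by split=> [|a b]; apply/funext => x; rewrite /cst_rmorph ?rmorph1 ?rmorphM.
Qed.
HB.instance Definition _ := GRing.isZmodMorphism.Build k (T -> B) cst_rmorph cst_rmorph_zmod.
HB.instance Definition _ := GRing.isMonoidMorphism.Build k (T -> B) cst_rmorph cst_rmorph_monoid.

End FunctionModule.
Arguments cst_rmorph {k B} c T a.

Lemma tcharMn (k : fieldType) n (t : 'I_n -> k) m i : torus_pt t ->
  tchar t (m *+ i) = tchar t m ^+ i.
Proof.
move=> t0; elim: i => [|i IH]; first by rewrite tchar0.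
by rewrite mulrS tcharD // IH exprS.
Qed.

(** * Weights of the transported torus, for one facet *)

Section FacetImage.
Variables (k : closedFieldType) (R B : idomainType).
Variables (c : {rmorphism k -> R}) (c' : {rmorphism k -> B}).
Hypothesis k_char0 : [pchar k] =i pred0.
Variable n : nat.
Local Notation M := 'rV[int]_n.
Variables (S : set M) (X : M -> R).
Hypothesis SM : lattice_monoid S.
Hypothesis XB : toric_basis c S X.

Variable Phi : (R -> R) -> B -> B.
Hypothesis Phi_aut : forall f, kaut c f -> kaut c' (Phi f).
Hypothesis PhiM : forall f g, kaut c f -> kaut c g -> Phi (f \o g) = Phi f \o Phi g.
Hypothesis Phi_inj : forall f g, kaut c f -> kaut c g -> Phi f = Phi g -> f = g.
Hypothesis Phi_surj : forall g, kaut c' g -> exists2 f, kaut c f & Phi f = g.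

Variable T : ('I_n -> k) -> R -> R.
Hypothesis TP : forall t, torus_pt t ->
  kaut c (T t) /\ forall s, S s -> T t (X s) = c (tchar t s) * X s.

Variable r : M.
Hypothesis Sr : facet S r.
Local Notation root_aut := (root_aut SM XB Sr).

Variables (dd : M -> B -> B) (tt : M -> {rmorphism k -> k}).
Hypothesis ddP : forall e, root S r e -> [/\ lnd c' (dd e), exists x, dd e x != 0
  & forall a, Phi (root_aut e a) = lnd_exp c' (dd e) (c' (tt e a))].

Definition torus := {t : 'I_n -> k | torus_pt t}.
Implicit Type t : torus.
Local Notation ch t := (tchar (sval t)).
Let g t := Phi (T (sval t)).
Let gk t : kaut c' (g t). Proof. by apply: Phi_aut; case: (TP (proj2_sig t)). Qed.
Let gl t : klinear c' (g t). Proof. exact: kend_klinear (proj1 (gk t)). Qed.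

Let Lnd e : root S r e -> lnd c' (dd e). Proof. by case/ddP. Qed.

Definition one_ps_pt (m : M) (s : k) (s0 : s != 0) : torus := exist _ _ (one_ps_torus m s0).

Lemma g_der e t x : root S r e ->
  g t (dd e x) = c' (tt e (ch t e)) * dd e (g t x).
Proof.
move=> er; have [dl _ dE] := ddP er; have [[_ _ dc _] t0] := (dl, proj2_sig t).
apply: (@lnd_exp_intertwine _ _ c' k_char0 (g t) (dd e)
  (fun y => c' (tt e (ch t e)) * dd e y)) => //.
- by case: (gk t).
- by apply: lnd_scale.
move=> {}x; rewrite lnd_exp_scale // mul1r -dE.
have -> : lnd_exp c' (dd e) 1 = Phi (root_aut e 1) by rewrite dE !rmorph1.
have [Tk TX] := TP t0.
have ka a : kaut c (root_aut e a) by apply: root_aut_kaut.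
rewrite -[LHS]/((Phi (T (sval t)) \o Phi _) x) -[RHS]/((Phi _ \o Phi (T (sval t))) x) -!PhiM //.
congr (Phi _ x); apply/funext => z /=.
by rewrite (root_aut_torus SM XB Sr 1 z er t0 (proj1 Tk) TX) mulr1.
Qed.

Variable e0 : M.
Hypothesis er0 : root S r e0.
Let d := dd e0.
Let dl : lnd c' d. Proof. exact: Lnd. Qed.

Lemma root_prod_comm e a (L : seq (M * k)) : root S r e ->
  (forall p, p \in L -> root S r p.1) ->
  forall x, root_aut e a (root_prod SM XB Sr L x) = root_prod SM XB Sr L (root_aut e a x).
Proof.
move=> er; elim: L => [//|p L IH] Lr x /=.
rewrite (root_aut_comm k_char0 SM XB Sr _ _ _ er (Lr p (mem_head _ _))) IH // => q qL.
by apply: Lr; rewrite inE qL orbT.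
Qed.

Lemma root_prod_kaut (L : seq (M * k)) : (forall p, p \in L -> root S r p.1) ->
  kaut c (root_prod SM XB Sr L).
Proof.
elim: L => [|p L IH] Lr; first exact: kaut_id.
have pr : root S r p.1 by apply: Lr; apply: mem_head.
apply: kaut_comp; first exact: root_aut_kaut.
by apply: IH => q qL; apply: Lr; rewrite inE qL orbT.
Qed.

Lemma Phi_root_prod (L : seq (M * k)) : (forall p, p \in L -> root S r p.1) ->
  exists D, [/\ lnd c' D, forall x, D x = \sum_(p <- L) c' (tt p.1 p.2) * dd p.1 x
    & Phi (root_prod SM XB Sr L) = lnd_exp c' D 1].
Proof.
elim: L => [|p L IH] Lr.
  exists (fun=> 0); have l0 : lnd c' (fun=> 0).
    by split=> *; rewrite ?addr0 ?mul0r ?mulr0 ?addr0 //; exists 1%N.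
  split=> [//|x|]; first by rewrite big_nil.
  apply/funext => x; rewrite lnd_exp_ker //.
  by rewrite (Phi_id Phi_aut PhiM).
have pr : root S r p.1 by apply: Lr; apply: mem_head.
have Lr' q : q \in L -> root S r q.1 by move=> qL; apply: Lr; rewrite inE qL orbT.
have [D [Dl DE DP]] := IH Lr'.
have [pl _ pE] := ddP pr; have [_ _ pc _] := pl.
have pl' : lnd c' (fun x => c' (tt p.1 p.2) * dd p.1 x) by apply: lnd_scale.
have pE' : Phi (root_aut p.1 p.2) = lnd_exp c' (fun x => c' (tt p.1 p.2) * dd p.1 x) 1.
  by apply/funext => x; rewrite lnd_exp_scale // mul1r pE.
have [|l lE] := lnd_add k_char0 pl' Dl.
  move=> x; rewrite -pE' -DP; apply: (Phi_comm PhiM).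
  - exact: root_aut_kaut.
  - exact: root_prod_kaut.
  - exact: root_prod_comm.
exists (fun x => c' (tt p.1 p.2) * dd p.1 x + D x); split=> // [x|].
  by rewrite big_cons DE.
apply/funext => x; rewrite lE -pE' -DP.
by rewrite -[RHS]/((Phi _ \o Phi _) x) -PhiM //; [apply: root_aut_kaut | apply: root_prod_kaut].
Qed.

Let d_nz : exists x, d x != 0. Proof. by case: (ddP er0). Qed.

(** If W comes from a root automorphism of the facet, W exp(f d) W^-1 = exp(W(f) d), which commutes
    with exp(f d). So the preimage of exp(f d) satisfies the hypotheses of
    [centralizer_root_prod]. *)
Lemma kernel_combination f : d f = 0 -> exists L : seq (M * k),
  [/\ uniq [seq p.1 | p <- L], forall p, p \in L -> root S r p.1 /\ p.2 != 0 &
      forall x, f * d x = \sum_(p <- L) c' (tt p.1 p.2) * dd p.1 x].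
Proof.
move=> df; have [u uk uE] := Phi_surj (lnd_exp_kaut k_char0 dl df).
have [s1 [Ss1 rs1]] := height_one SM Sr.
have ka e a : root S r e -> kaut c (root_aut e a) by apply: root_aut_kaut.
have e01 : Phi (root_aut e0 1) = lnd_exp c' d 1.
  by have [_ _ ->] := ddP er0; rewrite !rmorph1.
have d1 : d 1 = 0 by rewrite -(rmorph1 c'); case: dl.
have u_comm x : u (root_aut e0 1 x) = root_aut e0 1 (u x).
  apply: (Phi_comm_inv PhiM Phi_inj uk (ka _ _ er0)) => {}x.
  by rewrite uE e01 -!lnd_expD // addrC.
have u_conj m : S m -> dot r m = 0 -> forall x,
    u (root_aut (e0 + m) 1 (u (root_aut (e0 + m) (-1) x))) =
    root_aut (e0 + m) 1 (u (root_aut (e0 + m) (-1) (u x))).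
  move=> Sm rm; have er := root_add SM er0 Sm rm.
  pose W := root_aut (e0 + m) 1; pose W' := root_aut (e0 + m) (-1).
  have [Wk W'k] : kaut c W /\ kaut c W' by split; apply: ka.
  have PW : kaut c' (Phi W) by apply: Phi_aut.
  apply: (Phi_comm_inv PhiM Phi_inj uk (g := W \o u \o W')).
    by apply: kaut_comp => //; apply: kaut_comp.
  have Wd z : Phi W (d z) = d (Phi W z).
    apply: (lnd_exp_comm k_char0 (proj1 PW) dl) => w; rewrite -e01.
    apply: (Phi_comm PhiM) => //; first exact: ka.
    by move=> y; apply: root_aut_comm.
  have WW' z : Phi W (Phi W' z) = z.
    rewrite -[LHS]/((Phi W \o Phi W') z) -PhiM //.
    have -> : W \o W' = id.
      by apply/funext => y; rewrite /= /W /W' -root_autD // subrr root_aut0.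
    by rewrite (Phi_id Phi_aut PhiM).
  have WuW x : Phi (W \o u \o W') x = lnd_exp c' d (Phi W f) x.
    rewrite (PhiM (kaut_comp Wk uk) W'k) (PhiM Wk uk).
    by rewrite /= uE (lnd_exp_conj _ _ (proj1 PW) dl dl Wd) WW'.
  move=> x; rewrite !WuW uE -!lnd_expD //; first by rewrite addrC.
  by rewrite -Wd df; apply: klinear0 (kend_klinear (proj1 PW)).
have [L [uL LP uL']] :=
  @centralizer_root_prod k R c k_char0 n S X SM XB r Sr e0 er0 s1 Ss1 rs1 u uk u_comm u_conj.
exists L; split=> //.
have [D [Dl DE DP]] := Phi_root_prod (fun p pL => proj1 (LP p pL)).
move=> x; rewrite -DE; apply: (lnd_exp_inj k_char0 (lnd_scale dl df) Dl) => z.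
rewrite lnd_exp_scale // mul1r -DP -uE.
by congr (Phi _ z); apply/funext.
Qed.

(** All roots have height -1, so the one-parameter subgroup of [r] first identifies the field
    automorphisms; then the characters are compared. *)
Lemma root_weight_inj e e' : root S r e -> root S r e' ->
  (forall t, tt e (ch t e) = tt e' (ch t e')) -> e = e'.
Proof.
move=> er er' ee.
have tee s : s != 0 -> tt e s = tt e' s.
  move=> s0; have s'0 : s^-1 != 0 by rewrite invr_neq0.
  have := ee (one_ps_pt r s'0); rewrite !tchar_one_ps // (proj1 er) (proj1 er').
  by rewrite -exprnN expr1 invrK.
apply: (tchar_separates k_char0) => t t0; apply: (fmorph_inj (tt e)).
by rewrite (ee (exist _ t t0)) -tee //; apply: tchar_neq0.
Qed.

(** The products h d with h in the kernel form a subspace stable under conjugation by the torus. It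
    contains f d, hence every weight component of it, so each occurring [dd e] is itself such a
    product. *)
Lemma root_multiplier f : d f = 0 -> exists (L : seq (M * k)) (h : M -> B),
  [/\ uniq [seq p.1 | p <- L], forall p, p \in L ->
       [/\ root S r p.1, d (h p.1) = 0 & forall x, dd p.1 x = h p.1 * d x]
    & f = \sum_(p <- L) c' (tt p.1 p.2) * h p.1].
Proof.
move=> df; have [L [uL LP fE]] := kernel_combination df.
have /choice[g' g'P] t := kaut_inv (gk t).
pose G t (D : B -> B) := g t \o D \o g' t.
pose N : set (B -> B) := [set D | exists2 h, d h = 0 & D = (fun x => h * d x)].
have Gl t : klinear (cst_rmorph c' B) (G t).
  have [gD gZ] := gl t.
  by split=> [D E|a D]; apply/funext => x; [apply: gD | apply: gZ].
have [dD dZ] := lnd_klinear dl; have d0 := lnd0 dl.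
have Nsub : subspace (cst_rmorph c' B) N.
  split=> [|_ _ [h dh ->] [h' dh' ->]|a _ [h dh ->]].
  - by exists 0 => //; apply/funext => x; rewrite mul0r.
  - by exists (h + h'); [rewrite dD dh dh' addr0|apply/funext => x; rewrite mulrDl].
  - by exists (c' a * h); [rewrite dZ dh mulr0|apply/funext => x; rewrite -mulrA].
have Gdd e t : root S r e -> G t (dd e) = cst_rmorph c' B (tt e (ch t e)) * dd e.
  move=> er; apply/funext => x; rewrite /G /= g_der //.
  by have [_ _ ->] := g'P t.
have wn0 e t : c' (tt e (ch t e)) != 0.
  rewrite (fmorph_eq0 c') (fmorph_eq0 (tt e)); apply: tchar_neq0; exact: (proj2_sig t).
have NG t D : N D -> N (G t D).
  move=> [h dh ->]; exists (c' (tt e0 (ch t e0)) * g t h).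
    by rewrite dZ -[d _]/(dd e0 _) -g_der // -/d dh (klinear0 (gl t)).
  apply/funext => x; have [[_ gM _] _] := gk t; rewrite /G /= gM.
  have := congr1 (@^~ x) (Gdd _ t er0); rewrite /G /= => ->.
  by rewrite /cst_rmorph mulrCA mulrA.
have neqw : {in L &, forall p q, p != q -> exists t,
    tt p.1 (ch t p.1) != tt q.1 (ch t q.1)}.
  move=> p q pL qL; apply: contraNP => /forallNP h; apply/eqP.
  apply: (uniq_map_inj uL) => //; apply: root_weight_inj.
  - by case: (LP p).
  - by case: (LP q).
  - by move=> t; apply/eqP; apply: contrapT => /negP /h.
pose x p := cst_rmorph c' B (tt p.1 p.2) * dd p.1.
have xw : {in L, forall p t, G t (x p) =
    cst_rmorph c' B (tt p.1 (ch t p.1)) * x p}.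
  move=> p pL t; have [pr _] := LP p pL; have [_ GZ] := Gl t.
  by rewrite /x GZ Gdd // mulrCA.
have /(weight_component Gl Nsub NG (map_uniq uL) neqw xw) xN : N (\sum_(p <- L) x p).
  by exists f => //; apply/funext => z; rewrite fE fct_sumE.
have /choice[h hP] e : exists h, e \in [seq p.1 | p <- L] ->
    d h = 0 /\ forall x, dd e x = h * d x.
  case: (pselect (e \in [seq p.1 | p <- L])) => [/mapP[p pL ->]|]; last by exists 0.
  have [h dh hE] := xN p pL; have [_ p0] := LP p pL.
  have q0 : tt p.1 p.2 != 0 by rewrite fmorph_eq0.
  exists (c' ((tt p.1 p.2)^-1) * h) => _; split; first by rewrite dZ dh mulr0.
  move=> z; have E : c' (tt p.1 p.2) * dd p.1 z = h * d z := congr1 (@^~ z) hE.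
  by rewrite -mulrA -E mulrA -rmorphM mulVf // rmorph1 mul1r.
exists L, h; split=> // [p pL|].
  have [dh hE] := hP p.1 (map_f _ pL); split=> //; exact: (LP p pL).1.
have [z dz] := d_nz; apply: (mulIf dz); rewrite fE mulr_suml.
apply: eq_big_seq => p pL; have [_ ->] := hP p.1 (map_f _ pL).
by rewrite mulrA.
Qed.

Local Notation tau := (tt e0).

Lemma multiplier_weight e h : root S r e -> (forall x, dd e x = h * d x) ->
  forall t, g t h = c' (tt e (ch t e) / tau (ch t e0)) * h.
Proof.
move=> er hE t; have [z dz] := d_nz; have [[_ gM _] _] := gk t.
have [g' [_ _ g'K]] := kaut_inv (gk t).
have w0 : tau (ch t e0) != 0 by rewrite fmorph_eq0; apply: tchar_neq0; exact: (proj2_sig t).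
have cw0 : c' (tau (ch t e0)) != 0 by rewrite fmorph_eq0.
have := g_der t (g' z) er; rewrite hE gM (g_der _ _ er0) -/d !g'K hE.
rewrite !mulrA => /(mulIf dz) e1; apply: (mulIf cw0); rewrite e1.
by rewrite mulrAC -rmorphM mulfVK.
Qed.

Lemma multiplier_neq0 e h : root S r e -> (forall x, dd e x = h * d x) -> h != 0.
Proof.
move=> er hE; have [_ [x /negP h0] _] := ddP er; apply/eqP => h00.
by apply: h0; rewrite hE h00 mul0r.
Qed.

Lemma weight_ratio_inj e e' : root S r e -> root S r e' ->
  (forall t, tt e (ch t e) / tau (ch t e0) = tt e' (ch t e') / tau (ch t e0)) -> e = e'.
Proof.
move=> er er' h; apply: root_weight_inj => // t; apply: (mulIf _ (h t)).
by rewrite invr_eq0 fmorph_eq0; apply: tchar_neq0; exact: (proj2_sig t).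
Qed.

Lemma kernel_weight f (wf : torus -> k) : d f = 0 -> f != 0 ->
  (forall t, g t f = c' (wf t) * f) ->
  exists e h a, [/\ root S r e, d h = 0, forall x, dd e x = h * d x,
    forall t, wf t = tt e (ch t e) / tau (ch t e0) & f = c' a * h].
Proof.
move=> df f0 fw; have [L [h [uL LP fE]]] := root_multiplier df.
pose w (p : M * k) t := tt p.1 (ch t p.1) / tau (ch t e0).
have [||p [pL pw pE]] := weight_single (w := w) gl (map_uniq uL) _ _ fw fE f0.
- move=> p q pL qL; apply: contraNP => /forallNP H; apply/eqP.
  apply: (uniq_map_inj uL) => //; apply: weight_ratio_inj.
  + by case: (LP p).
  + by case: (LP q).
  + by move=> t; apply/eqP; apply: contrapT => /negP /H.
- move=> p pL t; have [pr _ hE] := LP p pL; have [_ gZ] := gl t.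
  by rewrite gZ (multiplier_weight pr hE) mulrCA.
by have [pr dh hE] := LP p pL; exists p.1, (h p.1), (tt p.1 p.2).
Qed.

(** The square of [h] is again a weight vector of the kernel, so its weight comes from some root e'.
    On the one-parameter subgroup of [r] this says tt_e(s)^2 = tau(s) tt_e'(s). *)
Lemma multiplier_tau e h : root S r e -> d h = 0 -> (forall x, dd e x = h * d x) ->
  tt e =1 tau.
Proof.
move=> er dh hE; have h0 := multiplier_neq0 er hE.
have [_ dM _ _] := dl; have dhh : d (h * h) = 0 by rewrite dM dh mulr0 mul0r addr0.
have [||e' [h' [a [er' _ _ e'w _]]]] :=
    @kernel_weight (h * h) (fun t => (tt e (ch t e) / tau (ch t e0)) ^+ 2) dhh.
- by rewrite mulf_neq0.
- move=> t; have [[_ gM _] _] := gk t.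
  by rewrite gM (multiplier_weight er hE) rmorphXn expr2 mulrACA.
apply: (field_endo_square (h := tt e')) => s s0.
have s'0 : s^-1 != 0 by rewrite invr_neq0.
have := e'w (one_ps_pt r s'0); rewrite !tchar_one_ps //.
rewrite (proj1 er) (proj1 er') (proj1 er0) -exprnN expr1 invrK.
have t0 : tau s != 0 by rewrite fmorph_eq0.
move=> E; rewrite -[tt e s](divfK t0) exprMn E; field; exact: t0.
Qed.

Definition wtv (q : M) (b : B) : Prop := forall t, g t b = c' (tau (ch t q)) * b.

Lemma wtvD q b b' : wtv q b -> wtv q b' -> wtv q (b + b').
Proof. by move=> h h' t; have [gD _] := gl t; rewrite gD h h' mulrDr. Qed.

Lemma wtvZ q a b : wtv q b -> wtv q (c' a * b).
Proof. by move=> h t; have [_ gZ] := gl t; rewrite gZ h mulrCA. Qed.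

Lemma wtv0 q : wtv q 0.
Proof. by move=> t; rewrite mulr0 (klinear0 (gl t)). Qed.

Lemma kernel_weight_flat q f : d f = 0 -> f != 0 -> wtv q f ->
  exists h a, [/\ dot r q = 0, forall x, dd (q + e0) x = h * d x & f = c' a * h].
Proof.
move=> df f0 fq; have [e [h [a [er dh hE fw fE]]]] := kernel_weight df f0 fq.
have qE : q = e - e0.
  apply: (tchar_separates k_char0) => t t0; apply: (fmorph_inj tau).
  rewrite (fw (exist _ t t0)) (multiplier_tau er dh hE) /=.
  by rewrite tcharD // tcharN // rmorphM fmorphV.
exists h, a; split=> // [|x]; last by rewrite qE subrK.
by rewrite qE linearB /= (proj1 er) (proj1 er0) subrr.
Qed.

Lemma kernel_weight_line q f f' : d f = 0 -> d f' = 0 -> f != 0 ->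
  wtv q f -> wtv q f' -> exists a, f' = c' a * f.
Proof.
move=> df df' f0 fq fq'; have [->|f'0] := eqVneq f' 0; first by exists 0; rewrite rmorph0 mul0r.
have [h [a [_ hE fE]]] := kernel_weight_flat df f0 fq.
have [h' [a' [_ hE' fE']]] := kernel_weight_flat df' f'0 fq'.
have [z dz] := d_nz; have hh : h = h' by apply: (mulIf dz); rewrite -hE -hE'.
have a0 : a != 0 by apply: contraNneq f0 => a0; rewrite fE a0 rmorph0 mul0r.
by exists (a' / a); rewrite fE fE' hh mulrA -rmorphM mulfVK.
Qed.

Definition wsum (P : B -> Prop) (x : B) : Prop := exists (l : seq M) (v : M -> B),
  [/\ uniq l, {in l, forall q, wtv q (v q) /\ P (v q)} & x = \sum_(q <- l) v q].

Lemma wsum_regroup (P : B -> Prop) (L : seq (M * B)) : P 0 ->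
  (forall x y, P x -> P y -> P (x + y)) ->
  (forall p, p \in L -> wtv p.1 p.2 /\ P p.2) -> wsum P (\sum_(p <- L) p.2).
Proof.
move=> P0 PD LP; exists (undup [seq p.1 | p <- L]), (fun q => \sum_(p <- L | p.1 == q) p.2).
rewrite undup_uniq -sum_regroup; split=> // q _; split.
  rewrite big_seq_cond; elim/big_ind: _ => [|x y|p /andP[pL /eqP <-]]; [exact: wtv0|exact: wtvD|].
  by case: (LP p pL).
rewrite big_seq_cond; elim/big_ind: _ => // p /andP[pL _]; by case: (LP p pL).
Qed.

Lemma wsum_sum (P : B -> Prop) (I : eqType) (s : seq I) (x : I -> B) : P 0 ->
  (forall x y, P x -> P y -> P (x + y)) ->
  {in s, forall i, wsum P (x i)} -> wsum P (\sum_(i <- s) x i).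
Proof.
move=> P0 PD xs.
suff [L LP ->] : exists2 L : seq (M * B), (forall p, p \in L -> wtv p.1 p.2 /\ P p.2)
    & \sum_(i <- s) x i = \sum_(p <- L) p.2 by apply: wsum_regroup.
elim: s xs => [|i s IH] xs; first by exists [::]; rewrite ?big_nil.
have [|L LP LE] := IH; first by move=> j js; apply: xs; rewrite inE js orbT.
have [l [v [ul lP xE]]] := xs i (mem_head _ _).
rewrite big_cons xE LE.
exists ([seq (q, v q) | q <- l] ++ L); last by rewrite big_cat big_map.
by move=> p; rewrite mem_cat => /orP[/mapP[q ql ->]|/LP//]; apply: lP.
Qed.

Lemma kernel_wsum f : d f = 0 -> wsum (fun v => d v = 0) f.
Proof.
move=> df; have [L [h [uL LP ->]]] := root_multiplier df; have [dD dZ] := lnd_klinear dl.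
rewrite -(big_map (fun p => (p.1 - e0, c' (tt p.1 p.2) * h p.1)) xpredT snd).
apply: wsum_regroup => [|x y dx dy|_ /mapP[p pL ->] /=]; first exact: lnd0 dl.
  by rewrite dD dx dy addr0.
have [pr dh hE] := LP p pL; split; last by rewrite dZ dh mulr0.
apply: wtvZ => t; rewrite (multiplier_weight pr hE) (multiplier_tau pr dh hE).
by rewrite tcharD ?tcharN ?rmorphM ?fmorphV //; exact: (proj2_sig t).
Qed.

Let two0 : 2%:R != 0 :> k. Proof. by rewrite natr_char0. Qed.
(** The value at 2 of the one-parameter subgroup [r] acts on weight q by 2^(dot r q), so it reads
    heights as powers of 2. *)
Let t2 := one_ps_pt r two0.
Local Notation g0 := (g t2).

Lemma wtv_level q b : wtv q b -> level c' g0 (dot r q) b.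
Proof.
by move=> h; rewrite /level h tchar_one_ps // fmorphXz rmorph_nat.
Qed.

Let g0_ker f : d f = 0 -> g0 f = f.
Proof.
move=> df; have [l [v [ul lP ->]]] := kernel_wsum df.
rewrite (klinear_sum _ _ _ (gl t2)); apply: eq_big_seq => q ql.
have [qw dq] := lP q ql; have [->|v0] := eqVneq (v q) 0; first exact: klinear0 (gl t2).
have [h [a [rq _ _]]] := kernel_weight_flat dq v0 qw.
by rewrite (wtv_level qw) rq expr0z rmorph1 mul1r.
Qed.

Let d_g0 x : d (g0 x) = 2%:R * g0 (d x).
Proof.
rewrite (g_der _ _ er0) -/d tchar_one_ps // (proj1 er0) fmorphXz rmorph_nat.
by rewrite mulrA -(rmorph_nat c') -rmorphM mulfV // rmorph1 mul1r.
Qed.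

Let g0_level z x t : level c' g0 z x -> level c' g0 z (g t x).
Proof.
have [_ gZ] := gl t; rewrite /level -gZ => <-.
have [[T2k T2X] [Tk TX]] := (TP (proj2_sig t2), TP (proj2_sig t)).
apply: (Phi_comm PhiM) => // {}x; move: x.
apply: (tb_ext SM XB (D := T (sval t2) \o T (sval t)) (D' := T (sval t) \o T (sval t2))).
- exact: kend_klinear (kend_comp (proj1 T2k) (proj1 Tk)).
- exact: kend_klinear (kend_comp (proj1 Tk) (proj1 T2k)).
move=> s Ss /=; have [_ TZ] := kend_klinear (proj1 Tk).
have [_ T2Z] := kend_klinear (proj1 T2k).
by rewrite TX // T2X // TZ T2Z TX // T2X // mulrCA.
Qed.

Lemma iter_der_weight t j x :
  g t (iter j d x) = c' (tau (ch t e0) ^+ j) * iter j d (g t x).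
Proof.
elim: j x => [|j IH] x; first by rewrite rmorph1 mul1r.
have [_ dZ] := lnd_klinear dl.
by rewrite !iterS (g_der _ _ er0) -/d IH dZ mulrA -rmorphM -exprS.
Qed.

(** The weight components of d^j x lift along d^j to level j because the image of that level is
    torus stable. On level j the map d^j is injective, so the lifts of weight q have weight q - j e0
    and add up to [x]. *)
Lemma level_wsum j x : level c' g0 j%:Z x -> iter j.+1 d x = 0 -> wsum (fun=> True) x.
Proof.
move=> jx djx; have [_ gZ0] := gl t2.
have jl := iter_klinear dl j; have [jD jZ] := jl.
have [l [v [ul lP fE]]] := kernel_wsum (f := iter j d x) djx.
pose N : set B := [set f | exists y, [/\ level c' g0 j%:Z y, iter j.+1 d y = 0 & f = iter j d y]].
have [dD dZ] := lnd_klinear dl; have [g0D g0Z] := gl t2.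
have Nsub : subspace c' N.
  split=> [|_ _ [y [jy dy ->]] [z [jz dz ->]]|a _ [y [jy dy ->]]].
  - exists 0; rewrite (klinear0 (iter_klinear dl _)) (klinear0 jl); split=> //.
    by rewrite /level mulr0; exact: klinear0 (gl t2).
  - exists (y + z); split=> //; last by rewrite iterS jD dD -!iterS dy dz addr0.
    by rewrite /level g0D jy jz mulrDr.
  - exists (c' a * y); split=> //; last by rewrite iterS jZ dZ -iterS dy mulr0.
    by rewrite /level g0Z jy mulrCA.
have tE t : tau (ch t e0) != 0.
  by rewrite fmorph_eq0; apply: tchar_neq0; exact: (proj2_sig t).
have NG t f : N f -> N (g t f).
  move=> [y [jy dy ->]]; exists (c' (tau (ch t e0) ^+ j) * g t y); split.
  - by have [_ _] := Nsub; rewrite /level g0Z (g0_level t jy) mulrCA.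
  - rewrite (iter_klinear dl j.+1).2.
    have : c' (tau (ch t e0) ^+ j.+1) * iter j.+1 d (g t y) = 0.
      by rewrite -iter_der_weight dy (klinear0 (gl t)).
    move=> /eqP; rewrite mulf_eq0 fmorph_eq0 expf_eq0 (negbTE (tE t)) andbF orFb.
    by move=> /eqP ->; rewrite mulr0.
  - by rewrite iter_der_weight jZ.
have vN : {in l, forall q, N (v q)}.
  apply: (weight_component gl Nsub NG ul (w := fun q t => tau (ch t q))).
  - move=> q q' _ _; apply: contraNP => /forallNP H; apply/eqP.
    apply: (tchar_separates k_char0) => t t0; apply: (fmorph_inj tau).
    by apply/eqP; apply: contrapT => /negP; apply: (H (exist _ t t0)).
  - by move=> q ql t; have [h _] := lP q ql; apply: h.
  - by rewrite -fE; exists x.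
have /choice[y yP] q : exists y, q \in l ->
    [/\ level c' g0 j%:Z y, iter j.+1 d y = 0 & v q = iter j d y].
  by have [/vN[y yP]|] := pselect (q \in l); [exists y | exists 0].
have -> : x = \sum_(q <- l) y q.
  apply/eqP; rewrite -subr_eq0; apply/eqP; apply: (level_kill k_char0 dl g0_ker d_g0 (i := j)).
    rewrite /level (klinearB _ _ (gl t2)) (klinear_sum _ _ _ (gl t2)) mulrBr jx.
    by rewrite mulr_sumr; congr (_ - _); apply: eq_big_seq => q /yP[].
  rewrite (klinearB _ _ jl) (klinear_sum _ _ _ jl) fE; apply/eqP; rewrite subr_eq0.
  by apply/eqP; apply: eq_big_seq => q /yP[].
rewrite -(big_map (fun q => (q - e0 *+ j, y q)) xpredT snd).
apply: wsum_regroup => // _ /mapP[q ql ->] /=; split=> // t.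
have [jy dy yE] := yP q ql; have [qw _] := lP q ql.
apply/eqP; rewrite -subr_eq0; apply/eqP; apply: (level_kill k_char0 dl g0_ker d_g0 (i := j)).
  rewrite /level (klinearB _ _ (gl t2)) mulrBr (g0_level t jy) gZ0 jy.
  by rewrite mulrCA.
rewrite (klinearB _ _ jl) jZ -yE; apply/eqP; rewrite subr_eq0; apply/eqP.
have tj : c' (tau (ch t e0) ^+ j) != 0 by rewrite fmorph_eq0 expf_neq0.
apply: (mulfI tj); rewrite -iter_der_weight -yE qw mulrA -rmorphM -rmorphXn -rmorphM.
congr (c' (tau _) * _); have t0 := proj2_sig t.
by rewrite tcharD // tcharN // tcharMn // mulrCA mulfV ?mulr1 // expf_neq0 // tchar_neq0.
Qed.

Lemma all_wsum x : wsum (fun=> True) x.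
Proof.
have [_ _ _ /(_ x)[j jx]] := dl.
have [y [yP ->]] := level_decomposition k_char0 dl (gl t2) g0_ker d_g0 jx.
apply: wsum_sum => // i _; have [y0|y0] := eqVneq (y i) 0.
  exists [::], (fun=> 0); rewrite big_nil; split=> //.
have iy := yP i (ltn_ord i).
have [i' [[ii'] _ dy]] := level_bound k_char0 dl g0_ker d_g0 iy y0.
by move: dy; rewrite -ii'; apply: level_wsum.
Qed.

Lemma weight_ge0 q b : b != 0 -> wtv q b -> 0 <= dot r q.
Proof.
move=> b0 /wtv_level h.
by have [i [-> _ _]] := level_bound k_char0 dl g0_ker d_g0 h b0.
Qed.

(** Vectors of equal weight have equal level i; d^i sends them injectively into the kernel, where
    weight spaces are lines. *)
Lemma weight_line q b b' : b != 0 -> wtv q b -> wtv q b' -> exists a, b' = c' a * b.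
Proof.
move=> b0 bq b'q; have [->|b'0] := eqVneq b' 0; first by exists 0; rewrite rmorph0 mul0r.
have [i [ri ib db]] := level_bound k_char0 dl g0_ker d_g0 (wtv_level bq) b0.
have [i' [ri' ib' db']] := level_bound k_char0 dl g0_ker d_g0 (wtv_level b'q) b'0.
move: ri'; rewrite ri => -[ii']; rewrite -{}ii' in ib' db'.
have wi x : wtv q x -> wtv (q + e0 *+ i) (iter i d x).
  move=> xq t; have t0 := proj2_sig t; have [_ jZ] := iter_klinear dl i.
  rewrite iter_der_weight xq jZ mulrA -rmorphM -rmorphXn -rmorphM.
  by rewrite tcharD // tcharMn // [X in tau X]mulrC.
have [a aE] := kernel_weight_line (f := iter i d b) (f' := iter i d b') db db' ib (wi _ bq) (wi _ b'q).
have [_ jZ] := iter_klinear dl i; have [_ gZ] := gl t2.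
exists a; apply/eqP; rewrite -subr_eq0; apply/eqP; apply: (level_kill k_char0 dl g0_ker d_g0 (i := i)).
  rewrite /level (klinearB _ _ (gl t2)) mulrBr -ri (wtv_level b'q) gZ.
  by rewrite (wtv_level bq) mulrCA.
by rewrite (klinearB _ _ (iter_klinear dl i)) jZ aE subrr.
Qed.

(** [dd e] moves some weight vector of weight q to a nonzero vector of weight tt_e(e) tau(q), which
    must be tau(q') for some q'. Along [r] this forces tt_e = tau, although [dd e] is not assumed to
    be a kernel multiple of [d]. *)
Lemma root_difference e : root S r e -> exists q q' b b',
  [/\ b != 0 /\ wtv q b, b' != 0 /\ wtv q' b' & e = q' - q].
Proof.
move=> er; have [el [x ex] _] := ddP er.
have [l [v [ul lP xE]]] := all_wsum x.
have [q [ql vq]] : exists q, q \in l /\ dd e (v q) != 0.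
  apply: contrapT => /forallNP h; case/negP: ex; apply/eqP.
  rewrite xE (klinear_sum _ _ _ (lnd_klinear el)) big_seq big1 // => q ql.
  by apply/eqP; apply: contrapT => /negP qn; apply: (h q).
have [qw _] := lP q ql.
have q0 : v q != 0 by apply: contraNneq vq => ->; rewrite (lnd0 el).
have [l' [v' [ul' lP' yE]]] := all_wsum (dd e (v q)).
have yw t : g t (dd e (v q)) = c' (tt e (ch t e) * tau (ch t q)) * dd e (v q).
  have [_ eZ] := lnd_klinear el.
  by rewrite g_der // qw eZ mulrA -rmorphM.
have [||q' [q'l ww yE']] := weight_single (w := fun q t => tau (ch t q)) gl ul' _ _ yw yE vq.
- move=> p p' _ _; apply: contraNP => /forallNP H; apply/eqP.
  apply: (tchar_separates k_char0) => t t0; apply: (fmorph_inj tau).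
  by apply/eqP; apply: contrapT => /negP; apply: (H (exist _ t t0)).
- by move=> p pl t; have [h _] := lP' p pl; apply: h.
have [q'w _] := lP' q' q'l.
exists q, q', (v q), (dd e (v q)); split=> //; first by split=> //; rewrite yE'.
have E t : tt e (ch t e) = tau (ch t (q' - q)).
  have t0 := proj2_sig t; have tq : tau (ch t q) != 0 by rewrite fmorph_eq0 tchar_neq0.
  by apply: (mulIf tq); rewrite ww -rmorphM -tcharD // subrK.
have [//||tte _] := @field_endo_power _ k_char0 (tt e) tau (-1) (dot r (q' - q)).
  move=> s s0; have := E (one_ps_pt r s0).
  by rewrite !tchar_one_ps // (proj1 er) !fmorphXz.
apply: (tchar_separates k_char0) => t t0; apply: (fmorph_inj tau).
by rewrite -(E (exist _ t t0)) tte.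
Qed.

End FacetImage.

Section FacetImageSummary.
Variables (k : closedFieldType) (R B : idomainType).
Variables (c : {rmorphism k -> R}) (c' : {rmorphism k -> B}).
Hypothesis k_char0 : [pchar k] =i pred0.
Hypothesis k_unc : ~ countable [set: k].
Variable n : nat.
Local Notation M := 'rV[int]_n.
Variables (S : set M) (X : M -> R).
Hypothesis SM : lattice_monoid S.
Hypothesis XB : toric_basis c S X.
Variables (N : nat) (y : 'I_N -> B).
Hypothesis y_gen : generates c' y.

Variable Phi : (R -> R) -> B -> B.
Hypothesis Phi_aut : forall f, kaut c f -> kaut c' (Phi f).
Hypothesis PhiM : forall f g, kaut c f -> kaut c g -> Phi (f \o g) = Phi f \o Phi g.
Hypothesis Phi_inj : forall f g, kaut c f -> kaut c g -> Phi f = Phi g -> f = g.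
Hypothesis Phi_surj : forall g, kaut c' g -> exists2 f, kaut c f & Phi f = g.

Variable T : ('I_n -> k) -> R -> R.
Hypothesis TP : forall t, torus_pt t ->
  kaut c (T t) /\ forall s, S s -> T t (X s) = c (tchar t s) * X s.

Definition weight_vec (tau : k -> k) (q : M) (b : B) : Prop :=
  forall t, torus_pt t -> Phi (T t) b = c' (tau (tchar t q)) * b.

Lemma facet_image r : facet S r -> exists tau : {rmorphism k -> k},
  [/\ bijective tau,
      forall x, exists (l : seq M) (v : M -> B),
        [/\ uniq l, {in l, forall q, weight_vec tau q (v q)} & x = \sum_(q <- l) v q],
      forall q b, b != 0 -> weight_vec tau q b -> 0 <= dot r q,
      forall q b b', b != 0 -> weight_vec tau q b -> weight_vec tau q b' ->
        exists a, b' = c' a * b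
    & forall e, root S r e -> exists q q' b b',
        [/\ b != 0 /\ weight_vec tau q b, b' != 0 /\ weight_vec tau q' b' & e = q' - q]].
Proof.
move=> Sr.
have /choice[F FP] e : exists F : (B -> B) * {rmorphism k -> k}, root S r e ->
    [/\ lnd c' F.1, exists x, F.1 x != 0, bijective F.2
      & forall a, Phi (root_aut SM XB Sr e a) = lnd_exp c' F.1 (c' (F.2 a))].
  have [er|] := pselect (root S r e); last by exists (id, (idfun : {rmorphism k -> k})).
  have [D [tau H]] :=
    root_image k_char0 k_unc SM XB y_gen Phi_aut PhiM Phi_inj Phi_surj Sr er.
  by exists (D, tau).
have ddP e : root S r e -> [/\ lnd c' (F e).1, exists x, (F e).1 x != 0
    & forall a, Phi (root_aut SM XB Sr e a) = lnd_exp c' (F e).1 (c' ((F e).2 a))].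
  by case/FP.
have [e0 er0] := root_ex SM Sr.
have wE q b : weight_vec (F e0).2 q b <->
    wtv c' Phi T (fun e => (F e).2) e0 q b.
  split=> h t; first by apply: h; apply: (proj2_sig t).
  by move=> t0; apply: (h (exist _ t t0)).
exists (F e0).2; split.
- by case: (FP _ er0).
- move=> x; have [l [v [ul lP ->]]] :=
    all_wsum k_char0 Phi_aut PhiM Phi_inj Phi_surj TP ddP er0 x.
  by exists l, v; split=> // q /lP[/wE].
- move=> q b b0 /wE; exact: (weight_ge0 k_char0 Phi_aut PhiM Phi_inj Phi_surj TP ddP er0).
- move=> q b b' b0 /wE bq /wE b'q.
  exact: (weight_line k_char0 Phi_aut PhiM Phi_inj Phi_surj TP ddP er0 b0 bq b'q).
move=> e er; have [q [q' [b [b' [[b0 /wE bq] [b'0 /wE b'q] eE]]]]] :=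
  root_difference k_char0 Phi_aut PhiM Phi_inj Phi_surj TP ddP er0 er.
by exists q, q', b, b'.
Qed.

End FacetImageSummary.

Definition integrally_closed (B : idomainType) : Prop :=
  forall z : {fraction B}, integralOver (@FracField.tofrac B) z ->
    exists f : B, z = FracField.tofrac f.

(** The fraction x / y is a root of the monic polynomial X^K - e. *)
Lemma integrally_closed_root (B : idomainType) (x y e : B) K : integrally_closed B ->
  (0 < K)%N -> y != 0 -> x ^+ K = e * y ^+ K -> exists b, x = b * y.
Proof.
move=> Bn K0 y0 xe; pose F := @FracField.tofrac B.
have Fy0 : F y != 0 by rewrite tofrac_eq0.
have [|b bE] := Bn (F x / F y).
  exists ('X^K - e%:P); first by rewrite monicXnsubC.
  rewrite rmorphB /= map_polyXn map_polyC rootE hornerD hornerN hornerXn hornerC /= subr_eq0.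
  by rewrite expr_div_n -!tofracXn xe tofracM mulfK // tofracXn expf_neq0.
by exists b; apply/eqP; rewrite -tofrac_eq tofracM -bE divfK.
Qed.

(** * Algebras graded by a lattice monoid *)

Section WeightAlgebra.
Variables (k : fieldType) (B : idomainType) (c : {rmorphism k -> B}).
Variable n : nat.
Local Notation M := 'rV[int]_n.
Variables (U : Type) (g : U -> B -> B) (chi : U -> M -> k).
Hypothesis gk : forall u, kend c (g u).
Hypothesis chi0 : forall u, chi u 0 = 1.
Hypothesis chiD : forall u p q, chi u (p + q) = chi u p * chi u q.
Hypothesis chi_neq0 : forall u q, chi u q != 0.
Hypothesis chi_sep : forall p q, (forall u, chi u p = chi u q) -> p = q.

Definition weight (q : M) (b : B) : Prop := forall u, g u b = c (chi u q) * b.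
Definition weights : set M := [set q | exists2 b, b != 0 & weight q b].

Let gl u : klinear c (g u). Proof. exact: kend_klinear (gk u). Qed.

Lemma weight_1 : weight 0 1.
Proof. by move=> u; rewrite (kend1 (gk u)) chi0 rmorph1 mulr1. Qed.

Lemma weightM p q x y : weight p x -> weight q y -> weight (p + q) (x * y).
Proof.
by move=> px qy u; have [_ gM _] := gk u; rewrite gM px qy chiD rmorphM mulrACA.
Qed.

Lemma weightX q x i : weight q x -> weight (q *+ i) (x ^+ i).
Proof.
move=> qx; elim: i => [|i IH]; first exact: weight_1.
by rewrite mulrS exprS; apply: weightM.
Qed.

Lemma weight_prod (I : Type) (s : seq I) (q : I -> M) (x : I -> B) :
  (forall i, weight (q i) (x i)) -> weight (\sum_(i <- s) q i) (\prod_(i <- s) x i).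
Proof.
move=> qx; elim: s => [|i s IH]; first by rewrite !big_nil; apply: weight_1.
by rewrite !big_cons; apply: weightM.
Qed.

Lemma weight0 q : weight q 0.
Proof. by move=> u; rewrite mulr0 (klinear0 (gl u)). Qed.

Lemma weightD q x y : weight q x -> weight q y -> weight q (x + y).
Proof. by move=> h h' u; have [gD _] := gl u; rewrite gD h h' mulrDr. Qed.

Lemma weightZ q a x : weight q x -> weight q (c a * x).
Proof. by move=> h u; have [_ gZ] := gl u; rewrite gZ h mulrCA. Qed.

Lemma weight_factor p q x y : y != 0 -> weight q y -> weight (p + q) (x * y) -> weight p x.
Proof.
move=> y0 qy h u; have [_ gM _] := gk u.
have := h u; rewrite gM qy chiD rmorphM.
have cq0 : c (chi u q) * y != 0 by rewrite mulf_neq0 // fmorph_eq0.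
by rewrite [c (chi u p) * _ * _]mulrACA => /(mulIf cq0).
Qed.

Lemma weight_neq : forall (l : seq M), {in l &, forall p q, p != q ->
  exists u, chi u p != chi u q}.
Proof.
move=> l p q _ _; apply: contraNP => /forallNP H; apply/eqP; apply: chi_sep => u.
by apply/eqP; apply: contrapT => /negP /H.
Qed.

Lemma weight_summand (l : seq M) (v : M -> B) q f : uniq l ->
  {in l, forall p, weight p (v p)} -> f != 0 -> weight q f -> f = \sum_(p <- l) v p -> q \in l /\ f = v q.
Proof.
move=> ul lv f0 fq fE.
have [p [pl wp vp]] := weight_single (w := fun q u => chi u q) gl ul (weight_neq (l := l)) lv fq fE f0.
by rewrite (chi_sep wp).
Qed.

Lemma weights0 : weights 0.
Proof. by exists 1; [apply: oner_neq0 | apply: weight_1]. Qed.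

Lemma weights_add p q : weights p -> weights q -> weights (p + q).
Proof.
move=> [b b0 bp] [b' b'0 b'q].
by exists (b * b'); [apply: mulf_neq0|apply: weightM].
Qed.

Hypothesis weight_dec : forall x, exists (l : seq M) (v : M -> B),
  [/\ uniq l, {in l, forall q, weight q (v q)} & x = \sum_(q <- l) v q].
Hypothesis weight_line : forall q b b', b != 0 -> weight q b -> weight q b' ->
  exists a, b' = c a * b.
Hypothesis weights_gen : forall x, exists p q, [/\ weights p, weights q & x = p - q].
Hypothesis B_normal : integrally_closed B.
Variables (N : nat) (y : 'I_N -> B).
Hypothesis y_gen : generates c y.
Hypothesis B_points : forall b, b != 0 ->
  exists2 ev : {rmorphism B -> k}, forall a, ev (c a) = a & ev b != 0.

(** The weights occurring in a finite set of algebra generators generate the monoid, since weights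
    add under products. *)
Lemma weights_fg : exists N' (q : 'I_N' -> M) (v : 'I_N' -> B),
  [/\ forall i, v i != 0, forall i, weight (q i) (v i) &
      forall p, weights p -> exists a : 'I_N' -> nat, p = \sum_i q i *+ a i].
Proof.
have /choice[F FP] i : exists L : seq (M * B),
    (forall p, p \in L -> p.2 != 0 /\ weight p.1 p.2) /\ y i = \sum_(p <- L) p.2.
  have [l [v [ul lv ->]]] := weight_dec (y i).
  exists [seq (q, v q) | q <- l & v q != 0]; split.
    by move=> _ /mapP[q + ->]; rewrite mem_filter => /andP[vq /lv].
  rewrite big_map big_filter [LHS](bigID (fun q => v q == 0)) /=.
  by rewrite big1 ?add0r // => q /eqP.
pose L := flatten [seq F i | i <- enum 'I_N].
have LP p : p \in L -> p.2 != 0 /\ weight p.1 p.2.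
  by case/flatten_mapP => i _ /((FP i).1).
pose tL := tnth (in_tuple L).
have tLP i : (tL i).2 != 0 /\ weight (tL i).1 (tL i).2 by apply: LP; apply: mem_tnth.
pose Q0 : set M := [set p | exists a : 'I_(size L) -> nat, p = \sum_i (tL i).1 *+ a i].
have Q00 : Q0 0 by exists (fun=> 0%N); rewrite big1.
have Q0D p q : Q0 p -> Q0 q -> Q0 (p + q).
  move=> [a ->] [b ->]; exists (fun i => a i + b i)%N.
  by rewrite -big_split; apply: eq_bigr => i _; rewrite mulrnDr.
have Q0L p : p \in L -> Q0 p.1.
  move=> /(@tnthP _ _ (in_tuple L))[i ->]; exists (fun j => nat_of_bool (j == i)).
  by rewrite (bigD1 i) //= eqxx mulr1n big1 ?addr0 // => j /negbTE ->.
pose W x := exists L' : seq (M * B), (forall p, p \in L' -> Q0 p.1 /\ weight p.1 p.2) /\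
  x = \sum_(p <- L') p.2.
have W0 : W 0 by exists [::]; rewrite big_nil.
have W1 : W 1.
  exists [:: (0, 1)]; rewrite big_seq1; split=> // p; rewrite inE => /eqP -> /=.
  by split=> //; apply: weight_1.
have WD x z : W x -> W z -> W (x + z).
  move=> [L1 [L1P ->]] [L2 [L2P ->]]; exists (L1 ++ L2); rewrite big_cat; split=> // p.
  by rewrite mem_cat => /orP[/L1P|/L2P].
have WM x z : W x -> W z -> W (x * z).
  move=> [L1 [L1P ->]] [L2 [L2P ->]].
  exists [seq (p.1 + q.1, p.2 * q.2) | p <- L1, q <- L2]; split.
    move=> _ /allpairsP[[p q] [/L1P[pQ pw] /L2P[qQ qw] ->]] /=.
    by split; [apply: Q0D | apply: weightM].
  by rewrite big_allpairs_dep mulr_suml; apply: eq_bigr => p _; rewrite mulr_sumr.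
have WX x i : W x -> W (x ^+ i) by move=> Wx; elim: i => // i IH; rewrite exprS; apply: WM.
have Wc a : W (c a).
  exists [:: (0, c a)]; rewrite big_seq1; split=> // p; rewrite inE => /eqP -> /=.
  by split=> // u; have [_ _ ->] := gk u; rewrite chi0 rmorph1 mul1r.
have Wall x : W x.
  have [G ->] := y_gen x; rewrite /mmap; elim/big_ind: _ => // m _.
  apply: (WM _ _ (Wc _)); rewrite /mmap1; elim/big_ind: _ => // i _.
  apply: WX; rewrite (FP i).2; exists (F i); split=> // p pF; split; last by case: (FP i) => /(_ p pF)[].
  by apply: Q0L; apply/flatten_mapP; exists i => //; rewrite mem_enum.
exists (size L), (fun i => (tL i).1), (fun i => (tL i).2); split=> [i|i|p [b b0 bp]].
- by case: (tLP i).
- by case: (tLP i).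
have [L' [L'P bE]] := Wall b.
pose v q := \sum_(p <- L' | p.1 == q) p.2.
rewrite sum_regroup in bE.
have [|pL _] := weight_summand (v := v) (undup_uniq _) _ b0 bp bE.
  move=> q _; rewrite /v big_seq_cond; elim/big_ind: _ => [|x z|p' /andP[/L'P[_ h] /eqP <-]] //.
    exact: weight0.
  exact: weightD.
by move: pL; rewrite mem_undup => /mapP[p' /L'P[Qp _] ->].
Qed.

(** Saturation comes from normality. If K x is a weight and x = p - q, vectors b1, b2 of weights p,
    q have (b1 / b2)^K in [B] because weight spaces are lines; so b1 / b2 lies in [B] and has weight
    x. *)
Lemma weights_lattice_monoid : lattice_monoid weights.
Proof.
split.
- exact: weights0.
- exact: weights_add.
- have [N' [q [v [v0 vw qP]]]] := weights_fg.
  by exists N', q; split=> // i; exists (v i).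
- exact: weights_gen.
move=> K x K0 [b b0 bw]; have [p [q [[b1 b10 b1p] [b2 b20 b2q] xE]]] := weights_gen x.
have [||e eE] := weight_line (b := b * b2 ^+ K) (b' := b1 ^+ K) (q := p *+ K) _ _ (weightX K b1p).
- by rewrite mulf_neq0 // expf_neq0.
- have -> : p *+ K = x *+ K + q *+ K by rewrite -mulrnDl xE subrK.
  by apply: weightM => //; apply: weightX.
rewrite mulrA in eE.
have [b3 b3E] := integrally_closed_root B_normal K0 b20 eE.
exists b3; first by apply: contraNneq b10 => b30; rewrite b3E b30 mul0r.
by apply: (weight_factor b20 b2q); rewrite -b3E xE subrK.
Qed.

(** Weight vectors are normalised to value 1 at a point where the generating weight vectors do not
    vanish; on one-dimensional weight spaces this makes the choice multiplicative. *)
Lemma weights_toric_basis : exists X : M -> B,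
  toric_basis c weights X /\ forall q, weights q -> weight q (X q).
Proof.
have [N' [q [v [v0 vw qP]]]] := weights_fg.
have [ev evc evv] : exists2 ev : {rmorphism B -> k}, forall a, ev (c a) = a &
    forall i, ev (v i) != 0.
  have [|ev evc e0] := B_points (b := \prod_i v i).
    by rewrite prodf_seq_neq0; apply/allP => i _ /=; apply: v0.
  exists ev => // i; move: e0; rewrite rmorph_prod prodf_seq_neq0 => /allP/(_ i).
  by rewrite mem_index_enum => /(_ isT).
have /choice[X XP] p : exists b, weights p -> ev b = 1 /\ weight p b.
  have [pw|] := pselect (weights p); last by exists 0.
  have [a pE] := qP p pw; pose b := \prod_i v i ^+ a i.
  have eb : ev b != 0.
    rewrite rmorph_prod prodf_seq_neq0; apply/allP => i _ /=.
    by rewrite rmorphXn expf_neq0.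
  exists (c (ev b)^-1 * b) => _; rewrite rmorphM evc mulVf //; split=> //.
  apply: weightZ; rewrite pE; apply: weight_prod => i; exact: weightX.
have X0 p : weights p -> X p != 0.
  move=> /XP[e _]; apply/eqP => Xp; have := oner_neq0 k.
  by rewrite -e Xp rmorph0 eqxx.
have X_uniq p b : weights p -> weight p b -> b = c (ev b) * X p.
  move=> pw bp; have [eX Xp] := XP p pw.
  have [a ->] := weight_line (X0 p pw) Xp bp.
  by rewrite rmorphM evc eX mulr1.
exists X; split; last by move=> p /XP[].
split.
- have [e w] := XP 0 weights0.
  by rewrite [RHS](X_uniq 0 1 weights0 weight_1) rmorph1 rmorph1 mul1r.
- move=> s t Ss St; have [es ws] := XP s Ss; have [et wt] := XP t St.
  by rewrite [RHS](X_uniq _ _ (weights_add Ss St) (weightM ws wt)) rmorphM es et mulr1 rmorph1 mul1r.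
- move=> f; have [l [w [ul lw ->]]] := weight_dec f.
  exists [seq p <- l | w p != 0], (fun p => ev (w p)); split.
  + exact: filter_uniq.
  + move=> p; rewrite mem_filter => /andP[wp pl]; exists (w p) => //; exact: lw.
  rewrite big_filter [LHS](bigID (fun p => w p == 0)) /= big1 ?add0r => [|p /eqP //].
  rewrite big_seq_cond [RHS]big_seq_cond; apply: eq_bigr => p /andP[pl wp].
  by apply: X_uniq; [exists (w p) => //|]; apply: lw.
move=> l a ul lw a0 p pl.
have g0 t z : [set (0 : B)] z -> [set (0 : B)] (g t z).
  by move=> ->; apply: klinear0 (gl t).
have := weight_component (w := fun q u => chi u q) (x := fun s => c (a s) * X s)
  gl (subspace0 c) g0 ul (weight_neq (l := l)) _ a0 pl.
move=> h; have /eqP : c (a p) * X p = 0.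
  apply: h => s sl t; have [_ Xs] := XP s (lw s sl); exact: weightZ.
by rewrite mulf_eq0 (negbTE (X0 p (lw p pl))) orbF fmorph_eq0 => /eqP.
Qed.

End WeightAlgebra.

(** * The weight monoid and all facets *)

Section WeightMonoid.
Variables (k : closedFieldType) (R B : idomainType).
Variables (c : {rmorphism k -> R}) (c' : {rmorphism k -> B}).
Hypothesis k_char0 : [pchar k] =i pred0.
Hypothesis k_unc : ~ countable [set: k].
Variable n : nat.
Local Notation M := 'rV[int]_n.
Variables (S : set M) (X : M -> R).
Hypothesis SM : lattice_monoid S.
Hypothesis XB : toric_basis c S X.
Hypothesis S_proper : exists m, ~ S m.
Variables (N : nat) (y : 'I_N -> B).
Hypothesis y_gen : generates c' y.

Variable Phi : (R -> R) -> B -> B.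
Hypothesis Phi_aut : forall f, kaut c f -> kaut c' (Phi f).
Hypothesis PhiM : forall f g, kaut c f -> kaut c g -> Phi (f \o g) = Phi f \o Phi g.
Hypothesis Phi_inj : forall f g, kaut c f -> kaut c g -> Phi f = Phi g -> f = g.
Hypothesis Phi_surj : forall g, kaut c' g -> exists2 f, kaut c f & Phi f = g.

Variable T : ('I_n -> k) -> R -> R.
Hypothesis TP : forall t, torus_pt t ->
  kaut c (T t) /\ forall s, S s -> T t (X s) = c (tchar t s) * X s.

Definition torus_op (t : torus k n) : B -> B := Phi (T (sval t)).
Definition twisted_char (tau : k -> k) (t : torus k n) (q : M) : k := tau (tchar (sval t) q).

Lemma torus_op_kend t : kend c' (torus_op t).
Proof. by case: (Phi_aut (TP (proj2_sig t)).1). Qed.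

Section Twist.
Variable tau : {rmorphism k -> k}.
Lemma twisted_char0 t : twisted_char tau t 0 = 1.
Proof. by rewrite /twisted_char tchar0 rmorph1. Qed.
Lemma twisted_charD t p q :
  twisted_char tau t (p + q) = twisted_char tau t p * twisted_char tau t q.
Proof. by rewrite /twisted_char tcharD ?rmorphM //; exact: (proj2_sig t). Qed.
Lemma twisted_char_neq0 t q : twisted_char tau t q != 0.
Proof. by rewrite fmorph_eq0; apply: tchar_neq0; exact: (proj2_sig t). Qed.
Lemma twisted_char_sep p q :
  (forall t, twisted_char tau t p = twisted_char tau t q) -> p = q.
Proof.
move=> h; apply: (tchar_separates k_char0) => t t0; apply: (fmorph_inj tau).
exact: (h (exist _ t t0)).
Qed.
End Twist.

Local Notation wt tau := (weight c' torus_op (twisted_char tau)).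

Lemma weight_vecE tau q b : weight_vec c' Phi T tau q b <-> wt tau q b.
Proof.
split=> h t; first by apply: h; apply: (proj2_sig t).
by move=> t0; apply: (h (exist _ t t0)).
Qed.

(** One facet provides tau, the decomposition and the generation of the lattice. Containment in [S]
    needs every facet, and each brings its own field automorphism, which must first be shown equal
    to tau. *)
Lemma weight_monoid_ex : exists tau : {rmorphism k -> k},
  [/\ bijective tau,
      forall x, exists (l : seq M) (v : M -> B),
        [/\ uniq l, {in l, forall q, wt tau q (v q)} & x = \sum_(q <- l) v q],
      forall q b b', b != 0 -> wt tau q b -> wt tau q b' -> exists a, b' = c' a * b,
      weights c' torus_op (twisted_char tau) `<=` S
    & forall x, exists p q, [/\ weights c' torus_op (twisted_char tau) p,
        weights c' torus_op (twisted_char tau) q & x = p - q]].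
Proof.
have [m nSm] := S_proper; have [r [Sr _]] := facet_separates SM nSm.
have [tau [tau_bij dec _ line diff]] :=
  facet_image k_char0 k_unc SM XB y_gen Phi_aut PhiM Phi_inj Phi_surj TP Sr.
have gk := torus_op_kend; have gl t := kend_klinear (gk t).
have dec' x : exists (l : seq M) (v : M -> B),
    [/\ uniq l, {in l, forall q, wt tau q (v q)} & x = \sum_(q <- l) v q].
  have [l [v [ul lv xE]]] := dec x; exists l, v; split=> // q /lv.
  by move/weight_vecE.
set Q := weights c' torus_op (twisted_char tau).
have Q0 : Q 0 := weights0 gk (twisted_char0 tau).
have QD p q : Q p -> Q q -> Q (p + q) := weights_add gk (twisted_charD tau) (p:=p) (q:=q).
have gen x : exists p q, [/\ Q p, Q q & x = p - q].
  apply: (root_generate SM Sr (H := [set x | exists p q, [/\ Q p, Q q & x = p - q]])) => [_ _ [p [q [Qp Qq ->]]] [p' [q' [Qp' Qq' ->]]]|e er].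
    exists (p + q'), (q + p'); split; try exact: QD.
    by rewrite !opprD opprK [RHS](AC (2*2) ((1*3)*(4*2))) /=.
  have [q [q' [b [b' [[b0 /weight_vecE bq] [b'0 /weight_vecE b'q] ->]]]]] := diff e er.
  by exists q', q; split=> //; [exists b' | exists b].
exists tau; split=> //.
  by move=> q b b' b0 /weight_vecE bq /weight_vecE b'q; apply: line b0 bq b'q.
have m0 : m != 0 by apply: contra_notN nSm => /eqP ->; apply: lmon0.
(* A vector of nonzero weight is needed to compare field automorphisms: on weight zero every twist
   is invisible. *)
have [q0 [b0 b00 b0q] q00] : exists2 q0, Q q0 & q0 != 0.
  have [p [q [Qp Qq mE]]] := gen m; have [p0|] := eqVneq p 0; last by exists p.
  by exists q => //; apply: contraNneq m0 => q0; rewrite mE p0 q0 subrr.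
move=> q [b bn0 bq]; apply: contrapT => nSq.
have [r' [Sr' r'q]] := facet_separates SM nSq.
have [tau' [_ dec2 ge0 _ _]] :=
  facet_image k_char0 k_unc SM XB y_gen Phi_aut PhiM Phi_inj Phi_surj TP Sr'.
have [l [v [ul lv b0E]]] := dec2 b0.
have lv' : {in l, forall q t, torus_op t (v q) = c' (twisted_char tau' t q) * v q}.
  by move=> p /lv/weight_vecE.
have sep : {in l &, forall p q, p != q -> exists t,
    twisted_char tau' t p != twisted_char tau' t q}.
  exact: (weight_neq (twisted_char_sep (tau := tau'))).
have [q' [_ E _]] := weight_single (w := fun q t => twisted_char tau' t q) gl ul sep lv' b0q b0E b00.
(* [b0] has weight q0 for tau and some q' for tau'. Restricted to the one-parameter subgroup of [q0]
   the two characters have exponents [dot q0 q0], which is nonzero, and [dot q0 q']. *)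
have [||tautau' _] := @field_endo_power _ k_char0 tau tau' (dot q0 q0) (dot q0 q').
- by rewrite gt_eqF // dot_gt0.
- move=> s s0; have := E (one_ps_pt q0 s0).
  by rewrite /twisted_char /= !tchar_one_ps // !fmorphXz.
have : 0 <= dot r' q.
  by apply: (ge0 q b) => // t t0; rewrite -tautau'; exact: (bq (exist _ t t0)).
by rewrite leNgt r'q.
Qed.

End WeightMonoid.

Lemma tchar_map (k : fieldType) n (tau : {rmorphism k -> k}) (t : 'I_n -> k) m :
  tchar (tau \o t) m = tau (tchar t m).
Proof. by rewrite /tchar rmorph_prod; apply: eq_bigr => i _; rewrite fmorphXz. Qed.

(** * Exchanging the two algebras *)

Section Transfer.
Variables (k : closedFieldType) (R B : idomainType).
Variables (c : {rmorphism k -> R}) (c' : {rmorphism k -> B}).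
Hypothesis k_char0 : [pchar k] =i pred0.
Hypothesis k_unc : ~ countable [set: k].
Variable n : nat.
Local Notation M := 'rV[int]_n.
Variables (S : set M) (X : M -> R).
Hypothesis SM : lattice_monoid S.
Hypothesis XB : toric_basis c S X.
Hypothesis S_proper : exists m, ~ S m.
Variables (N : nat) (z : 'I_N -> R).
Hypothesis z_gen : generates c z.
Variables (N' : nat) (y : 'I_N' -> B).
Hypothesis y_gen : generates c' y.
Hypothesis B_normal : integrally_closed B.
Hypothesis B_points : forall b : B, b != 0 ->
  exists2 ev : {rmorphism B -> k}, forall a, ev (c' a) = a & ev b != 0.

Variable Phi : (R -> R) -> B -> B.
Hypothesis Phi_aut : forall f, kaut c f -> kaut c' (Phi f).
Hypothesis PhiM : forall f g, kaut c f -> kaut c g -> Phi (f \o g) = Phi f \o Phi g.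
Hypothesis Phi_inj : forall f g, kaut c f -> kaut c g -> Phi f = Phi g -> f = g.
Hypothesis Phi_surj : forall g, kaut c' g -> exists2 f, kaut c f & Phi f = g.

(** [B] is the monoid algebra of its weight monoid [Q], a subset of [S]. The same result for the
    inverse of [Phi] bounds the weights of [R] under the torus of [B] by [Q]; these include [S] once
    the two tori and the two twists are matched. *)
Theorem toric_basis_transfer : exists X' : M -> B, toric_basis c' S X'.
Proof.
have [T TP] := torus_action_ex SM XB.
have [tau [[ta taK tKa] dec line QS gen]] :=
  weight_monoid_ex k_char0 k_unc SM XB S_proper y_gen Phi_aut PhiM Phi_inj Phi_surj TP.
have gk := torus_op_kend Phi_aut TP.
set Q := weights _ _ _ in QS gen.
have [QM [X' [QB X'w]]] : lattice_monoid Q /\ exists X' : M -> B, toric_basis c' Q X' /\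
    forall q, Q q -> weight c' (torus_op Phi T) (twisted_char tau) q (X' q).
  have d0 := @twisted_char0 k n tau; have dD := @twisted_charD k n tau.
  have dn := @twisted_char_neq0 k n tau; have ds := @twisted_char_sep k k_char0 n tau.
  split; first exact (weights_lattice_monoid gk d0 dD dn ds dec line gen B_normal y_gen).
  exact (weights_toric_basis gk d0 dD ds dec line y_gen B_points).
have Q_proper : exists m, ~ Q m by have [m nSm] := S_proper; exists m => /QS.
have [T' T'P] := torus_action_ex QM QB.
(* [Psi] inverts [Phi] on automorphisms; elsewhere its value is irrelevant and set to [id]. *)
have /choice[Psi PsiP] g : exists f, kaut c' g -> kaut c f /\ Phi f = g.
  have [/Phi_surj[f fk fg]|] := pselect (kaut c' g); first by exists f.
  by exists id.
have Psi_aut g : kaut c' g -> kaut c (Psi g) by case/PsiP.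
have PhiK g : kaut c' g -> Phi (Psi g) = g by case/PsiP.
have PsiK f : kaut c f -> Psi (Phi f) = f.
  by move=> fk; apply: Phi_inj => //; rewrite ?PhiK //; [apply: Psi_aut|]; apply: Phi_aut.
have PsiM f g : kaut c' f -> kaut c' g -> Psi (f \o g) = Psi f \o Psi g.
  move=> fk gk'; have fg := kaut_comp fk gk'.
  apply: Phi_inj; [exact: Psi_aut|by apply: kaut_comp; apply: Psi_aut|].
  by rewrite (PhiM (Psi_aut _ fk) (Psi_aut _ gk')) !PhiK.
have Psi_inj f g : kaut c' f -> kaut c' g -> Psi f = Psi g -> f = g.
  by move=> /PhiK {2}<- /PhiK {2}<- ->.
have Psi_surj f : kaut c f -> exists2 g, kaut c' g & Psi g = f.
  by move=> fk; exists (Phi f); [apply: Phi_aut|apply: PsiK].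
have [tau' [_ _ _ S'Q gen']] := weight_monoid_ex k_char0 k_unc QM QB Q_proper z_gen
  Psi_aut PsiM Psi_inj Psi_surj T'P.
have torus_tau (t : 'I_n -> k) : torus_pt t -> torus_pt (tau \o t) by move=> t0 i; rewrite fmorph_eq0.
(* Twisting the character by tau amounts to applying tau to the coordinates of the torus point. *)
have PhiT t : torus_pt t -> Phi (T t) = T' (tau \o t).
  move=> t0; have [Tk _] := TP t t0; have [T'k T'X] := T'P _ (torus_tau t t0).
  apply/funext; apply: (tb_ext QM QB).
  - exact: kend_klinear (Phi_aut Tk).1.
  - exact: kend_klinear T'k.1.
  move=> q Qq; rewrite T'X // tchar_map.
  exact: (X'w q Qq (exist _ t t0)).
have PsiT t : torus_pt t -> Psi (T' (tau \o t)) = T t.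
  by move=> t0; rewrite -PhiT // PsiK //; case: (TP t t0).
(* A vector of nonzero weight p for the returned action has character tau'(tau(p)), and by the
   original basis it has an untwisted character; along [p] the two are compared as powers. *)
have tau'K s : tau' (tau s) = s.
  have [m nSm] := S_proper.
  have m0 : m != 0 by apply: contra_notN nSm => /eqP ->; apply: lmon0.
  have [p [f f0 fp] p0] : exists2 p,
      weights c (torus_op Psi T') (twisted_char tau') p & p != 0.
    have [p [q [S'p S'q mE]]] := gen' m; have [p0|] := eqVneq p 0; last by exists p.
    by exists q => //; apply: contraNneq m0 => q0; rewrite mE p0 q0 subrr.
  have [l [a [ul lS fE]]] := tb_span XB f.
  have [||||q [_ qE _]] := weight_single (c := c)
     (g := fun (t : torus k n) => T (sval t))
     (w := fun q (t : torus k n) => tchar (sval t) q) (x := fun q => c (a q) * X q) (f := f)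
     (wf := fun t => tau' (tau (tchar (sval t) p))) _ ul _ _ _ fE f0.
  - by move=> t; case: (TP _ (proj2_sig t)) => -[Tk _] _; apply: kend_klinear.
  - move=> q q' _ _; apply: contraNP => /forallNP H; apply/eqP.
    apply: (tchar_separates k_char0) => t t0.
    by apply/eqP; apply: contrapT => /negP; apply: (H (exist _ t t0)).
  - move=> q ql t; have [[Tk _] TX] := TP _ (proj2_sig t).
    by have [_ TZ] := kend_klinear Tk; rewrite TZ (TX _ (lS q ql)) mulrCA.
  - move=> t; have t0 := proj2_sig t.
    have := fp (exist _ _ (torus_tau _ t0)).
    by rewrite /torus_op /twisted_char /= PsiT // tchar_map.
  have [||h _] := @field_endo_power _ k_char0 (tau' \o tau) idfun (dot p p) (dot p q).
  - by rewrite gt_eqF // dot_gt0.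
  - move=> u u0; have := qE (one_ps_pt p u0).
    by rewrite /= !tchar_one_ps // !fmorphXz.
  exact: h.
have SQ : S `<=` Q.
  move=> s Ss; apply: S'Q; exists (X s); first by apply: (tb_neq0 XB Ss).
  case=> t' t'0; rewrite /torus_op /twisted_char /=.
  have t0 : torus_pt (ta \o t').
    by move=> i; apply: contraNneq (t'0 i) => /= e; rewrite -(tKa (t' i)) e rmorph0.
  have t'E : t' = tau \o (ta \o t') by apply/funext => i; rewrite /= tKa.
  have [_ TX] := TP _ t0.
  by rewrite t'E PsiT // TX // tchar_map tau'K.
by exists X'; have -> : S = Q by apply/seteqP.
Qed.

End Transfer.

(** * Affine varieties and their coordinate rings *)

Section CoordinateRing.
Variables (k : fieldType) (X : irrVariety k).
Local Notation O := (coord_ring X).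

Lemma coord_ring_ext (f g : O) : (forall x, f x = g x) -> f = g.
Proof. by move=> fg; apply: val_inj; apply/funext. Qed.

Definition reg (f : X -> k) (fr : regular_function f) : O := MkRegular (asboolT fr).

Lemma regular_of (f : O) : regular_function f.
Proof. exact: asboolW (regular_funP f). Qed.

Lemma regular_const (a : k) : regular_function (fun _ : X => a).
Proof. by exists a%:MP => x; rewrite mevalC. Qed.

Lemma regular_coord i : regular_function (fun x : X => \val x i).
Proof. by exists 'X_i => x; rewrite mevalXU. Qed.

Definition cstO (a : k) : O := reg (regular_const a).
Fact cstO_zmod : zmod_morphism cstO.
Proof. by move=> a b; apply: coord_ring_ext. Qed.
Fact cstO_monoid : monoid_morphism cstO.
Proof. by split=> [|a b]; apply: coord_ring_ext. Qed.
HB.instance Definition _ := GRing.isZmodMorphism.Build k O cstO cstO_zmod.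
HB.instance Definition _ := GRing.isMonoidMorphism.Build k O cstO cstO_monoid.

Definition coordO i : O := reg (regular_coord i).

Definition evO (x : X) (f : O) : k := f x.
Fact evO_zmod x : zmod_morphism (evO x). Proof. by []. Qed.
Fact evO_monoid x : monoid_morphism (evO x). Proof. by []. Qed.
HB.instance Definition _ x := GRing.isZmodMorphism.Build O k (evO x) (evO_zmod x).
HB.instance Definition _ x := GRing.isMonoidMorphism.Build O k (evO x) (evO_monoid x).

Lemma mmap_coord (p : {mpoly k[ambient_dim X]}) x : mmap cstO coordO p x = p.@[\val x].
Proof. by rewrite -[LHS]/(evO x _) rmorph_mmap /meval; apply: eq_bigr. Qed.

Lemma coord_generates : generates cstO coordO.
Proof.
move=> f; have [p fp] := regular_of f; exists p; apply: coord_ring_ext => x.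
by rewrite mmap_coord fp.
Qed.

Lemma coord_ring_points (b : O) : b != 0 ->
  exists2 ev : {rmorphism O -> k}, forall a, ev (cstO a) = a & ev b != 0.
Proof.
move=> b0; have [x bx] : exists x, b x != 0.
  apply: contrapT => /forallNP h; case/eqP: b0; apply: coord_ring_ext => x.
  by apply/eqP; apply: contrapT => /negP /h.
by exists (evO x).
Qed.

Lemma point_ext (x x' : X) : (forall f : O, f x = f x') -> x = x'.
Proof. by move=> h; apply: val_inj; apply/ffunP => i; apply: (h (coordO i)). Qed.

Lemma dense_ext (A : set X) (f g : O) : vdense A -> (forall x, A x -> f x = g x) -> f = g.
Proof.
move=> Ad fg; have h := Ad _ (regular_zeros_closed (f - g)).
apply: coord_ring_ext => x; apply/eqP; rewrite -subr_eq0; apply/eqP.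
suff : [set x | (f - g) x = 0] x by [].
by rewrite h // => z Az /=; rewrite -[LHS]/(f z - g z) fg // subrr.
Qed.

End CoordinateRing.
Arguments cstO {k} X a.
Arguments coordO {k} X i.

(** * Duality between varieties and coordinate rings *)

Section Duality.
Variables (k : fieldType).
Implicit Types X Y Z : irrVariety k.

Definition pullback X Y (f : X -> Y) (fm : is_morphism f) (h : coord_ring Y) : coord_ring X :=
  reg (regular_comp fm (regular_of h)).

Lemma morphism_of_hom X Y (psi : {rmorphism coord_ring Y -> coord_ring X}) :
  (forall a, psi (cstO Y a) = cstO X a) ->
  exists f : X -> Y, is_morphism f /\ forall (h : coord_ring Y) x, h (f x) = psi h x.
Proof.
move=> psic.
pose v x : {ffun 'I_(ambient_dim Y) -> k} := [ffun i => psi (coordO Y i) x].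
have psiE p x : psi (mmap (cstO Y) (coordO Y) p) x = p.@[v x].
  rewrite rmorph_mmap -[LHS]/(evO x _) rmorph_mmap /meval; apply: eq_bigr => m _ /=.
  rewrite psic; congr (_ * _); rewrite /mmap1; apply: eq_bigr => i _.
  by rewrite /= ffunE.
have [T YT] := locusP Y.
have YT' w : locus Y w -> zero_locus T w by rewrite YT.
have vY x : locus Y (v x).
  rewrite YT => p Tp; rewrite -psiE (_ : mmap _ _ _ = 0) ?rmorph0 //.
  apply: coord_ring_ext => z; rewrite mmap_coord.
  exact: (YT' _ (set_mem (valP z)) p Tp).
exists (fun x => SigSub (mem_set (vY x))); split=> [i|h x].
  have [p pE] := regular_of (psi (coordO Y i)); exists p => x.
  by rewrite -pE /= ffunE.
have [p pE] := coord_generates h; rewrite pE psiE mmap_coord; exact: meval_eq.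
Qed.

Definition aut_pull X (a : AutV X) : coord_ring X -> coord_ring X :=
  pullback (proj1 (asboolW (aut_funP a))).

Lemma pullback_kend X (f : X -> X) (fm : is_morphism f) : kend (cstO X) (pullback fm).
Proof. by split=> *; apply: coord_ring_ext. Qed.

Lemma aut_pullM X (a b : AutV X) : aut_pull (a * b)%g = aut_pull b \o aut_pull a.
Proof. by apply/funext => h; apply: coord_ring_ext. Qed.

Lemma aut_pull1 X : aut_pull (1%g : AutV X) = id.
Proof. by apply/funext => h; apply: coord_ring_ext. Qed.

Lemma aut_pull_kaut X (a : AutV X) : kaut (cstO X) (aut_pull a).
Proof.
split; first exact: pullback_kend.
exists (aut_pull a^-1%g) => h.
  by rewrite -[LHS]/((aut_pull _ \o aut_pull _) h) -aut_pullM mulgV aut_pull1.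
by rewrite -[LHS]/((aut_pull _ \o aut_pull _) h) -aut_pullM mulVg aut_pull1.
Qed.

Lemma aut_pull_inj X : injective (@aut_pull X).
Proof.
move=> a b ab; apply: val_inj; apply/funext => x /=; apply: point_ext => f.
exact: (congr1 (fun F : coord_ring X -> coord_ring X => F f x) ab).
Qed.

Lemma aut_pull_surj X f : kaut (cstO X) f -> exists a : AutV X, aut_pull a = f.
Proof.
move=> fk; have [g [gk fK gK]] := kaut_inv fk.
have [F FE] := kend_rmorph fk.1; have [G GE] := kend_rmorph gk.1.
have [|u [um uE]] := @morphism_of_hom X X F; first by move=> a; rewrite -FE; case: fk => -[_ _ ->].
have [|v [vm vE]] := @morphism_of_hom X X G; first by move=> a; rewrite -GE; case: gk => -[_ _ ->].
have iu : is_isomorphism u.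
  split=> //; exists v; split=> // x; apply: point_ext => h.
    by rewrite vE uE -GE -FE gK.
  by rewrite uE vE -GE -FE fK.
exists (MkAut (asboolT iu)); apply/funext => h; apply: coord_ring_ext => x.
by rewrite FE -uE.
Qed.

Lemma isomorphic_of_hom X Y (psi : {rmorphism coord_ring Y -> coord_ring X})
    (psi' : coord_ring X -> coord_ring Y) :
  (forall a, psi (cstO Y a) = cstO X a) -> cancel psi psi' -> cancel psi' psi ->
  isomorphic X Y.
Proof.
move=> psic psiK psi'K.
have psi'c a : psi' (cstO X a) = cstO Y a by rewrite -psic psiK.
have p1 : zmod_morphism psi' by move=> a b; apply: (can_inj psiK); rewrite rmorphB !psi'K.
have p2 : monoid_morphism psi'.
  by split=> [|a b]; apply: (can_inj psiK); rewrite ?rmorph1 ?rmorphM ?psi'K.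
pose m1 := GRing.isZmodMorphism.Build _ _ psi' p1.
pose m2 := GRing.isMonoidMorphism.Build _ _ psi' p2.
pose P : {rmorphism coord_ring X -> coord_ring Y} :=
  HB.pack_for {rmorphism coord_ring X -> coord_ring Y} psi' m1 m2.
have [u [um uE]] := morphism_of_hom psic.
have [v [vm vE]] := @morphism_of_hom Y X P psi'c.
exists u; split=> //; exists v; split=> // x; apply: point_ext => h.
  by rewrite vE uE /= psi'K.
by rewrite uE vE /= psiK.
Qed.

End Duality.

(** * Isomorphism of monoid algebras of the same monoid *)

Section BasisIsomorphism.
Variables (k : fieldType) (n : nat).
Local Notation M := 'rV[int]_n.
Variable S : set M.
Hypothesis SM : lattice_monoid S.

(** Formal sums are lists that may repeat exponents: differences and products become list
    operations, and one list can be evaluated in both algebras. *)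
Definition combination (R : idomainType) (c : {rmorphism k -> R}) (X : M -> R)
    (L : seq (k * M)) : R := \sum_(p <- L) c p.1 * X p.2.

Definition in_monoid (L : seq (k * M)) : Prop := forall p, p \in L -> S p.2.

Lemma combination_regroup (R : idomainType) (c : {rmorphism k -> R}) X L :
  combination c X L =
  \sum_(q <- undup [seq p.2 | p <- L]) c (\sum_(p <- L | p.2 == q) p.1) * X q.
Proof.
rewrite /combination -(big_map (fun p => (p.2, c p.1 * X p.2)) xpredT snd) sum_regroup.
rewrite -map_comp; apply: eq_bigr => q _; rewrite big_map rmorph_sum mulr_suml.
by apply: eq_bigr => p /= /eqP ->.
Qed.

Lemma combination_eq0 (R B : idomainType) (c : {rmorphism k -> R}) (c' : {rmorphism k -> B}) X X' L :
  toric_basis c S X -> in_monoid L -> combination c X L = 0 -> combination c' X' L = 0.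
Proof.
move=> XB LS; rewrite !combination_regroup => h.
have a0 := tb_free XB (undup_uniq _) _ h.
rewrite big_seq big1 // => q ql; rewrite a0 ?rmorph0 ?mul0r // => s.
by rewrite mem_undup => /mapP[p /LS Sp ->].
Qed.

Lemma combinationB (R : idomainType) (c : {rmorphism k -> R}) X L L' :
  combination c X (L ++ [seq (- p.1, p.2) | p <- L']) = combination c X L - combination c X L'.
Proof.
rewrite /combination big_cat big_map /= -sumrN; congr (_ + _).
by apply: eq_bigr => p _; rewrite rmorphN mulNr.
Qed.

Lemma in_monoidB L L' : in_monoid L -> in_monoid L' ->
  in_monoid (L ++ [seq (- p.1, p.2) | p <- L']).
Proof.
by move=> LS LS' p; rewrite mem_cat => /orP[/LS //|/mapP[q /LS' ? ->]].
Qed.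

Lemma combinationM (R : idomainType) (c : {rmorphism k -> R}) X L L' : toric_basis c S X ->
  in_monoid L -> in_monoid L' ->
  combination c X [seq (p.1 * q.1, p.2 + q.2) | p <- L, q <- L'] = combination c X L * combination c X L'.
Proof.
move=> XB LS LS'; rewrite /combination big_allpairs_dep mulr_suml.
apply: eq_big_seq => p pL; rewrite mulr_sumr; apply: eq_big_seq => q qL /=.
by rewrite rmorphM (tbD XB (LS p pL) (LS' q qL)) mulrACA.
Qed.

Lemma in_monoidM L L' : in_monoid L -> in_monoid L' ->
  in_monoid [seq (p.1 * q.1, p.2 + q.2) | p <- L, q <- L'].
Proof.
move=> LS LS' _ /allpairsP[[p q] [/LS Sp /LS' Sq ->]] /=; exact: (lmonD SM).
Qed.

Lemma combination_ex (R : idomainType) (c : {rmorphism k -> R}) X f : toric_basis c S X ->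
  exists L, in_monoid L /\ combination c X L = f.
Proof.
move=> XB; have [r [a [ur rS ->]]] := tb_span XB f.
exists [seq (a s, s) | s <- r]; split; first by move=> _ /mapP[s /rS ? ->].
by rewrite /combination big_map.
Qed.

Lemma toric_basis_iso (R B : idomainType) (c : {rmorphism k -> R}) (c' : {rmorphism k -> B}) X X' :
  toric_basis c S X -> toric_basis c' S X' ->
  exists (psi : {rmorphism R -> B}) (psi' : B -> R),
    [/\ forall a, psi (c a) = c' a, cancel psi psi' & cancel psi' psi].
Proof.
move=> XB XB'.
have /choice[cf cfP] := fun f => @combination_ex R c X f XB.
have /choice[cf' cfP'] := fun f => @combination_ex B c' X' f XB'.
pose psi f := combination c' X' (cf f); pose psi' b := combination c X (cf' b).
have cfS f : in_monoid (cf f) by case: (cfP f).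
have cfE f : combination c X (cf f) = f by case: (cfP f).
have cfS' f : in_monoid (cf' f) by case: (cfP' f).
have cfE' f : combination c' X' (cf' f) = f by case: (cfP' f).
have psiE L : in_monoid L -> psi (combination c X L) = combination c' X' L.
  move=> LS; apply/eqP; rewrite -subr_eq0 -combinationB; apply/eqP.
  apply: (combination_eq0 c' X' XB); first exact: in_monoidB.
  by rewrite combinationB cfE subrr.
have psiE' L : in_monoid L -> psi' (combination c' X' L) = combination c X L.
  move=> LS; apply/eqP; rewrite -subr_eq0 -combinationB; apply/eqP.
  apply: (combination_eq0 c X XB'); first exact: in_monoidB.
  by rewrite combinationB cfE' subrr.
have psic a : psi (c a) = c' a.
  have h : in_monoid [:: (a, 0)] by move=> p; rewrite inE => /eqP ->; apply: (lmon0 SM).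
  by have := psiE _ h; rewrite /combination !big_seq1 (tb0 XB) (tb0 XB') !mulr1.
have p1 : zmod_morphism psi.
  move=> f g; rewrite -{1}(cfE f) -{1}(cfE g) -combinationB psiE ?combinationB //.
  exact: in_monoidB.
have p2 : monoid_morphism psi.
  split=> [|f g]; first by rewrite -(rmorph1 c) psic rmorph1.
  rewrite -{1}(cfE f) -{1}(cfE g) -combinationM // psiE ?combinationM //.
  exact: in_monoidM.
pose m1 := GRing.isZmodMorphism.Build _ _ psi p1.
pose m2 := GRing.isMonoidMorphism.Build _ _ psi p2.
pose P : {rmorphism R -> B} := HB.pack_for {rmorphism R -> B} psi m1 m2.
exists P, psi'; split=> // [f|b] /=.
  by rewrite /psi psiE' // cfE.
by rewrite /psi' psiE // cfE'.
Qed.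

End BasisIsomorphism.

(** * A criterion for generating the lattice *)

Section LatticeGeneration.
Variables (N n : nat) (q : 'I_N -> 'rV[int]_n).
Local Notation M := 'rV[int]_n.

(** In Smith normal form A = L D R, the j-th column of the inverse of [R] is a primitive form whose
    values on the rows [q i] are divisible by the j-th diagonal entry, or all zero beyond the last
    row. The hypothesis makes every entry a unit. *)
Lemma lattice_generation :
  (forall (w : M) (d : int), (forall i, exists z, dot w (q i) = z * d) ->
    (exists m, dot w m = 1) -> `|d| = 1) ->
  forall x, exists u : 'I_N -> int, x = \sum_i u i *: q i.
Proof.
move=> h; pose A : 'M[int]_(N, n) := \matrix_i q i.
have [L Lu [R Ru [d _ AE]]] := int_Smith_normal_form A.
set D := (X in L *m X *m R) in AE.
pose w (j : 'I_n) : M := (col j (invmx R))^T.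
have dotw j m : dot (w j) m = (m *m invmx R) 0 j.
  by rewrite mxE /dot; apply: eq_bigr => i _; rewrite !mxE mulrC.
have RR : R *m invmx R = 1%:M by apply: mulmxV.
have dj (j : 'I_n) : (j < N)%N /\ `|d`_j| = 1.
  have wR : exists m, dot (w j) m = 1.
    by exists (row j R); rewrite dotw -row_mul RR !mxE eqxx.
  have qE i : q i *m invmx R = row i L *m D.
    by rewrite -[q i]rowK -/A AE !row_mul -mulmxA RR mulmx1.
  have [jN|Nj] := ltnP j N.
    split=> //; apply: h wR => i; exists ((row i L) 0 (Ordinal jN)).
    rewrite dotw qE mxE (bigD1 (Ordinal jN)) //= !mxE eqxx mulr1n big1 ?addr0 // => l lj.
    rewrite !mxE; case: eqP => [e|_]; last by rewrite mulr0n mulr0.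
    by case/eqP: lj; apply: val_inj.
  have := h (w j) 0 _ wR; rewrite normr0 => {}h.
  suff /h /eqP : forall i, exists z : int, dot (w j) (q i) = z * 0 by rewrite eq_sym oner_eq0.
  move=> i; exists 0; rewrite mulr0 dotw qE mxE big1 // => l _; rewrite !mxE.
  case: eqP => [e|_]; last by rewrite mulr0n mulr0.
  by move: (ltn_ord l); rewrite e ltnNge Nj.
have surjD (z : M) : exists u : 'rV[int]_N, u *m D = z.
  exists (\row_l (if insub (val l) is Some j then z 0 j * d`_l else 0)).
  apply/rowP => j; have [jN dj1] := dj j.
  rewrite mxE (bigD1 (Ordinal jN)) //= !mxE eqxx mulr1n big1 ?addr0 => [|l lj].
    have -> : insub (val j) = Some j :> option 'I_n by apply: valK.
    have dd1 : d`_j * d`_j = 1 by apply/eqP; rewrite -expr2 sqr_norm_eq1 dj1.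
    by rewrite -mulrA dd1 mulr1.
  rewrite !mxE; case: eqP => [e|_]; last by rewrite mulr0n mulr0.
  by case/eqP: lj; apply: val_inj.
move=> x; have [u uD] := surjD (x *m invmx R).
exists ((u *m invmx L) 0).
have : x = (u *m invmx L) *m A.
  by rewrite AE -!mulmxA mulKmx // mulmxA uD mulmxKV.
move=> {1}->; apply/rowP => j; rewrite mxE summxE; apply: eq_bigr => i _.
by rewrite !mxE.
Qed.

End LatticeGeneration.

(** * Products, torus points and independence of characters *)

Section Products.
Variable k : fieldType.
Implicit Types X Y Z : affVariety k.

Fact prod_pt_subproof X Y (x : X) (y : Y) :
  @prod_locus k X Y [ffun i : 'I_(ambient_dim X + ambient_dim Y) => match fintype.split i with inl j => \val x j | inr j => \val y j end].
Proof.
rewrite /prod_locus /=; split.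
- rewrite (_ : ffun_fst _ = \val x); first exact: (set_mem (valP x)).
  by apply/ffunP => j; rewrite !ffunE -[lshift _ j]/(unsplit (inl j)) unsplitK.
- rewrite (_ : ffun_snd _ = \val y); first exact: (set_mem (valP y)).
  by apply/ffunP => j; rewrite !ffunE -[rshift _ j]/(unsplit (inr j)) unsplitK.
Qed.

Definition prod_pt X Y (x : X) (y : Y) : prod_variety X Y :=
  SigSub (mem_set (prod_pt_subproof x y)).

Lemma prod_pt_fst X Y (x : X) (y : Y) : prod_fst (prod_pt x y) = x.
Proof.
apply: val_inj; apply/ffunP => j.
by rewrite /= !ffunE -[lshift _ j]/(unsplit (inl j)) unsplitK.
Qed.

Lemma prod_pt_snd X Y (x : X) (y : Y) : prod_snd (prod_pt x y) = y.
Proof.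
apply: val_inj; apply/ffunP => j.
by rewrite /= !ffunE -[rshift _ j]/(unsplit (inr j)) unsplitK.
Qed.

Lemma regular_eq X (f g : X -> k) : f =1 g -> regular_function f -> regular_function g.
Proof. by move=> fg [p pE]; exists p => x; rewrite -fg. Qed.

Lemma pair_morphism X Y Z (f : Z -> X) (g : Z -> Y) :
  is_morphism f -> is_morphism g -> is_morphism (fun z => prod_pt (f z) (g z)).
Proof.
move=> fm gm i; case E : (fintype.split i) => [j|j].
  by apply: regular_eq (fm j) => z; rewrite /= ffunE E.
by apply: regular_eq (gm j) => z; rewrite /= ffunE E.
Qed.

Lemma const_morphism X Y (y : Y) : is_morphism (fun _ : X => y).
Proof. by move=> i; exists (\val y i)%:MP => x; rewrite mevalC. Qed.

End Products.

Section TorusPoints.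
Variables (k : closedFieldType) (n : nat).
Implicit Types s t : torus k n.

Fact gm_subproof t : torus_locus [ffun i : 'I_(n + n) => match fintype.split i return k with
  inl j => sval t j | inr j => (sval t j)^-1 end].
Proof.
move=> j; rewrite !ffunE -[lshift _ j]/(unsplit (inl j)) -[rshift _ j]/(unsplit (inr j)).
by rewrite !unsplitK mulfV //; apply: (proj2_sig t).
Qed.

Definition gm t : Gm k n := SigSub (mem_set (gm_subproof t)).

Lemma gm_surj (s : Gm k n) : exists t, gm t = s.
Proof.
have s0 : torus_pt (fun i => \val s (lshift n i)).
  by move=> i; apply/eqP => h; have /eqP := GmP s i; rewrite h mul0r eq_sym oner_eq0.
exists (exist _ _ s0); apply: val_inj; apply/ffunP => i; rewrite /= ffunE -[i in RHS]splitK.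
case: (fintype.split i) => j //=; apply: (mulfI (s0 j)).
by rewrite mulfV ?s0 // GmP.
Qed.

Fact tmul_subproof s t : torus_pt (fun i => sval s i * sval t i).
Proof. by move=> i; apply: mulf_neq0; [apply: (proj2_sig s)|apply: (proj2_sig t)]. Qed.
Definition tmul s t : torus k n := exist (@torus_pt k n) _ (tmul_subproof s t).

Fact tone_subproof : torus_pt (fun _ : 'I_n => 1 : k).
Proof. by move=> i; apply: oner_neq0. Qed.
Definition tone : torus k n := exist (@torus_pt k n) _ tone_subproof.

Lemma gm_mul s t : gm (tmul s t) = torus_mul (gm s) (gm t).
Proof.
apply: val_inj; apply/ffunP => i; rewrite /= !ffunE; case: (fintype.split i) => j //.
by rewrite invfM.
Qed.

Lemma gm_one : gm tone = torus_one k n.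
Proof.
by apply: val_inj; apply/ffunP => i; rewrite /= !ffunE; case: (fintype.split i) => j //=; rewrite invr1.
Qed.

Lemma tchar_mul s t m : tchar (sval (tmul s t)) m = tchar (sval s) m * tchar (sval t) m.
Proof. by rewrite -big_split; apply: eq_bigr => i _; rewrite /= expfzMl. Qed.

Lemma tchar_one m : tchar (sval tone) m = 1.
Proof. by apply: big1 => i _; rewrite exp1rz. Qed.

Lemma tchar_delta t (j : 'I_n) z : tchar (sval t) (z *: delta_mx 0 j) = sval t j ^ z.
Proof.
rewrite /tchar (bigD1 j) //= !mxE !eqxx mulr1 big1 ?mulr1 // => i /negbTE ij.
by rewrite !mxE ij mulr0 expr0z.
Qed.

(** Dedekind independence with coefficients in [R]: the summands are weight vectors for translation
    on functions from the torus to [R]. *)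
Lemma character_independence (R : idomainType) (c : {rmorphism k -> R})
    (l : seq 'rV[int]_n) (u : 'rV[int]_n -> R) : [pchar k] =i pred0 -> uniq l ->
  (forall t, \sum_(q <- l) c (tchar (sval t) q) * u q = 0) -> {in l, forall q, u q = 0}.
Proof.
move=> k_char0 ul h q ql.
pose G s (F : torus k n -> R) : torus k n -> R := fun t => F (tmul s t).
pose x q : torus k n -> R := fun t => c (tchar (sval t) q) * u q.
have Gl s : klinear (cst_rmorph c (torus k n)) (G s) by [].
have h0 : [set 0] (\sum_(q <- l) x q) by apply/funext => t; rewrite fct_sumE /= h.
have : x q = 0.
  apply: (weight_component (w := fun q s => tchar (sval s) q) Gl (subspace0 _) _ ul _ _ h0 ql)
    => [s F -> //|p p' _ _|p _ s].
    apply: contraNP => /forallNP H; apply/eqP; apply: (tchar_separates k_char0) => t t0.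
    by apply/eqP; apply: contrapT => /negP; apply: (H (exist _ t t0)).
  apply/funext => t; rewrite /G /x tchar_mul rmorphM.
  by rewrite -[RHS]/(c _ * (c _ * u p)) mulrA.
by move/(congr1 (@^~ tone)); rewrite /x /= tchar_one rmorph1 mul1r.
Qed.

End TorusPoints.

(** For d > 1, a root of 1 + X + ... + X^(d-1), which is not 1 in characteristic zero; for d = 0 any
    scalar works, such as 2. *)
Lemma root_of_unity (k : closedFieldType) (d : int) : [pchar k] =i pred0 -> `|d| != 1 ->
  exists z : k, [/\ z != 0, z != 1 & z ^ d = 1].
Proof.
move=> k_char0; wlog d0 : d / 0 <= d.
  move=> h; case: (leP 0 d) => [/h //|/ltW d0]; rewrite -normrN => /(h (- d)) [].
    by rewrite oppr_ge0.
  by move=> z [z0 z1 zd]; exists z; split=> //; apply: invr_inj; rewrite invr_expz zd invr1.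
case: d d0 => [[|[|m]]|//] _ //.
  by exists 2%:R; rewrite natr_char0 // expr0z -subr_eq0 -{2}[1]/(1%:R) -natrB // oner_eq0.
move=> _; pose p : {poly k} := \sum_(i < m.+2) 'X^i.
have pE : p = \poly_(i < m.+2) 1.
  by rewrite poly_def; apply: eq_bigr => i _; rewrite scale1r.
have sp : size p = m.+2 by rewrite pE size_poly_eq // oner_eq0.
have [z pz] : exists z, poly.root p z by apply/closed_rootP; rewrite sp.
have zn : z ^+ m.+2 = 1.
  apply/eqP; rewrite -subr_eq0 subrX1; move: pz; rewrite rootE horner_sum => /eqP pz.
  by rewrite (eq_bigr (fun i : 'I__ => ('X^i).[z])) ?pz ?mulr0 // => i _; rewrite hornerXn.
exists z; split=> //.
  by apply/eqP => z0; have := oner_neq0 k; rewrite -zn z0 exprS mul0r eqxx.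
apply/eqP => z1; move: pz; rewrite rootE horner_sum z1.
rewrite (eq_bigr (fun=> 1)) => [|i _]; last by rewrite hornerXn expr1n.
by rewrite sumr_const card_ord natr_char0.
Qed.

Lemma morphism_eq (k : fieldType) (X Y : affVariety k) (f g : X -> Y) :
  f =1 g -> is_morphism f -> is_morphism g.
Proof. by move=> fg fm i; apply: regular_eq (fm i) => x; rewrite fg. Qed.

(** * The coordinate ring of a toric variety *)

Section ToricVariety.
Variables (k : closedFieldType) (X : irrVariety k).
Hypothesis k_char0 : [pchar k] =i pred0.
Hypothesis X_normal : normal_variety X.
Variables (n : nat) (a : Gm k n -> X -> X) (x0 : X).
Hypothesis a_act : torus_action a.
Hypothesis a_faithful : faithful_action a.
Hypothesis x0_dense : vdense (torus_orbit a x0).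
Local Notation O := (coord_ring X).
Local Notation M := 'rV[int]_n.
Local Notation c := (cstO X).

Lemma action_morphism (Z : affVariety k) (f : Z -> Gm k n) (g : Z -> X) :
  is_morphism f -> is_morphism g -> is_morphism (fun z => a (f z) (g z)).
Proof.
move=> fm gm; have [_ _ am] := a_act.
apply: morphism_eq (morphism_comp (pair_morphism fm gm) am) => z /=.
by rewrite prod_pt_fst prod_pt_snd.
Qed.

Lemma translation_morphism t : is_morphism (a (gm t)).
Proof. by apply: action_morphism; [apply: const_morphism|apply: morphism_id]. Qed.

Definition translate (t : torus k n) : O -> O := pullback (translation_morphism t).
Definition tch (t : torus k n) (q : M) : k := tchar (sval t) q.

Lemma translate_kend t : kend c (translate t).
Proof. exact: pullback_kend. Qed.

Lemma tch0 t : tch t 0 = 1. Proof. exact: tchar0. Qed.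
Lemma tchD t p q : tch t (p + q) = tch t p * tch t q.
Proof. by apply: tcharD; apply: (proj2_sig t). Qed.
Lemma tch_neq0 t q : tch t q != 0.
Proof. by apply: tchar_neq0; apply: (proj2_sig t). Qed.
Lemma tch_sep p q : (forall t, tch t p = tch t q) -> p = q.
Proof.
by move=> h; apply: (tchar_separates k_char0) => t t0; apply: (h (exist _ t t0)).
Qed.

Lemma translateM s t f : translate s (translate t f) = translate (tmul t s) f.
Proof.
have [_ aM _] := a_act; apply: coord_ring_ext => x.
by rewrite -[LHS]/(f (a (gm t) (a (gm s) x))) -aM -gm_mul.
Qed.

Lemma translate1 f : translate (tone k n) f = f.
Proof.
have [a1 _ _] := a_act; apply: coord_ring_ext => x.
by rewrite -[LHS]/(f (a (gm (tone k n)) x)) gm_one a1.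
Qed.

(** Laurent polynomials in the torus coordinates with coefficients in [O], seen as functions on the
    torus. *)
Definition laurent (F : torus k n -> O) : Prop := exists L : seq (M * O),
  forall t, F t = \sum_(p <- L) c (tch t p.1) * p.2.

Lemma laurent_char q f : laurent (fun t => c (tch t q) * f).
Proof. by exists [:: (q, f)] => t; rewrite big_seq1. Qed.

Lemma laurent_const f : laurent (fun=> f).
Proof. by have [L E] := laurent_char 0 f; exists L => t; rewrite -E tch0 rmorph1 mul1r. Qed.

Lemma laurentD F G : laurent F -> laurent G -> laurent (fun t => F t + G t).
Proof. by move=> [L LE] [L' LE']; exists (L ++ L') => t; rewrite big_cat LE LE'. Qed.

Lemma laurentM F G : laurent F -> laurent G -> laurent (fun t => F t * G t).
Proof.
move=> [L LE] [L' LE']; exists [seq (p.1 + q.1, p.2 * q.2) | p <- L, q <- L'] => t.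
rewrite LE LE' big_allpairs_dep mulr_suml; apply: eq_bigr => p _.
by rewrite mulr_sumr; apply: eq_bigr => q _; rewrite /= tchD rmorphM mulrACA.
Qed.

Lemma laurentX F i : laurent F -> laurent (fun t => F t ^+ i).
Proof.
move=> lF; elim: i => [|i IH]; first exact: laurent_const.
by have [L E] := laurentM lF IH; exists L => t; rewrite exprS.
Qed.

Lemma translate_laurent f : laurent (fun t => translate t f).
Proof.
have [_ _ am] := a_act; have [p pE] := regular_comp am (regular_of f).
pose y t (i : 'I_((n + n) + ambient_dim X)) : O := match fintype.split i with
  | inl j => c (\val (gm t) j) | inr j => coordO X j end.
have yl i : laurent (fun t => y t i).
  rewrite /y; case: (fintype.split i) => [j|j]; last exact: laurent_const.
  suff [q qE] : exists q, forall t, \val (gm t) j = tch t q.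
    by have [L E] := laurent_char q 1; exists L => t; rewrite -E mulr1 qE.
  rewrite /= -[j]splitK; case: (fintype.split j) => l.
    by exists (1%Z *: delta_mx 0 l) => t; rewrite ffunE unsplitK /tch tchar_delta expr1z.
  exists ((-1)%Z *: delta_mx 0 l) => t; rewrite ffunE unsplitK /tch tchar_delta.
  by rewrite -exprN1.
suff [L E] : laurent (fun t => mmap c (y t) p).
  exists L => t; rewrite -E; apply: coord_ring_ext => x.
  have := pE (prod_pt (gm t) x); rewrite /= prod_pt_fst prod_pt_snd => e.
  rewrite -[LHS]/(f (a (gm t) x)) e -[RHS]/(evO x _) rmorph_mmap /meval; apply: eq_bigr => m _.
  congr (_ * _); rewrite /mmap1; apply: eq_bigr => i _; congr (_ ^+ _).
  by rewrite /= /y !ffunE; case: (fintype.split i).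
rewrite /mmap; elim: (msupp p) => [|m l IH].
  by have [L E] := laurent_const 0; exists L => t; rewrite big_nil -E.
suff h : laurent (fun t => c p@_m * mmap1 (y t) m).
  by have [L E] := laurentD h IH; exists L => t; rewrite big_cons -E.
apply: laurentM; first exact: laurent_const.
rewrite /mmap1; elim: (index_enum _) => [|i s IHs].
  by have [L E] := laurent_const 1; exists L => t; rewrite big_nil -E.
by have [L E] := laurentM (laurentX (m i) (yl i)) IHs; exists L => t; rewrite big_cons -E.
Qed.

Local Notation wt := (weight c translate tch).

(** Collect the Laurent expansion of t -> t.f by exponents. Comparing (ts).f with s.(t.f) through
    independence of characters shows that each coefficient is a weight vector; they add up to f at t
    = 1. *)
Lemma toric_weight_dec f : exists (l : seq M) (v : M -> O),
  [/\ uniq l, {in l, forall q, wt q (v q)} & f = \sum_(q <- l) v q].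
Proof.
have [L E] := translate_laurent f.
pose l := undup [seq p.1 | p <- L]; pose v q := \sum_(p <- L | p.1 == q) p.2.
have lE t : translate t f = \sum_(q <- l) c (tch t q) * v q.
  rewrite E; have := sum_regroup [seq (p.1, c (tch t p.1) * p.2) | p <- L].
  rewrite big_map -map_comp => ->; apply: eq_bigr => q _.
  by rewrite big_map mulr_sumr; apply: eq_bigr => p /eqP /= ->.
exists l, v; split; first exact: undup_uniq; last first.
  rewrite -[LHS]translate1 lE; apply: eq_bigr => q _.
  by rewrite /tch tchar_one rmorph1 mul1r.
move=> q ql s; apply/eqP; rewrite -subr_eq0; apply/eqP.
apply: (character_independence (u := fun q => translate s (v q) - c (tch s q) * v q)
  k_char0 (undup_uniq _) _ ql) => t.
have gl := kend_klinear (translate_kend s).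
apply/eqP; rewrite (eq_bigr (fun q => c (tch t q) * translate s (v q) -
   c (tch t q) * (c (tch s q) * v q))) => [|p _]; last by rewrite mulrBr.
rewrite sumrB subr_eq0; apply/eqP; apply/esym.
transitivity (translate (tmul t s) f).
  by rewrite lE; apply: eq_bigr => p _; rewrite /tch tchar_mul rmorphM mulrA.
rewrite -translateM lE (klinear_sum _ _ _ gl); apply: eq_bigr => p _.
by case: gl => _ ->.
Qed.

Lemma orbit_weight q b t : wt q b -> b (a (gm t) x0) = tch t q * b x0.
Proof. by move=> /(_ t) /(congr1 (fun f : O => f x0)). Qed.

(** A function of given weight is determined on the dense orbit by its value at [x0]. *)
Lemma toric_weight_line q b b' : b != 0 -> wt q b -> wt q b' -> exists z, b' = c z * b.
Proof.
move=> b0 bq b'q.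
have orbit_ext (f g : O) : (forall t, f (a (gm t) x0) = g (a (gm t) x0)) -> f = g.
  move=> fg; apply: (dense_ext x0_dense) => _ [s _ <-].
  by have [t <-] := gm_surj s.
have bx0 : b x0 != 0.
  apply: contraNneq b0 => bx0; apply/eqP; apply: orbit_ext => t.
  by rewrite (orbit_weight t bq) bx0 mulr0.
exists (b' x0 / b x0); apply: orbit_ext => t.
rewrite -[RHS]/((b' x0 / b x0) * b (a (gm t) x0)) (orbit_weight t bq) (orbit_weight t b'q).
by rewrite mulrCA divfK.
Qed.

Local Notation Q := (weights c translate tch).

(** Here faithfulness is used. If the weights did not generate the lattice, a primitive form [w]
    would take only multiples of a nonunit [d] on them, and a nontrivial d-th root of unity in the
    one-parameter subgroup of [w] would act trivially. *)
Lemma toric_weights_gen x : exists p q, [/\ Q p, Q q & x = p - q].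
Proof.
have gk := translate_kend.
have [N [q [v [v0 vq qgen]]]] := weights_fg gk tch0 tchD tch_sep toric_weight_dec
  (@coord_generates k X).
have Qq i : Q (q i) by exists (v i).
have Q0 : Q 0 := weights0 gk tch0.
have QD p p' : Q p -> Q p' -> Q (p + p') := weights_add gk tchD (p:=p) (q:=p').
have [|u ->] := @lattice_generation N n q _ x; last first.
  elim/big_ind: _ => [|_ _ [p [p' [Qp Qp' ->]]] [r [r' [Qr Qr' ->]]]|i _].
  - by exists 0, 0; rewrite subrr.
  - exists (p + r), (p' + r'); split; try exact: QD.
    by rewrite opprD [RHS](AC (2*2) ((1*3)*(2*4))).
  have Qn m : Q (q i *+ m) by elim: m => [|m IH]; rewrite ?mulr0n ?mulrS //; apply: QD.
  case: (u i) => m; first by exists (q i *+ m), 0; split=> //; rewrite subr0 -scaler_nat natz.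
  exists 0, (q i *+ m.+1); split=> //.
  by rewrite sub0r NegzE scaleNr -scaler_nat natz.
move=> w d dq [m wm]; apply/eqP; apply: contraT => d1.
have [z [z0 z1 zd]] := root_of_unity k_char0 d1.
pose t := one_ps_pt w z0.
have tq i : tch t (q i) = 1.
  have [e eE] := dq i.
  by rewrite /tch tchar_one_ps // eE mulrC -exprz_exp zd exp1rz.
have tQ p : Q p -> tch t p = 1.
  move=> /qgen[b ->]; elim/big_ind: _ => [|p1 p2 h1 h2|i _]; first exact: tch0.
    by rewrite tchD h1 h2 mulr1.
  by rewrite /tch tcharMn ?[tchar _ _]tq ?expr1n //; apply: (proj2_sig t).
have tid (f : O) : translate t f = f.
  have [l [v' [ul lv ->]]] := toric_weight_dec f.
  rewrite (klinear_sum _ _ _ (kend_klinear (gk t))); apply: eq_big_seq => p pl.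
  have [->|vp] := eqVneq (v' p) 0; first exact: klinear0 (kend_klinear (gk t)).
  by rewrite (lv p pl) tQ ?rmorph1 ?mul1r //; exists (v' p) => //; apply: lv.
have t1 : gm t = torus_one k n.
  apply: a_faithful => y; apply: point_ext => f.
  exact: (congr1 (fun g : O => g y) (tid f)).
case/eqP: z1; rewrite -(expr1z z) -wm -tchar_one_ps // -[LHS]/(tch t m).
rewrite /tch /tchar big1 // => i _; rewrite (_ : sval t i = 1) ?exp1rz //.
have := congr1 (fun s : Gm k n => \val s (lshift n i)) t1.
by rewrite /= !ffunE -[lshift _ i]/(unsplit (inl i)) unsplitK.
Qed.

Lemma toric_variety_basis : lattice_monoid Q /\
  exists Y : M -> O, toric_basis c Q Y /\ forall q, Q q -> wt q (Y q).
Proof.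
split.
  exact (weights_lattice_monoid translate_kend tch0 tchD tch_neq0 tch_sep toric_weight_dec
    toric_weight_line toric_weights_gen X_normal (@coord_generates k X)).
exact (weights_toric_basis translate_kend tch0 tchD tch_sep toric_weight_dec
    toric_weight_line (@coord_generates k X) (@coord_ring_points k X)).
Qed.

(** If every character is a weight, the monomials are units. Those of the basis vectors, normalised
    at [x0], give a morphism to the torus which inverts the orbit map, as density of the orbit
    shows. *)
Lemma toric_weights_proper : ~ is_torus X -> exists m, ~ Q m.
Proof.
move=> X_nt; apply: contrapT => /forallNP h; apply: X_nt; exists n.
have [_ [Y [YB Yw]]] := toric_variety_basis.
have Qall m : Q m by apply: contrapT.
have orbit_pt : is_morphism (fun s : Gm k n => a s x0).
  by apply: action_morphism; [apply: morphism_id|apply: const_morphism].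
pose e (i : 'I_n) : M := 1%Z *: delta_mx 0 i.
have YN m x : Y m x * Y (- m) x = 1.
  have := tbD YB (Qall m) (Qall (- m)); rewrite subrr (tb0 YB).
  by move=> /(congr1 (fun f : O => f x)).
have Y0 m x : Y m x != 0.
  by apply/eqP => e0; have /eqP := YN m x; rewrite e0 mul0r eq_sym oner_eq0.
have torus_f x : torus_pt (fun i => Y (e i) x / Y (e i) x0).
  by move=> i; rewrite mulf_neq0 ?invr_eq0.
pose f x := gm (exist (@torus_pt k n) _ (torus_f x)).
have fm : is_morphism f.
  move=> i; rewrite -[i]splitK; case: (fintype.split i) => j.
    apply: regular_eq (regular_of (c ((Y (e j) x0)^-1) * Y (e j))) => x.
    rewrite /= ffunE -[lshift _ j]/(unsplit (inl j)) unsplitK mulrC.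
    by [].
  apply: regular_eq (regular_of (c (Y (e j) x0) * Y (- e j))) => x.
  rewrite /= ffunE -[rshift _ j]/(unsplit (inr j)) unsplitK invf_div -[LHS]/(Y (e j) x0 * Y (- e j) x).
  by congr (_ * _); apply: (mulfI (Y0 (e j) x)); rewrite YN mulfV.
have forbit s : f (a s x0) = s.
  have [t <-] := gm_surj s; apply: val_inj; apply/ffunP => i; rewrite /= !ffunE.
  have fE j : Y (e j) (a (gm t) x0) / Y (e j) x0 = sval t j.
    by rewrite (orbit_weight t (Yw _ (Qall _))) mulfK // /tch tchar_delta expr1z.
  by case: (fintype.split i) => j; rewrite fE.
exists f; split=> //; exists (fun s => a s x0); split=> // x.
apply: point_ext => g; pose af := action_morphism fm (@const_morphism k X X x0).
have -> : g (a (f x) x0) = pullback af g x by [].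
suff -> : pullback af g = g by [].
apply: (dense_ext x0_dense) => _ [s _ <-].
by rewrite -[LHS]/(g (a (f (a s x0)) x0)) forbit.
Qed.

End ToricVariety.

Theorem corollary4 (k : closedFieldType) (k_char0 : [pchar k] =i pred0)
    (k_uncountable : ~ countable [set: k]) (X Y : irrVariety k)
    (X_normal : normal_variety X) (Y_normal : normal_variety Y)
    (AutXY : exists phi : {multiplicative AutV X -> AutV Y}, bijective phi)
    (X_toric : toric X) (X_not_torus : ~ is_torus X) :
  isomorphic Y X.
Proof.
have [phi [phi' phiK phi'K]] := AutXY.
have [_ [n [a [act faith [x0 [_ dense]]]]]] := X_toric.
have [QM [Z [ZB _]]] := toric_variety_basis k_char0 X_normal act faith dense.
have Qp := toric_weights_proper k_char0 X_normal act faith dense X_not_torus.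
(* [A] recovers the automorphism of X from its action on functions, with the identity as value on
   maps that are not automorphisms. *)
have /choice[A AP] f : exists b : AutV X, kaut (cstO X) f -> aut_pull b = f.
  have [/aut_pull_surj[b bf]|] := pselect (kaut (cstO X) f); first by exists b.
  by exists 1%g.
have AK b : A (aut_pull b) = b by apply: aut_pull_inj; apply: AP; apply: aut_pull_kaut.
pose Phi f := aut_pull (phi (A f)).
have [||||Z' ZB'] := toric_basis_transfer k_char0 k_uncountable QM ZB Qp
  (@coord_generates k X) (@coord_generates k Y) Y_normal (@coord_ring_points k Y) (Phi := Phi).
- by move=> f _; apply: aut_pull_kaut.
(* Pulling back reverses products; [A] reverses them a first time and [aut_pull] a second, so [Phi]
   preserves composition. *)
- move=> f g fk gk; rewrite /Phi -aut_pullM -gmulfM; congr (aut_pull (phi _)).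
  by apply: aut_pull_inj; rewrite aut_pullM !AP //; apply: kaut_comp.
- move=> f g fk gk /aut_pull_inj /(can_inj phiK) /(congr1 (@aut_pull _ X)).
  by rewrite !AP.
- move=> g /aut_pull_surj[b <-]; exists (aut_pull (phi' b)); first exact: aut_pull_kaut.
  by rewrite /Phi AK phi'K.
have [psi [psi' [psic psiK psi'K]]] := toric_basis_iso QM ZB ZB'.
exact: isomorphic_of_hom psic psiK psi'K.
Qed.
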